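(* Let $d\in\{1,2,3\}$, $k\in\{2,3,4\}$, and let $A_\kappa$ be the conjugate operator on $\ell^2(\mathbb{Z}^d)$ with $\kappa_j=k$ for all $1\le j\le d$. The following inclusions hold. Open sets contained in $\boldsymbol{\mu}_{A_\kappa}(\Delta)\cap[0,d]$: - $k=2$: $(0,1)$ for $d=1$; $(1,2)$ for $d=2$; $(2,3)$ for $d=3$. - $k=3$: $[0,1)\setminus\{\frac12\}$ for $d=1$; $\left(\frac12\sqrt{\frac12(5-\sqrt7)},1\right)\cup\left(\frac32,2\right)$ for $d=2$; $\left(\frac52,3\right)$ for $d=3$. - $k=4$: $(0,1)\setminus\{\frac1{\sqrt2}\}$ for $d=1$; $\left(\sqrt{\frac32-\frac1{\sqrt5}},\sqrt2\right)\cup\left(1+\frac{\sqrt2}2,2\right)$ for $d=2$; $\left(2+\frac1{\sqrt2},3\right)$ for $d=3$. Closed sets contained in $[0,d]\setminus\boldsymbol{\mu}_{A_\kappa}(\Delta)$: - $k=2$: $\{0,1\}$ for $d=1$; $[0,1]\cup\{2\}$ for $d=2$; $[0,2]\cup\{3\}$ for $d=3$. - $k=3$: $\{\frac12,1\}$ for $d=1$; $\left[0,\frac12\sqrt{\frac12(5-\sqrt7)}\right]\cup\left[1,\frac32\right]\cup\{2\}$ for $d=2$; $\left[0,\frac52\right]\cup\{3\}$ for $d=3$. - $k=4$: $\{0,\frac1{\sqrt2},1\}$ for $d=1$; $\left[0,\sqrt{\frac32-\frac1{\sqrt5}}\right]\cup\left[\sqrt2,1+\frac{\sqrt2}2\right]\cup\{2\}$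 for $d=2$; $[0,2]\cup\left[\frac3{\sqrt2},2+\frac1{\sqrt2}\right]\cup\{3\}$ for $d=3$.
   Context: On $\ell^2(\mathbb{Z}^d)$, $S_j$ is the shift $(S_ju)(n)=u(n_1,\ldots,n_j-1,\ldots,n_d)$, $\Delta_j=\frac12(S_j+S_j^{-1})$, $\Delta=\sum_{j=1}^d\Delta_j$ (so $\sigma(\Delta)=[-d,d]$), $(N_ju)(n)=n_ju(n)$. For $\kappa=(\kappa_j)$ with positive integer entries, $A_\kappa$ is the self-adjoint closure, from finitely supported sequences, of $\sum_{j=1}^d\frac{1}{4\mathrm{i}}[(S_j^{\kappa_j}-S_j^{-\kappa_j})N_j+N_j(S_j^{\kappa_j}-S_j^{-\kappa_j})]$. $[\Delta,\mathrm{i}A_\kappa]_\circ$ is the bounded extension of the commutator form. $\boldsymbol{\mu}^\pm_{A_\kappa}(\Delta)$ is the set of $E\in\sigma(\Delta)$ for which there are an open interval $I\ni E$ and $\gamma>0$ with $\pm E_I(\Delta)[\Delta,\mathrm{i}A_\kappa]_\circ E_I(\Delta)\ge\gamma E_I(\Delta)$, where $E_I(\Delta)$ is the spectral projection, and $\boldsymbol{\mu}_{A_\kappa}(\Delta)=\boldsymbol{\mu}^+_{A_\kappa}(\Delta)\cup\boldsymbol{\mu}^-_{A_\kappa}(\Delta)$. *)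

(* Defs.v *)
From mathcomp Require Import all_boot all_order all_algebra.
From mathcomp Require Import all_classical all_reals all_analysis.
From mathcomp Require Export complex.
Import Order.TTheory GRing.Theory Num.Theory.
Import numFieldNormedType.Exports.

Set Implicit Arguments.
Unset Strict Implicit.
Unset Printing Implicit Defensive.

Local Open Scope classical_set_scope.
Local Open Scope ring_scope.
Local Open Scope complex_scope.

(* The Hilbert space l^2(Z^d) is the subset [ell2] of the vector space of all
   complex functions on Z^d.  Operators are functions on that vector space; only
   their values on [ell2] matter. *)
Notation lattice_fun R d := ('rV[int]_d -> R[i]).
Notation lattice_op R d := (lattice_fun R d -> lattice_fun R d).

Section Ell2.
Context {R : realType} {d : nat}.
Implicit Types (u v : lattice_fun R d) (T : lattice_op R d).

Definition ell2 : set (lattice_fun R d) :=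
  [set u | (\esum_(n in [set: 'rV[int]_d]) (Normc.normc (u n) ^+ 2)%:E < +oo)%E].

(* Sums over Z^d of absolutely summable families (junk otherwise). *)
Definition rsum (f : 'rV[int]_d -> R) : R :=
  fine (\esum_(n in [set: 'rV[int]_d]) (Num.max (f n) 0)%:E
        - \esum_(n in [set: 'rV[int]_d]) (Num.max (- f n) 0)%:E)%E.

Definition csum (f : 'rV[int]_d -> R[i]) : R[i] :=
  rsum (fun n => complex.Re (f n)) +i* rsum (fun n => complex.Im (f n)).

(* Antilinear in the first argument. *)
Definition inner u v : R[i] := csum (fun n => (u n)^* * v n).

(* Equal to 0 by convention outside [ell2]. *)
Definition ell2_norm u : R := Num.sqrt (rsum (fun n => Normc.normc (u n) ^+ 2)).

Definition ell2_cvg (u_ : nat -> lattice_fun R d) u : Prop :=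
  (fun k => ell2_norm (u_ k - u)) @ \oo --> (0 : R).

Definition finitely_supported u : Prop :=
  finite_set [set n | u n != 0].

Definition bounded_op (T : lattice_op R d) : Prop :=
  [/\ forall u, ell2 u -> ell2 (T u),
      forall (c : R[i]) u v, ell2 u -> ell2 v ->
        T (c *: u + v) = c *: T u + T v
    & exists M : R, forall u, ell2 u -> ell2_norm (T u) <= M * ell2_norm u].

(* The real part of the spectrum of T. *)
Definition spectrum (T : lattice_op R d) : set R :=
  [set x | ~ exists S : lattice_op R d, bounded_op S /\
     forall u, ell2 u -> S (T u - x%:C *: u) = u /\ T (S u) - x%:C *: S u = u].

Definition orthogonal_projection (P : lattice_op R d) : Prop :=
  [/\ bounded_op P,
      forall u, ell2 u -> P (P u) = P u
    & forall u v, ell2 u -> ell2 v -> inner u (P v) = inner (P u) v].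

(* Of the Borel sets of R; the value of P at other sets is irrelevant. *)
Definition projection_valued_measure (P : set R -> lattice_op R d) : Prop :=
  [/\ forall B : set (measurableTypeR R), measurable B -> orthogonal_projection (P B),
      forall u, ell2 u -> P set0 u = 0 /\ P setT u = u,
      forall B1 B2 : set (measurableTypeR R), measurable B1 ->
        measurable B2 -> forall u, ell2 u -> P (B1 `&` B2) u = P B1 (P B2 u)
    & forall F : nat -> set (measurableTypeR R), (forall k, measurable (F k)) ->
        trivIset setT F -> forall u, ell2 u ->
        ell2_cvg (fun m => \sum_(k < m) P (F k) u) (P (\bigcup_k F k) u)].

(* T is the integral of x with respect to P, in the weak sense
   <u, T u> = \int x d<u, P(x) u>. *)
Definition spectral_measure (T : lattice_op R d) (P : set R -> lattice_op R d) :
    Prop :=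
  projection_valued_measure P /\
  forall u, ell2 u ->
  exists mu : {measure set (measurableTypeR R) -> \bar R},
    [/\ forall B : set (measurableTypeR R), measurable B ->
          mu B = (complex.Re (inner u (P B u)))%:E,
        mu.-integrable setT (EFin : measurableTypeR R -> \bar R)
      & inner u (T u) = (\int[mu]_x (x : R))%R%:C].

(* (S_j^m u)(n) = u(n - m e_j), for m in Z. *)
Definition lattice_shift (j : 'I_d) (m : int) : lattice_op R d :=
  fun u n => u (n - delta_mx 0 j *~ m).

Definition Delta_ (j : 'I_d) : lattice_op R d :=
  fun u => 2^-1 *: (lattice_shift j 1 u + lattice_shift j (-1) u).

Definition Delta : lattice_op R d := fun u => \sum_(j < d) Delta_ j u.

Definition position (j : 'I_d) : lattice_op R d :=
  fun u n => (n 0 j)%:~R * u n.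

Definition conjugate_op0 (kappa : 'I_d -> nat) : lattice_op R d := fun u =>
  \sum_(j < d) (4 * 'i%C)^-1 *:
    ((lattice_shift j (kappa j) (position j u)
      - lattice_shift j (- (kappa j)%:Z) (position j u))
     + position j (lattice_shift j (kappa j) u
                   - lattice_shift j (- (kappa j)%:Z) u)).

(* Graph of the closure of [conjugate_op0] on finitely supported functions. *)
Definition conjugate_op (kappa : 'I_d -> nat) :
    set (lattice_fun R d * lattice_fun R d) :=
  [set p | [/\ ell2 p.1, ell2 p.2 &
     exists u_ : nat -> lattice_fun R d,
       [/\ forall k, finitely_supported (u_ k),
           ell2_cvg u_ p.1
         & ell2_cvg (fun k => conjugate_op0 kappa (u_ k)) p.2]]].

(* C is the bounded extension of the form [T, iA] on the domain of A, where T
   is bounded self-adjoint and A is self-adjoint: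
   (iA)^* = -iA gives <u, [T, iA] v> = <T u, i A v> - <- i A u, T v>. *)
Definition commutator_ext (T : lattice_op R d)
    (A : set (lattice_fun R d * lattice_fun R d)) (C : lattice_op R d) : Prop :=
  bounded_op C /\
  forall u Au v Av, A (u, Au) -> A (v, Av) ->
    inner u (C v) = inner (T u) ('i%C *: Av) - inner (- 'i%C *: Au) (T v).

Definition op_ge (X Y : lattice_op R d) : Prop :=
  forall u, ell2 u -> inner u (Y u) <= inner u (X u).

(* [P] is meant to be the spectral measure of [T]. *)
Definition mourre_set_sgn (s : R) (T : lattice_op R d)
    (A : set (lattice_fun R d * lattice_fun R d))
    (P : set R -> lattice_op R d) : set R :=
  [set x | spectrum T x /\
     exists (C : lattice_op R d) (I : set R) (gamma : R),
     [/\ commutator_ext T A C,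
         [/\ open I, is_interval I & I x],
         0 < gamma
       & op_ge (fun u => s%:C *: P I (C (P I u))) (fun u => gamma%:C *: P I u)]].

Definition mourre_set T A P : set R :=
  mourre_set_sgn 1 T A P `|` mourre_set_sgn (-1) T A P.

End Ell2.

(* [k] is the common value of the shift exponents, [d] the dimension. *)
Definition open_part {R : realType} (k d : nat) : set R :=
  match k, d with
  | 2, 1 => `]0, 1[
  | 2, 2 => `]1, 2[
  | 2, 3 => `]2, 3[
  | 3, 1 => `[0, 1[ `\ 2^-1
  | 3, 2 => `]2^-1 * Num.sqrt (2^-1 * (5 - Num.sqrt 7)), 1[ `|` `]3 / 2, 2[
  | 3, 3 => `]5 / 2, 3[
  | 4, 1 => `]0, 1[ `\ (Num.sqrt 2)^-1
  | 4, 2 => `]Num.sqrt (3 / 2 - (Num.sqrt 5)^-1), Num.sqrt 2[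
            `|` `]1 + Num.sqrt 2 / 2, 2[
  | 4, 3 => `]2 + (Num.sqrt 2)^-1, 3[
  | _, _ => set0
  end.

Definition closed_part {R : realType} (k d : nat) : set R :=
  match k, d with
  | 2, 1 => [set 0; 1]
  | 2, 2 => `[0, 1] `|` [set 2]
  | 2, 3 => `[0, 2] `|` [set 3]
  | 3, 1 => [set 2^-1; 1]
  | 3, 2 => `[0, 2^-1 * Num.sqrt (2^-1 * (5 - Num.sqrt 7))]
            `|` `[1, 3 / 2] `|` [set 2]
  | 3, 3 => `[0, 5 / 2] `|` [set 3]
  | 4, 1 => [set 0; (Num.sqrt 2)^-1; 1]
  | 4, 2 => `[0, Num.sqrt (3 / 2 - (Num.sqrt 5)^-1)]
            `|` `[Num.sqrt 2, 1 + Num.sqrt 2 / 2] `|` [set 2]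
  | 4, 3 => `[0, 2] `|` `[3 / Num.sqrt 2, 2 + (Num.sqrt 2)^-1] `|` [set 3]
  | _, _ => set0
  end.

(* Main.v *)
Require Import Defs.
From mathcomp Require Import all_boot all_order all_algebra.
From mathcomp Require Import all_classical all_reals all_analysis.
From mathcomp Require Import cyclic separable cyclotomic.
From mathcomp Require Import ring lra zify.
Import Order.TTheory GRing.Theory Num.Theory.
Import numFieldNormedType.Exports.

Set Implicit Arguments.
Unset Strict Implicit.
Unset Printing Implicit Defensive.

Local Open Scope classical_set_scope.
Local Open Scope ring_scope.
Local Open Scope complex_scope.

(** Let [velocity k x = (T_(k-1) x - T_(k+1) x) / 2 = (1 - x^2) U_(k-1) x], with
    [T] and [U] the Chebyshev polynomials, and [G x = \sum_j velocity k (x j)]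
    for [x] in the cube [[-1, 1]^d].  In Fourier variables [x j = cos xi_j], the
    Laplacian multiplies by [\sum_j x j] and its commutator with [iA] by [G].
    Hence, for [0 <= E <= d], the energy [E] lies in the Mourre set with sign [s]
    exactly when [s * G] is positive on the energy surface of [E], the part of
    the cube where the coordinates add up to [E] ([mourre_necessary],
    [mourre_sufficient]).  The theorem is then a finite list of polynomial
    inequalities.

    Necessity.  A plane wave cut off to a large box is an approximate
    eigenvector of all shifts at once ([approx_joint_eigenvector]).  By
    [pvm_far] it almost lies in the range of the spectral projection of any
    neighbourhood of [E], and there the commutator form is close to [G x].

    Sufficiency.  By compactness [s * G + K * (\sum_j x j - E)^2] is bounded
    below by some [m > 0] on the cube ([penalized_lower_bound]).  Such an
    inequality between symbols is inherited by the operators ([symbol_ge0]): on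
    finitely supported functions this is Plancherel's identity for the discrete
    Fourier transform on a torus large enough to hold the support
    ([plancherel]), and the general case follows by density.  On the spectral
    subspace of a short interval around [E] the penalty is at most
    [m / 2] ([pvm_near]).

    The spectral measure [P] of the Laplacian [T] is given by the weak relation
    [<u, T u> = \int x d<u, P(x) u>] only.  Since [u |-> <u, T u>] is additive
    along disjoint spectral subspaces, the mixed terms vanish ([pvm_cross]), so
    that [T] commutes with [P] and is controlled on each subspace by its
    quadratic form.

    Everything is done with the real inner product [rin], the real part of
    [inner]; imaginary parts are recovered from [inner_rin].

    Signs of [G].  On the top band [d - 1 + h < E < d], where [h] is the largest
    zero of [velocity k] below 1, all coordinates exceed [h] and [G > 0].  For
    [d = 1] the energy surface is the point [E].  For [d = 2] and [k = 3, 4],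
    [G] is, at fixed [s = a + b], a concave quadratic function of [p = a * b]
    (up to a positive factor); its discriminant gives the nested radicals of
    the statement.  On the closed sets, explicit points
    of the energy surface are exhibited at which [G] is nonpositive and
    nonnegative, respectively. *)

(** * Summable families on the lattice *)

Section Rsum.
Context {R : realType} {d : nat}.
Implicit Types (f g : 'rV[int]_d -> R).

Definition abs_summable f : Prop :=
  (\esum_(n in [set: 'rV[int]_d]) `|f n|%:E < +oo)%E.

Lemma abs_summable_le f g :
  (forall n, `|f n| <= g n) -> abs_summable g -> abs_summable f.
Proof.
move=> fg; apply: le_lt_trans; apply: le_esum => n _.
by rewrite lee_fin (le_trans (fg n))// ler_norm.
Qed.

Lemma abs_summableD f g :
  abs_summable f -> abs_summable g -> abs_summable (fun n => f n + g n).
Proof. by move=> sf sg; have := @summableD _ _ _ (EFin \o f) (EFin \o g) sf sg. Qed.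

Local Notation E f := (\esum_(n in [set: 'rV[int]_d]) (f n)%:E).

Local Lemma E_fin f : (forall n, 0 <= f n) -> abs_summable f -> E f \is a fin_num.
Proof.
move=> f0 sf; rewrite ge0_fin_numE; last by apply: esum_ge0 => n _; rewrite lee_fin.
rewrite (le_lt_trans _ sf)//; apply: le_esum => n _.
by rewrite lee_fin ler_norm.
Qed.

Lemma ge0_esumZ (c : R) f : 0 <= c -> (forall n, 0 <= f n) ->
  \esum_(n in [set: 'rV[int]_d]) (c * f n)%:E =
  (c%:E * \esum_(n in [set: 'rV[int]_d]) (f n)%:E)%E.
Proof.
have le c' g : 0 <= c' -> (forall n, 0 <= g n) ->
  (\esum_(n in [set: 'rV[int]_d]) (c' * g n)%:E <=
  c'%:E * \esum_(n in [set: 'rV[int]_d]) (g n)%:E)%E.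
  move=> c0 g0; apply: ge_ereal_sup => _ [X [finX _] <-].
  under eq_fsbigr do rewrite EFinM.
  rewrite -ge0_mule_fsumr => [|n]; last by rewrite lee_fin.
  by rewrite lee_wpmul2l// ereal_sup_ubound//; exists X.
move=> c0 f0; apply/eqP; rewrite eq_le le//=.
have [c00|cn0] := eqVneq c 0.
  by rewrite c00 mul0e; apply: esum_ge0 => n _; rewrite lee_fin mul0r.
have -> : \esum_(n in [set: 'rV[int]_d]) (f n)%:E =
  \esum_(n in [set: 'rV[int]_d]) (c^-1 * (c * f n))%:E.
  by apply: eq_esum => n _; rewrite mulKf.
rewrite -[leRHS]mul1e -(divff cn0) EFinM -muleA.
rewrite lee_wpmul2l ?lee_fin// le ?invr_ge0// => n.
exact: mulr_ge0.
Qed.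

Lemma abs_summableZ (c : R) f : abs_summable f -> abs_summable (fun n => c * f n).
Proof.
rewrite /abs_summable => sf.
under eq_esum do rewrite normrM.
rewrite ge0_esumZ// lte_mul_pinfty ?lee_fin//.
Qed.

Local Lemma big_cons_fun (I : Type) i (r : seq I) (P : pred I) (F : I -> 'rV[int]_d ->
  R) :
  (fun n => \sum_(j <- i :: r | P j) F j n) =
  if P i then (fun n => F i n + \sum_(j <- r | P j) F j n)
  else (fun n => \sum_(j <- r | P j) F j n).
Proof. by case: ifP => Pi; apply/funext => n; rewrite big_cons Pi. Qed.

Lemma abs_summable_sum (I : Type) (r : seq I) (P : pred I) (F : I -> 'rV[int]_d -> R) :
  (forall i, P i -> abs_summable (F i)) ->
  abs_summable (fun n => \sum_(i <- r | P i) F i n).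
Proof.
move=> sF; elim: r => [|i r IH].
  by rewrite /abs_summable esum1 ?ltry// => n _; rewrite big_nil normr0.
rewrite big_cons_fun.
by case: ifPn => // Pi; apply: abs_summableD => //; exact: sF.
Qed.

Lemma rsum_ge0E f : (forall n, 0 <= f n) -> rsum f = fine (E f).
Proof.
move=> f0; rewrite /rsum [X in (_ - X)%E]esum1 ?sube0; last first.
  by move=> n _; rewrite max_r// oppr_le0.
by congr fine; apply: eq_esum => n _; rewrite max_l.
Qed.

Lemma rsum_EFin f : (forall n, 0 <= f n) -> abs_summable f ->
  (rsum f)%:E = E f.
Proof. by move=> f0 sf; rewrite rsum_ge0E// fineK// E_fin. Qed.

Lemma rsum_ge0 f : (forall n, 0 <= f n) -> 0 <= rsum f.
Proof.
move=> f0; rewrite rsum_ge0E// fine_ge0// esum_ge0// => n _.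
by rewrite lee_fin.
Qed.

Local Lemma rsumBpos f g : abs_summable f -> abs_summable g ->
  (forall n, 0 <= f n) -> (forall n, 0 <= g n) ->
  rsum (fun n => f n - g n) = rsum f - rsum g.
Proof.
move=> sf sg f0 g0.
rewrite (rsum_ge0E f0) (rsum_ge0E g0) -fineB ?E_fin//.
have := @esumB _ _ setT (EFin \o f) (EFin \o g) sf sg
  (fun n _ => f0 n) (fun n _ => g0 n).
move=> <-; rewrite /rsum; congr (fine (_ - _)%E); apply: eq_esum => n _.
  by rewrite funeposE EFin_max.
by rewrite funenegE EFin_max.
Qed.

Local Definition posp f n := Num.max (f n) 0.
Local Definition negp f n := Num.max (- f n) 0.

Local Lemma posp_ge0 f n : 0 <= posp f n. Proof. by rewrite /posp le_max lexx orbT. Qed.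
Local Lemma negp_ge0 f n : 0 <= negp f n. Proof. by rewrite /negp le_max lexx orbT. Qed.
Local Hint Resolve posp_ge0 negp_ge0 : core.

Local Lemma pospB f n : f n = posp f n - negp f n.
Proof.
rewrite /posp /negp; have [h|h] := leP 0 (f n).
  by rewrite [X in _ - X]max_r ?subr0// oppr_le0.
by rewrite [X in _ - X]max_l ?sub0r ?opprK// oppr_ge0 ltW.
Qed.

Local Lemma sposp f : abs_summable f -> abs_summable (posp f).
Proof.
apply: le_lt_trans; apply: le_esum => n _; rewrite lee_fin ger0_norm//.
by rewrite /posp ge_max normr_ge0 ler_norm.
Qed.

Local Lemma snegp f : abs_summable f -> abs_summable (negp f).
Proof.
apply: le_lt_trans; apply: le_esum => n _; rewrite lee_fin ger0_norm//.
by rewrite /negp ge_max normr_ge0 -normrN ler_norm.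
Qed.

Local Lemma rsum_posneg f : abs_summable f -> rsum f = rsum (posp f) - rsum (negp f).
Proof.
move=> sf; rewrite -rsumBpos//; [|exact: sposp|exact: snegp].
by congr rsum; apply/funext => n; exact: pospB.
Qed.

Local Lemma rsumDpos f g : abs_summable f -> abs_summable g ->
  (forall n, 0 <= f n) -> (forall n, 0 <= g n) ->
  rsum (fun n => f n + g n) = rsum f + rsum g.
Proof.
move=> sf sg f0 g0.
rewrite !rsum_ge0E// => [|n]; last exact: addr_ge0.
rewrite -fineD ?E_fin//; congr fine.
by rewrite -esumD// => n _; rewrite lee_fin.
Qed.

Lemma rsumD f g : abs_summable f -> abs_summable g ->
  rsum (fun n => f n + g n) = rsum f + rsum g.
Proof.
move=> sf sg; have [sf1 sf2 sg1 sg2] := And4 (sposp sf) (snegp sf) (sposp sg) (snegp sg).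
have -> : (fun n => f n + g n) =
    (fun n => (posp f n + posp g n) - (negp f n + negp g n)).
  by apply/funext => n; rewrite (pospB f) (pospB g); ring.
rewrite rsumBpos; [|exact: abs_summableD|exact: abs_summableD| |]; last 2 first.
  - by move=> n; rewrite addr_ge0.
  - by move=> n; rewrite addr_ge0.
by rewrite !rsumDpos// (rsum_posneg sf) (rsum_posneg sg); ring.
Qed.

Lemma rsum0 : rsum (fun _ : 'rV[int]_d => 0 : R) = 0.
Proof. by rewrite rsum_ge0E// esum1. Qed.

Lemma rsumN f : abs_summable f -> rsum (fun n => - f n) = - rsum f.
Proof.
move=> sf; apply/eqP; rewrite -addr_eq0 -rsumD//.
  by rewrite -rsum0; apply/eqP; congr rsum; apply/funext => n; rewrite addNr.
by rewrite /abs_summable; under eq_esum do rewrite normrN.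
Qed.

Lemma rsumZ (c : R) f : abs_summable f -> rsum (fun n => c * f n) = c * rsum f.
Proof.
have pos c' g : 0 <= c' -> abs_summable g -> (forall n, 0 <= g n) ->
    rsum (fun n => c' * g n) = c' * rsum g.
  move=> c0 sg g0; rewrite !rsum_ge0E// => [|n]; last exact: mulr_ge0.
  by rewrite ge0_esumZ// fineM// E_fin.
have pos' c' g : 0 <= c' -> abs_summable g -> rsum (fun n => c' * g n) = c' * rsum g.
  move=> c0 sg; rewrite (rsum_posneg sg) mulrBr -!pos//; [|exact: snegp|exact: sposp].
  rewrite -rsumBpos; [|exact/abs_summableZ/sposp|exact/abs_summableZ/snegp| |];
    last 2 first.
    - by move=> n; rewrite mulr_ge0.
    - by move=> n; rewrite mulr_ge0.
  by congr rsum; apply/funext => n; rewrite [in LHS](pospB g) mulrBr.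
move=> sf; have [c0|c0] := leP 0 c; first exact: pos'.
rewrite -[c]opprK mulNr -pos' ?oppr_ge0 1?ltW// -rsumN; last exact: abs_summableZ.
by congr rsum; apply/funext => n; rewrite mulNr.
Qed.

Lemma rsum_sum (I : Type) (r : seq I) (P : pred I) (F : I -> 'rV[int]_d -> R) :
  (forall i, P i -> abs_summable (F i)) ->
  rsum (fun n => \sum_(i <- r | P i) F i n) = \sum_(i <- r | P i) rsum (F i).
Proof.
move=> sF; elim: r => [|i r IH].
  by rewrite big_nil -[RHS]rsum0; congr rsum; apply/funext => n; rewrite big_nil.
rewrite big_cons_fun big_cons.
case: ifPn => // Pi; rewrite rsumD ?IH//; first exact: sF.
exact: abs_summable_sum.
Qed.

Lemma ler_rsum f g : abs_summable f -> abs_summable g ->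
  (forall n, f n <= g n) -> rsum f <= rsum g.
Proof.
move=> sf sg fg; rewrite -subr_ge0 -rsumN// -rsumD//.
  by apply: rsum_ge0 => n; rewrite subr_ge0.
by rewrite /abs_summable; under eq_esum do rewrite normrN.
Qed.

Lemma ge0_rsum_eq0 f : (forall n, 0 <= f n) -> abs_summable f ->
  rsum f = 0 -> forall n, f n = 0.
Proof.
move=> f0 sf f00 n; apply/eqP; rewrite eq_le f0 andbT -lee_fin -f00 rsum_EFin//.
rewrite (esumID [set n])// => [|m _]; last by rewrite lee_fin.
rewrite setTI esum_set1 ?lee_fin// leeDl//.
by apply: esum_ge0 => m _; rewrite lee_fin.
Qed.

Lemma abs_summable_bij (h h' : 'rV[int]_d -> 'rV[int]_d) f :
  cancel h h' -> cancel h' h -> abs_summable f -> abs_summable (f \o h).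
Proof.
move=> hK h'K; rewrite /abs_summable (@reindex_esum _ _ _ setT setT h)//.
by rewrite setTT_bijective; exists h'.
Qed.

Lemma rsum_bij (h h' : 'rV[int]_d -> 'rV[int]_d) f :
  cancel h h' -> cancel h' h -> rsum (f \o h) = rsum f.
Proof.
move=> hK h'K; have bh : set_bij setT setT h.
  by rewrite setTT_bijective; exists h'.
rewrite /rsum; congr (fine (_ - _)%E).
  exact: (esym (@reindex_esum R _ _ _ _ h (fun n => (Num.max (f n) 0)%:E) bh)).
exact: (esym (@reindex_esum R _ _ _ _ h (fun n => (Num.max (- f n) 0)%:E) bh)).
Qed.

Lemma abs_summable_delta (m : 'rV[int]_d) (c : R) :
  abs_summable (fun n : 'rV[int]_d => c *+ (n == m)).
Proof.
rewrite /abs_summable (esumID [set m])// setTI esum_set1// eqxx esum1 ?adde0 ?ltry//.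
by move=> n [_ /eqP /negbTE ->]; rewrite normr0.
Qed.

Lemma rsum_delta (m : 'rV[int]_d) (c : R) : rsum (fun n : 'rV[int]_d => c *+ (n == m))
  = c.
Proof.
have pos (c' : R) : 0 <= c' -> rsum (fun n : 'rV[int]_d => c' *+ (n == m)) = c'.
  move=> c0; have h n : 0 <= c' *+ (n == m) by case: eqP.
  rewrite (rsum_ge0E h) (esumID [set m]); last by move=> n _; rewrite lee_fin.
  rewrite setTI esum_set1 ?eqxx// esum1 ?adde0//.
  by move=> n [_ /eqP /negbTE ->].
have [c0|c0] := leP 0 c; first exact: pos.
rewrite -[RHS]opprK -[in RHS](pos (- c)) ?oppr_ge0 1?ltW// -rsumN;
  last exact: abs_summable_delta.
by congr rsum; apply/funext => n; rewrite mulNrn opprK.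
Qed.

Local Lemma finE (F : seq 'rV[int]_d) f : uniq F -> (forall n, n \notin F -> f n = 0) ->
  f = fun n => \sum_(m <- F) f m *+ (n == m).
Proof.
move=> uF f0; apply/funext => n.
have [nF|nF] := boolP (n \in F).
  rewrite (big_rem n)//= eqxx big_seq big1 ?addr0// => m.
  by rewrite mem_rem_uniq// inE => /andP[/negbTE]; rewrite eq_sym => ->.
rewrite f0// big_seq big1// => m mF; case: eqP => // nm.
by move: nF; rewrite nm mF.
Qed.

Lemma abs_summable_finite (F : seq 'rV[int]_d) f : uniq F ->
  (forall n, n \notin F -> f n = 0) -> abs_summable f.
Proof.
move=> uF /(finE uF) ->; apply: abs_summable_sum => m _.
exact: abs_summable_delta.
Qed.

Lemma rsum_finite (F : seq 'rV[int]_d) f : uniq F ->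
  (forall n, n \notin F -> f n = 0) -> rsum f = \sum_(n <- F) f n.
Proof.
move=> uF /(finE uF) ->; rewrite rsum_sum => [|m _]; last exact: abs_summable_delta.
rewrite [RHS]big_seq [LHS]big_seq; apply: eq_bigr => m mF; rewrite rsum_delta.
rewrite (big_rem m)//= eqxx big_seq big1 ?addr0// => n.
by rewrite mem_rem_uniq// inE => /andP[/negbTE]; rewrite eq_sym => ->.
Qed.

End Rsum.

(** * The real inner product on square-summable functions *)

Section Hilbert.
Context {R : realType} {d : nat}.
Implicit Types (u v w : lattice_fun R d) (T : lattice_op R d).

(** The real part of [inner] ([inner_rin]): real bilinearity suffices for all the
    estimates, and the sum is that of one real family. *)
Definition rin u v : R :=
  rsum (fun n => complex.Re (u n) * complex.Re (v n)
                 + complex.Im (u n) * complex.Im (v n)).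

Lemma normc_sqr (z : R[i]) :
  Normc.normc z ^+ 2 = complex.Re z * complex.Re z + complex.Im z * complex.Im z.
Proof.
by case: z => a b; rewrite /= sqr_sqrtr ?addr_ge0 ?sqr_ge0// !expr2.
Qed.

Lemma ell2P u : ell2 u <-> abs_summable (fun n => Normc.normc (u n) ^+ 2).
Proof.
rewrite /ell2 /abs_summable /=;
  under [in X in _ <-> X]eq_esum do rewrite ger0_norm ?sqr_ge0//.
by [].
Qed.

Lemma ell2_le u v w : (forall n, Normc.normc (w n) ^+ 2 <=
    2 * Normc.normc (u n) ^+ 2 + 2 * Normc.normc (v n) ^+ 2) ->
  ell2 u -> ell2 v -> ell2 w.
Proof.
move=> h /ell2P su /ell2P sv; apply/ell2P.
apply: abs_summable_le (abs_summableD (abs_summableZ 2 su) (abs_summableZ 2 sv)).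
by move=> n; rewrite ger0_norm ?sqr_ge0.
Qed.

Lemma ell2D u v : ell2 u -> ell2 v -> ell2 (u + v).
Proof.
apply: ell2_le => n; rewrite !normc_sqr -[(u + v) n]/(u n + v n).
case: (u n) (v n) => [a b] [a' b'] /=; rewrite -subr_ge0.
rewrite (_ : _ - _ = (a - a') ^+ 2 + (b - b') ^+ 2); last by ring.
by rewrite addr_ge0 ?sqr_ge0.
Qed.

Lemma ell2Z (c : R[i]) u : ell2 u -> ell2 (c *: u).
Proof.
move=> /ell2P su; apply/ell2P.
apply: abs_summable_le (abs_summableZ (Normc.normc c ^+ 2) su) => n.
by rewrite ger0_norm ?sqr_ge0// -[(c *: u) n]/(c * u n) Normc.normcM exprMn.
Qed.

Lemma ell2N u : ell2 u -> ell2 (- u).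
Proof. by move=> /(ell2Z (-1)); rewrite scaleN1r. Qed.

Lemma ell2B u v : ell2 u -> ell2 v -> ell2 (u - v).
Proof. by move=> eu /ell2N; exact: ell2D. Qed.

Lemma ell20 : ell2 (0 : lattice_fun R d).
Proof.
apply/ell2P; rewrite /abs_summable esum1 ?ltry// => n _.
by rewrite normc_sqr /= mul0r addr0 normr0.
Qed.

Lemma ell2_sum (I : Type) (r : seq I) (P : pred I) (F : I -> lattice_fun R d) :
  (forall i, P i -> ell2 (F i)) -> ell2 (\sum_(i <- r | P i) F i).
Proof. by move=> h; elim/big_ind: _ => //; [exact: ell20|exact: ell2D]. Qed.

Local Hint Resolve ell2D ell2Z ell2N ell2B ell20 : core.

Lemma rin_summable u v : ell2 u -> ell2 v ->
  abs_summable (fun n => complex.Re (u n) * complex.Re (v n)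
                 + complex.Im (u n) * complex.Im (v n)).
Proof.
move=> /ell2P su /ell2P sv.
apply: abs_summable_le (abs_summableD su sv) => n; rewrite !normc_sqr.
case: (u n) (v n) => [a b] [a' b'] /=.
have h1 := sqr_ge0 (a - a'); have h2 := sqr_ge0 (b - b').
have h3 := sqr_ge0 (a + a'); have h4 := sqr_ge0 (b + b').
by rewrite ler_norml; apply/andP; split; nra.
Qed.

Lemma rinC u v : rin u v = rin v u.
Proof. by congr rsum; apply/funext => n; ring. Qed.

Lemma rinDl u v w : ell2 u -> ell2 v -> ell2 w -> rin (u + v) w = rin u w + rin v w.
Proof.
move=> eu ev ew; rewrite /rin -rsumD; [|exact: rin_summable|exact: rin_summable].
congr rsum; apply/funext => n; rewrite -[(u + v) n]/(u n + v n).
by case: (u n) (v n) => [a b] [a' b'] /=; ring.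
Qed.

Lemma rinZl (c : R) u v : ell2 u -> ell2 v -> rin (c%:C *: u) v = c * rin u v.
Proof.
move=> eu ev; rewrite /rin -rsumZ; last exact: rin_summable.
congr rsum; apply/funext => n; rewrite -[(_ *: u) n]/(_ * u n).
by case: (u n) => [a b] /=; ring.
Qed.

Lemma rinNl u v : ell2 u -> ell2 v -> rin (- u) v = - rin u v.
Proof.
move=> eu ev; have -> : - u = (-1)%:C *: u by rewrite rmorphN rmorph1 scaleN1r.
by rewrite rinZl// mulN1r.
Qed.

Lemma rinBl u v w : ell2 u -> ell2 v -> ell2 w -> rin (u - v) w = rin u w - rin v w.
Proof. by move=> eu ev ew; rewrite rinDl// ?rinNl//; exact: ell2N. Qed.

Lemma rinDr u v w : ell2 u -> ell2 v -> ell2 w -> rin w (u + v) = rin w u + rin w v.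
Proof. by move=> eu ev ew; rewrite rinC rinDl// !(rinC w). Qed.

Lemma rinZr (c : R) u v : ell2 u -> ell2 v -> rin v (c%:C *: u) = c * rin v u.
Proof. by move=> eu ev; rewrite rinC rinZl// (rinC v). Qed.

Lemma rinNr u v : ell2 u -> ell2 v -> rin v (- u) = - rin v u.
Proof. by move=> eu ev; rewrite rinC rinNl// (rinC v). Qed.

Lemma rinBr u v w : ell2 u -> ell2 v -> ell2 w -> rin w (u - v) = rin w u - rin w v.
Proof. by move=> eu ev ew; rewrite rinC rinBl// !(rinC w). Qed.

Lemma rin0l u : rin 0 u = 0.
Proof. by rewrite -[RHS](@rsum0 R d); congr rsum; apply/funext => n /=;
  rewrite !mul0r addr0. Qed.

Lemma rin0r u : rin u 0 = 0.
Proof. by rewrite rinC rin0l. Qed.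

Lemma rin_suml (I : Type) (r : seq I) (P : pred I) (F : I -> lattice_fun R d) v :
  (forall i, P i -> ell2 (F i)) -> ell2 v ->
  rin (\sum_(i <- r | P i) F i) v = \sum_(i <- r | P i) rin (F i) v.
Proof.
move=> h ev; elim: r => [|i r IH]; first by rewrite !big_nil rin0l.
rewrite !big_cons; case: ifPn => // Pi; rewrite rinDl ?IH//; first exact: h.
exact: ell2_sum.
Qed.

Lemma rin_sumr (I : Type) (r : seq I) (P : pred I) (F : I -> lattice_fun R d) v :
  (forall i, P i -> ell2 (F i)) -> ell2 v ->
  rin v (\sum_(i <- r | P i) F i) = \sum_(i <- r | P i) rin v (F i).
Proof. by move=> h ev; rewrite rinC rin_suml//; apply: eq_bigr => i _; rewrite rinC. Qed.

Lemma rin_ge0 u : 0 <= rin u u.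
Proof. by apply: rsum_ge0 => n; rewrite -!expr2 addr_ge0 ?sqr_ge0. Qed.

Lemma rin_eq0 u : ell2 u -> rin u u = 0 -> u = 0.
Proof.
move=> eu u0; apply/funext => n.
have := ge0_rsum_eq0 _ (rin_summable eu eu) u0 n.
rewrite /= -[(0 : lattice_fun R d) n]/(0 : R[i]).
move=> /(_ (fun m => ltac:(by rewrite -!expr2 addr_ge0 ?sqr_ge0))).
case: (u n) => a b /= /eqP; rewrite -!expr2 paddr_eq0 ?sqr_ge0// !sqrf_eq0.
by move=> /andP[/eqP -> /eqP ->].
Qed.

Lemma ell2_norm_sqr u : ell2_norm u ^+ 2 = rin u u.
Proof.
rewrite /ell2_norm sqr_sqrtr.
  by congr rsum; apply/funext => n; rewrite normc_sqr.
by apply: rsum_ge0 => n; rewrite sqr_ge0.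
Qed.

Lemma ell2_norm_ge0 u : 0 <= ell2_norm u.
Proof. exact: sqrtr_ge0. Qed.

Lemma ell2_normE u : ell2_norm u = Num.sqrt (rin u u).
Proof. by rewrite -ell2_norm_sqr sqrtr_sqr ger0_norm// ell2_norm_ge0. Qed.

Lemma rin_sqr_le u v : ell2 u -> ell2 v -> rin u v ^+ 2 <= rin u u * rin v v.
Proof.
move=> eu ev; have [v0|v0] := eqVneq (rin v v) 0.
  by rewrite (rin_eq0 ev v0) rin0l rin0r expr0n mulr0.
have vp : 0 < rin v v by rewrite lt_neqAle eq_sym v0 rin_ge0.
have := rin_ge0 ((rin v v)%:C *: u - (rin u v)%:C *: v).
rewrite rinBl ?rinBr ?rinZl ?rinZr; try (by auto).
rewrite (rinC v u) => h.
rewrite -subr_ge0 -(pmulr_rge0 _ vp); move: h; congr (_ <= _); ring.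
Qed.

Lemma ler_rin u v : ell2 u -> ell2 v -> `|rin u v| <= ell2_norm u * ell2_norm v.
Proof.
move=> eu ev; rewrite !ell2_normE -sqrtrM ?rin_ge0// -sqrtr_sqr.
by rewrite ler_wsqrtr// rin_sqr_le.
Qed.

Lemma ell2_normD u v : ell2 u -> ell2 v -> ell2_norm (u + v) <= ell2_norm u + ell2_norm v.
Proof.
move=> eu ev; rewrite -(@ler_pXn2r _ 2)// ?nnegrE ?addr_ge0 ?ell2_norm_ge0//.
rewrite sqrrD !ell2_norm_sqr rinDl ?rinDr; try (by auto).
have := ler_rin eu ev; rewrite ler_norml => /andP[_ h].
by rewrite (rinC v u); lra.
Qed.

Lemma ell2_norm0 : ell2_norm (0 : lattice_fun R d) = 0.
Proof. by rewrite ell2_normE rin0l sqrtr0. Qed.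

(** Multiplication by a complex number of modulus 1 is an isometry; used for the
    phases of plane waves and for the imaginary unit. *)
Lemma rin_unimod (c : R[i]) u v : Normc.normc c = 1 -> rin (c *: u) (c *: v) = rin u v.
Proof.
move=> c1; congr rsum; apply/funext => n.
rewrite -[(_ *: u) n]/(_ * u n) -[(_ *: v) n]/(_ * v n).
have := normc_sqr c; rewrite c1 expr1n.
case: c c1 (u n) (v n) => [c c'] _ [a b] [a' b'] /= h.
transitivity ((c * c + c' * c') * (a * a' + b * b')); first ring.
by rewrite -h mul1r.
Qed.

Lemma ell2_norm_unimod (c : R[i]) u : Normc.normc c = 1 ->
  ell2_norm (c *: u) = ell2_norm u.
Proof. by move=> c1; rewrite !ell2_normE rin_unimod. Qed.

Lemma ell2_normZ (c : R) u : ell2 u -> ell2_norm (c%:C *: u) = `|c| * ell2_norm u.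
Proof.
move=> eu; rewrite !ell2_normE rinZl ?rinZr//; last exact: ell2Z.
by rewrite mulrA -expr2 sqrtrM ?sqr_ge0// sqrtr_sqr.
Qed.

Lemma ell2_normN u : ell2_norm (- u) = ell2_norm u.
Proof.
have -> : - u = (-1) *: u by rewrite scaleN1r.
by rewrite ell2_norm_unimod//= oppr0 expr0n addr0 sqrrN expr1n sqrtr1.
Qed.

Lemma ell2_norm_sum (I : Type) (r : seq I) (P : pred I) (F : I -> lattice_fun R d) :
  (forall i, P i -> ell2 (F i)) ->
  ell2_norm (\sum_(i <- r | P i) F i) <= \sum_(i <- r | P i) ell2_norm (F i).
Proof.
move=> h; elim: r => [|i r IH]; first by rewrite !big_nil ell2_norm0.
rewrite !big_cons; case: ifPn => // Pi; apply: le_trans (ell2_normD _ _) _.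
- exact: h.
- exact: ell2_sum.
- by rewrite lerD2l.
Qed.

(** Imaginary parts are real parts against [i u], so that identities for [rin]
    which are stable under [u |-> i u] are identities for [inner]. *)
Lemma inner_rin u v : inner u v = rin u v +i* rin ('i *: u) v.
Proof.
rewrite /inner /csum; congr (_ +i* _); congr rsum; apply/funext => n.
  by case: (u n) (v n) => [a b] [a' b'] /=; ring.
rewrite -[(_ *: u) n]/(_ * u n).
by case: (u n) (v n) => [a b] [a' b'] /=; ring.
Qed.

(** The imaginary part of [inner u u] vanishes. *)
Lemma rin_i_diag u : rin ('i *: u) u = 0.
Proof.
rewrite -[RHS](@rsum0 R d); congr rsum; apply/funext => n.
rewrite -[(_ *: u) n]/(_ * u n).
by case: (u n) => [a b] /=; ring.
Qed.

Lemma rin_ii u v : rin ('i *: u) ('i *: v) = rin u v.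
Proof. by apply: rin_unimod; rewrite /= expr0n add0r expr1n sqrtr1. Qed.

Lemma ell2_cvg_rin (u_ v_ : nat -> lattice_fun R d) u v :
  (forall k, ell2 (u_ k)) -> (forall k, ell2 (v_ k)) -> ell2 u -> ell2 v ->
  ell2_cvg u_ u -> ell2_cvg v_ v -> (fun k => rin (u_ k) (v_ k)) @ \oo --> rin u v.
Proof.
move=> eu_ ev_ eu ev cu cv.
have bnd k : `|rin u v - rin (u_ k) (v_ k)| <=
    ell2_norm (u_ k - u) * ell2_norm (v_ k - v)
    + ell2_norm (u_ k - u) * ell2_norm v + ell2_norm u * ell2_norm (v_ k - v).
  have -> : rin u v - rin (u_ k) (v_ k) =
     - (rin (u_ k - u) (v_ k - v) + rin (u_ k - u) v + rin u (v_ k - v)).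
    by rewrite !rinBl ?rinBr; try (by auto); ring.
  rewrite normrN (le_trans (ler_normD _ _))// lerD ?ler_rin//; try (by auto).
  by rewrite (le_trans (ler_normD _ _))// lerD ?ler_rin//; auto.
apply/cvgrPdist_le => e e0.
have : (fun k => ell2_norm (u_ k - u) * ell2_norm (v_ k - v)
    + ell2_norm (u_ k - u) * ell2_norm v + ell2_norm u * ell2_norm (v_ k - v)) @ \oo
    --> 0 * 0 + 0 * ell2_norm v + ell2_norm u * 0.
  apply: cvgD; [apply: cvgD; [exact: cvgM|]|].
    exact: cvgMl.
  exact: cvgMr.
rewrite !(mul0r, mulr0) !addr0 => /cvgrPdist_le/(_ e e0).
apply: filterS => k; rewrite sub0r normrN => h.
by rewrite (le_trans (bnd k))// (le_trans (ler_norm _)).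
Qed.

Lemma bounded_op_cvg T (u_ : nat -> lattice_fun R d) u : bounded_op T ->
  (forall k, ell2 (u_ k)) -> ell2 u -> ell2_cvg u_ u -> ell2_cvg (T \o u_) (T u).
Proof.
move=> [Te Tl [M TM]] eu_ eu cu.
apply/cvgrPdist_le => e e0.
have : (fun k => M * ell2_norm (u_ k - u)) @ \oo --> M * 0 by exact: cvgMr.
rewrite mulr0 => /cvgrPdist_le/(_ e e0).
apply: filterS => k; rewrite !sub0r !normrN => h.
have -> : (T \o u_) k - T u = T (u_ k - u).
  have -> : u_ k - u = (-1) *: u + u_ k by rewrite scaleN1r addrC.
  by rewrite /= Tl// scaleN1r addrC.
rewrite ger0_norm ?ell2_norm_ge0// (le_trans (TM _ _))//; first by auto.
by rewrite (le_trans (ler_norm _)).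
Qed.

Section Bounded.
Variable T : lattice_op R d.
Hypothesis bT : bounded_op T.
Lemma bounded_opD u v : ell2 u -> ell2 v -> T (u + v) = T u + T v.
Proof. by move=> eu ev; case: bT => _ Tl _; rewrite -[u]scale1r Tl// !scale1r. Qed.
Lemma bounded_op0 : T 0 = 0.
Proof.
have := bounded_opD ell20 ell20; rewrite addr0 => /eqP.
by rewrite -subr_eq0 opprD addrA subrr sub0r oppr_eq0 => /eqP.
Qed.
Lemma bounded_opZ c u : ell2 u -> T (c *: u) = c *: T u.
Proof.
by move=> eu; case: bT => _ Tl _; rewrite -[c *: u]addr0 Tl// bounded_op0 addr0.
Qed.
Lemma bounded_opN u : ell2 u -> T (- u) = - T u.
Proof. by move=> eu; rewrite -scaleN1r bounded_opZ// scaleN1r. Qed.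
Lemma bounded_opB u v : ell2 u -> ell2 v -> T (u - v) = T u - T v.
Proof. by move=> eu ev; rewrite bounded_opD ?bounded_opN//; exact: ell2N. Qed.
Lemma bounded_op_ell2 u : ell2 u -> ell2 (T u).
Proof. by case: bT => h _ _; exact: h. Qed.
Lemma bounded_op_bound : exists2 M, 0 <= M & forall u, ell2 u ->
  ell2_norm (T u) <= M * ell2_norm u.
Proof.
case: bT => _ _ [M TM]; exists `|M| => // u eu; rewrite (le_trans (TM u eu))//.
by rewrite ler_wpM2r ?ell2_norm_ge0// ler_norm.
Qed.
End Bounded.

Lemma bounded_op_add T T' : bounded_op T -> bounded_op T' ->
  bounded_op (fun u => T u + T' u).
Proof.
move=> bT bT'; have [M M0 TM] := bounded_op_bound bT.
have [M' M'0 TM'] := bounded_op_bound bT'; split.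
- by move=> u eu; exact: ell2D (bounded_op_ell2 bT eu) (bounded_op_ell2 bT' eu).
- move=> c u v eu ev;
  rewrite (bounded_opD bT (ell2Z c eu) ev) (bounded_opD bT' (ell2Z c eu) ev).
  by rewrite (bounded_opZ bT c eu) (bounded_opZ bT' c eu) scalerDr addrACA.
- exists (M + M') => u eu; rewrite mulrDl.
  have h := ell2_normD (bounded_op_ell2 bT eu) (bounded_op_ell2 bT' eu).
  exact: le_trans h (lerD (TM u eu) (TM' u eu)).
Qed.

Lemma bounded_op_scale (a : R) T : bounded_op T -> bounded_op (fun u => a%:C *: T u).
Proof.
move=> bT; have [M M0 TM] := bounded_op_bound bT; split.
- by move=> u eu; exact: ell2Z (bounded_op_ell2 bT eu).
- move=> c u v eu ev; rewrite (bounded_opD bT (ell2Z c eu) ev) (bounded_opZ bT c eu).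
  by rewrite scalerDr !scalerA mulrC.
- exists (`|a| * M) => u eu; rewrite (ell2_normZ _ (bounded_op_ell2 bT eu)).
  by rewrite -mulrA; apply: ler_wpM2l => //; exact: TM.
Qed.

Lemma bounded_op_zero : bounded_op (fun=> 0 : lattice_fun R d).
Proof.
split; [by move=> u _; exact: ell20|by move=> c u v _ _; rewrite scaler0 addr0|].
by exists 0 => u _; rewrite ell2_norm0 mul0r.
Qed.

Lemma bounded_op_sum (I : Type) (r : seq I) (F : I -> lattice_op R d) :
  (forall i, bounded_op (F i)) -> bounded_op (fun u => \sum_(i <- r) F i u).
Proof.
move=> bF; elim: r => [|i r IH].
  rewrite (_ : (fun u => _) = fun=> 0); first exact: bounded_op_zero.
  by apply/funext => u; rewrite big_nil.
rewrite (_ : (fun u => _) = fun u => F i u + \sum_(i <- r) F i u).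
  exact: bounded_op_add.
by apply/funext => u; rewrite big_cons.
Qed.

End Hilbert.

(** * Finitely supported functions and lattice shifts *)

Section Finite.
Context {R : realType} {d : nat}.
Implicit Types (u v w : lattice_fun R d) (T : lattice_op R d).

Lemma finitely_supportedP u : finitely_supported u <->
  exists2 F : seq 'rV[int]_d, uniq F & forall n, n \notin F -> u n = 0.
Proof.
split=> [fu|[F uF F0]].
  exists (finmap.enum_fset (fset_set [set n | u n != 0])); first exact: finmap.fset_uniq.
  move=> n; rewrite in_fset_set// => /negP h; apply/eqP; apply: contrapT => un.
  by apply: h; rewrite inE /=; apply/negP.
apply: (@sub_finite_set _ _ [set` F]); last exact: finite_seq.
by move=> n /= un; apply: contrapT => /negP/F0 /eqP; apply/negP.
Qed.

Lemma finitely_supported_ell2 u : finitely_supported u -> ell2 u.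
Proof.
move=> /finitely_supportedP[F uF F0]; apply/ell2P;
  apply: (abs_summable_finite uF) => n nF.
by rewrite F0// normc_sqr/= mulr0 addr0.
Qed.

Definition restrict (F : seq 'rV[int]_d) u : lattice_fun R d :=
  fun n => if n \in F then u n else 0.

Lemma finitely_supported_restrict F u : uniq F -> finitely_supported (restrict F u).
Proof.
by move=> uF; apply/finitely_supportedP; exists F => // n /negbTE;
  rewrite /restrict => ->.
Qed.

(** The sum of squares is a supremum over finite sets, and the square of the
    distance to a restriction is the part of that sum off the finite set. *)
Lemma restrict_approx u (e : R) : ell2 u -> 0 < e ->
  exists2 F : seq 'rV[int]_d, uniq F & ell2_norm (restrict F u - u) <= e.
Proof.
move=> eu e0; have su := (ell2P u).1 eu.
pose f n := Normc.normc (u n) ^+ 2.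
have f0 n : 0 <= f n by rewrite sqr_ge0.
have Efin := rsum_EFin f0 su.
have : \esum_(n in [set: 'rV[int]_d]) (f n)%:E \is a fin_num by rewrite -Efin.
move=> /(ub_ereal_sup_adherent (exprn_gt0 2 e0))[_ [X [finX _] <-]].
rewrite -[ereal_sup _]/(\esum_(n in [set: 'rV[int]_d]) (f n)%:E) -Efin.
rewrite fsbig_finite//= sumEFin -EFinB lte_fin => h.
pose F : seq 'rV[int]_d := finmap.enum_fset (fset_set X).
have uF : uniq F by exact: finmap.fset_uniq.
exists F => //.
have ef : ell2 (restrict F u).
  exact/finitely_supported_ell2/finitely_supported_restrict.
rewrite -(@ler_pXn2r _ 2)// ?nnegrE ?ell2_norm_ge0 ?(ltW e0)// ell2_norm_sqr.
have E1 : rin (restrict F u) (restrict F u) = \sum_(n <- F) f n.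
  rewrite /rin (rsum_finite uF); last first.
    by move=> n /negbTE nF; rewrite /restrict nF /= mulr0 addr0.
  rewrite big_seq [RHS]big_seq; apply: eq_bigr => n nF.
  by rewrite /f normc_sqr /restrict nF.
have E2 : rin (restrict F u) u = \sum_(n <- F) f n.
  rewrite -E1; congr rsum; apply/funext => n.
  by rewrite /restrict; case: ifP => //= _; rewrite !mul0r.
have E3 : rin u u = rsum f by congr rsum; apply/funext => n; rewrite /f normc_sqr.
rewrite rinBl ?rinBr//; try (exact: ell2B).
rewrite (rinC u (restrict F u)) E1 E2 E3 subrr sub0r opprB.
by move: h; rewrite ltrBlDr -ltrBlDl => /ltW.
Qed.

Lemma finitely_supported_dense u : ell2 u ->
  exists2 u_ : nat -> lattice_fun R d,
    forall k, finitely_supported (u_ k) & ell2_cvg u_ u.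
Proof.
move=> eu.
have /choice[F hF] k : exists F : seq 'rV[int]_d,
    uniq F /\ ell2_norm (restrict F u - u) <= k.+1%:R^-1.
  have [|F uF h] := @restrict_approx u k.+1%:R^-1 eu; first by rewrite invr_gt0.
  by exists F.
exists (fun k => restrict (F k) u).
  by move=> k; apply: finitely_supported_restrict; case: (hF k).
apply: (@squeeze_cvgr _ _ _ _ (fun=> 0) (fun k => k.+1%:R^-1)).
- by near=> k; rewrite ell2_norm_ge0 /=; case: (hF k).
- exact: cvg_cst.
- exact: cvg_harmonic.
Unshelve. all: end_near. Qed.

End Finite.

Section Shift.
Context {R : realType} {d : nat}.
Implicit Types (u v w : lattice_fun R d) (T : lattice_op R d).

Lemma ell2_shift j m u : ell2 u -> ell2 (lattice_shift j m u).
Proof.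
move=> /ell2P su; apply/ell2P.
apply: (@abs_summable_bij _ _ (fun n => n - delta_mx 0 j *~ m)
  (fun n => n + delta_mx 0 j *~ m)) su => n; [exact: subrK|exact: addrK].
Qed.

Lemma rin_shift j m u v : rin (lattice_shift j m u) (lattice_shift j m v) = rin u v.
Proof.
apply: (@rsum_bij _ _ (fun n => n - delta_mx 0 j *~ m)
  (fun n => n + delta_mx 0 j *~ m)
  (fun n => complex.Re (u n) * complex.Re (v n) + complex.Im (u n) * complex.Im (v n))).
- by move=> n; rewrite subrK.
- by move=> n; rewrite addrK.
Qed.

Lemma lattice_shiftD j m l u :
  lattice_shift j m (lattice_shift j l u) = lattice_shift j (m + l) u.
Proof. by apply/funext => n; rewrite /lattice_shift mulrzDr opprD addrA. Qed.

Lemma lattice_shift0 j u : lattice_shift j 0 u = u.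
Proof. by apply/funext => n; rewrite /lattice_shift mulr0z subr0. Qed.

Lemma rin_shift_adj j m u v : rin (lattice_shift j m u) v = rin u (lattice_shift j (-
  m) v).
Proof. by rewrite -(rin_shift j (- m)) lattice_shiftD addNr lattice_shift0. Qed.

Lemma ell2_norm_shift j m u : ell2_norm (lattice_shift j m u) = ell2_norm u.
Proof. by rewrite !ell2_normE rin_shift. Qed.

Lemma bounded_op_shift j m : bounded_op (@lattice_shift R d j m).
Proof.
split; [by move=> u; exact: ell2_shift|by []|].
by exists 1 => u _; rewrite ell2_norm_shift mul1r.
Qed.

Lemma half_complex : (2^-1 : R[i]) = (2^-1)%:C.
Proof. by rewrite fmorphV rmorph_nat. Qed.

Lemma bounded_op_Delta_ j : bounded_op (@Delta_ R d j).
Proof.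
have : bounded_op (fun u => (2^-1)%:C *: (lattice_shift j 1 u + lattice_shift j (-1) u)).
  by apply/bounded_op_scale/bounded_op_add; exact: bounded_op_shift.
by rewrite -half_complex.
Qed.

Lemma bounded_op_Delta : bounded_op (@Delta R d).
Proof. by apply: bounded_op_sum => j; exact: bounded_op_Delta_. Qed.

Lemma rin_Delta u v : ell2 u -> ell2 v -> rin (Delta u) v = rin u (Delta v).
Proof.
move=> eu ev; rewrite /Delta rin_suml ?rin_sumr//; last 2 first.
- by move=> j _; exact: (bounded_op_ell2 (bounded_op_Delta_ j)).
- by move=> j _; exact: (bounded_op_ell2 (bounded_op_Delta_ j)).
apply: eq_bigr => j _; rewrite /Delta_ half_complex.
have es w m : ell2 w -> ell2 (lattice_shift j m w) by exact: ell2_shift.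
rewrite rinZl ?rinZr ?rinDl ?rinDr; try by auto using ell2D.
by rewrite !rin_shift_adj opprK [X in _ * X = _]addrC.
Qed.

(** The commutator of the Laplacian with [iA].  Its symbol is the sum over [j] of
    [sin xi_j * sin (k xi_j) = (cos ((k - 1) xi_j) - cos ((k + 1) xi_j)) / 2],
    hence the four shifts. *)
Definition commutator_op (k : nat) : lattice_op R d := fun u =>
  \sum_(j < d) (4^-1)%:C *:
    ((lattice_shift j (k%:Z - 1) u + lattice_shift j (- (k%:Z - 1)) u)
   - (lattice_shift j (k%:Z + 1) u + lattice_shift j (- (k%:Z + 1)) u)).

Lemma bounded_op_commutator k : bounded_op (commutator_op k).
Proof.
apply: bounded_op_sum => j; apply: bounded_op_scale.
have -> : (fun u => lattice_shift j (k%:Z - 1) u + lattice_shift j (- (k%:Z - 1)) u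
   - (lattice_shift j (k%:Z + 1) u + lattice_shift j (- (k%:Z + 1)) u)) =
  (fun u : lattice_fun R d => lattice_shift j (k%:Z - 1) u + lattice_shift j (- (k%:Z -
    1)) u
   + (-1)%:C *: (lattice_shift j (k%:Z + 1) u + lattice_shift j (- (k%:Z + 1)) u)).
  by apply/funext => u; rewrite rmorphN rmorph1 scaleN1r.
apply: bounded_op_add; first by apply: bounded_op_add; exact: bounded_op_shift.
by apply/bounded_op_scale/bounded_op_add; exact: bounded_op_shift.
Qed.

End Shift.

(** * The commutator of the Laplacian with the conjugate operator *)

Section Conjugate.
Context {R : realType} {d : nat}.
Implicit Types (u v w : lattice_fun R d) (T : lattice_op R d).

Lemma finitely_supported_shift j m u :
  finitely_supported u -> finitely_supported (lattice_shift j m u).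
Proof.
move=> /finitely_supportedP[F uF F0]; apply/finitely_supportedP.
exists [seq n + delta_mx 0 j *~ m | n <- F].
  by rewrite map_inj_uniq//; exact: addIr.
move=> n /mapP nF; apply: F0; apply/negP => h; apply: nF.
by eexists; [exact: h|rewrite subrK].
Qed.

Lemma finitely_supported_lift (f : R[i] -> R[i] -> 'rV[int]_d -> R[i]) u v :
  (forall n, f 0 0 n = 0) -> finitely_supported u -> finitely_supported v ->
  finitely_supported (fun n => f (u n) (v n) n).
Proof.
move=> f0 /finitely_supportedP[F uF F0] /finitely_supportedP[G uG G0].
apply/finitely_supportedP; exists (undup (F ++ G)); first exact: undup_uniq.
move=> n; rewrite mem_undup mem_cat negb_or => /andP[/F0 -> /G0 ->].
exact: f0.
Qed.

Lemma finitely_supportedD u v : finitely_supported u -> finitely_supported v ->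
  finitely_supported (u + v).
Proof. by apply: (@finitely_supported_lift (fun a b _ => a + b)) => n; rewrite addr0. Qed.

Lemma finitely_supportedB u v : finitely_supported u -> finitely_supported v ->
  finitely_supported (u - v).
Proof. by apply: (@finitely_supported_lift (fun a b _ => a - b)) => n; rewrite subr0. Qed.

Lemma finitely_supportedZ c u : finitely_supported u -> finitely_supported (c *: u).
Proof.
by move=> fu; apply: (@finitely_supported_lift (fun a _ _ => c * a) u u) => // n;
  rewrite mulr0.
Qed.

Lemma finitely_supported_position j u :
  finitely_supported u -> finitely_supported (position j u).
Proof.
move=> fu; apply: (@finitely_supported_lift (fun a _ n => (n 0 j)%:~R * a) u u) => // n.
by rewrite mulr0.
Qed.

Lemma finitely_supported0 : finitely_supported (0 : lattice_fun R d).
Proof. by apply/finitely_supportedP; exists [::]. Qed.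

Lemma finitely_supported_sum (I : Type) (r : seq I) (F : I -> lattice_fun R d) :
  (forall i, finitely_supported (F i)) -> finitely_supported (\sum_(i <- r) F i).
Proof.
by move=> h; elim/big_ind: _ => //;
  [exact: finitely_supported0|exact: finitely_supportedD].
Qed.

(** The summand with index [j] of [iA], on finitely supported functions; the
    factor [i] makes its coefficients real. *)
Definition iconj_ (k : nat) (j : 'I_d) : lattice_op R d := fun u =>
  (4^-1)%:C *:
    ((lattice_shift j k (position j u) - lattice_shift j (- k%:Z) (position j u))
     + position j (lattice_shift j k u - lattice_shift j (- k%:Z) u)).

Definition iconj (k : nat) : lattice_op R d := fun u => \sum_(j < d) iconj_ k j u.

Lemma iconjE k u : 'i%C *: conjugate_op0 (fun=> k) u = iconj k u.
Proof.
rewrite /conjugate_op0 scaler_sumr; apply: eq_bigr => j _.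
rewrite scalerA /iconj_; congr (_ *: _).
have i0 : 'i%C != 0 :> R[i] by rewrite eq_complex /= oner_eq0 andbF.
by rewrite invfM mulrCA mulfV// mulr1 fmorphV rmorph_nat.
Qed.

Lemma finitely_supported_iconj_ k j u : finitely_supported u ->
  finitely_supported (iconj_ k j u).
Proof.
move=> fu; apply: finitely_supportedZ; apply: finitely_supportedD.
  by apply: finitely_supportedB;
    apply/finitely_supported_shift/finitely_supported_position.
by apply/finitely_supported_position/finitely_supportedB; exact: finitely_supported_shift.
Qed.

Lemma finitely_supported_iconj k u : finitely_supported u ->
  finitely_supported (iconj k u).
Proof. by move=> fu; apply: finitely_supported_sum => j;
  exact: finitely_supported_iconj_. Qed.

Lemma finitely_supported_conj0 k u : finitely_supported u ->
  finitely_supported (conjugate_op0 (fun=> k) u).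
Proof.
move=> fu; have -> : conjugate_op0 (fun=> k) u = (- 'i%C) *: iconj k u.
  by rewrite -iconjE scalerA mulNr -expr2 sqr_i opprK scale1r.
exact/finitely_supportedZ/finitely_supported_iconj.
Qed.

Lemma finitely_supported_Delta u : finitely_supported u -> finitely_supported (Delta u).
Proof.
move=> fu; apply: finitely_supported_sum => j; apply: finitely_supportedZ.
by apply: finitely_supportedD; exact: finitely_supported_shift.
Qed.

Lemma rin_position j u v : rin (position j u) v = rin u (position j v).
Proof.
congr rsum; apply/funext => n; rewrite /position.
have -> : ((n 0 j)%:~R : R[i]) = ((n 0 j)%:~R)%:C by rewrite rmorph_int.
by case: (u n) (v n) => [a b] [a' b'] /=; ring.
Qed.

Lemma positionB j u v : position j (u - v) = position j u - position j v.
Proof. by apply/funext => n; exact: mulrBr. Qed.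

(** Shifts are unitary and the position operator is symmetric, so exchanging the
    order of the factors reverses the sign of [S^k - S^(-k)]. *)
Lemma rin_iconj_ k j u v : finitely_supported u -> finitely_supported v ->
  rin (iconj_ k j u) v = - rin u (iconj_ k j v).
Proof.
move=> fu fv.
have fe w : finitely_supported w -> ell2 w by exact: finitely_supported_ell2.
have fs m w : finitely_supported w -> finitely_supported (lattice_shift j m w).
  exact: finitely_supported_shift.
have fp w : finitely_supported w -> finitely_supported (position j w).
  exact: finitely_supported_position.
have fl w : finitely_supported w -> ell2 (iconj_ k j w).
  by move=> fw; exact/fe/finitely_supported_iconj_.
rewrite /iconj_ !positionB.
rewrite rinZl ?rinZr; try by auto 10 using ell2D, ell2B.
rewrite rinDl ?rinDr; try by auto 10 using ell2D, ell2B, ell2N.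
rewrite !rinBl ?rinBr; try by auto 10 using ell2D, ell2B, ell2N.
rewrite !rin_position !rin_shift_adj !rin_position opprK.
rewrite !rinNr; try by auto.
ring.
Qed.

Lemma rin_iconj k u v : finitely_supported u -> finitely_supported v ->
  rin (iconj k u) v = - rin u (iconj k v).
Proof.
move=> fu fv; have fe w : finitely_supported w ->
  ell2 w by exact: finitely_supported_ell2.
rewrite rin_suml ?rin_sumr; try by auto using finitely_supported_iconj_.
by rewrite -sumrN; apply: eq_bigr => j _; exact: rin_iconj_.
Qed.

(** Source of the commutator: a shift along [e_j] changes the [j]-th position by
    a constant and leaves the other positions alone. *)
Lemma coord_translate (n : 'rV[int]_d) i j m :
  (n - delta_mx 0 j *~ m) 0 i = n 0 i - m *+ (i == j).
Proof.
have -> : (delta_mx 0 j *~ m : 'rV[int]_d) = m *: delta_mx 0 j.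
  by rewrite -scaler_int intz.
by rewrite !mxE eqxx /= mulr_natr.
Qed.

Lemma lattice_shift_iconj_ k i j m u :
  lattice_shift i m (iconj_ k j u) - iconj_ k j (lattice_shift i m u) =
  ((i == j)%:R * - (m%:~R / 2)) *:
    (lattice_shift i m (lattice_shift j k u) - lattice_shift i m (lattice_shift j (-
      k%:Z) u)).
Proof.
have iE w n : iconj_ k j w n = 4^-1 *
  ((2 * (n 0 j)%:~R - k%:R) * lattice_shift j k w n
   - (2 * (n 0 j)%:~R + k%:R) * lattice_shift j (- k%:Z) w n).
  rewrite /iconj_ -[LHS]/(_ * (_ * _ - _ * _ + _ * (_ - _))).
  rewrite fmorphV rmorph_nat; congr (_ * _).
  rewrite !coord_translate !eqxx !mulr1n. rewrite opprK mulrzBr mulrzDr -pmulrn.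
  rewrite /lattice_shift; ring.
have Scomm l : lattice_shift j l (lattice_shift i m u) = lattice_shift i m
  (lattice_shift j l u).
  by apply/funext => n; rewrite /lattice_shift addrAC.
apply/funext => n.
rewrite -[LHS]/(lattice_shift i m (iconj_ k j u) n - iconj_ k j (lattice_shift i m u) n).
rewrite -[RHS]/(_ * (lattice_shift i m (lattice_shift j k u) n
  - lattice_shift i m (lattice_shift j (- k%:Z) u) n)).
rewrite {1}/lattice_shift !iE !Scomm.
rewrite -![lattice_shift j _ u (n - _)]/(lattice_shift i m (lattice_shift j _ u) n).
set a := lattice_shift i m _ n; set b := lattice_shift i m _ n.
rewrite coord_translate mulrzBr eq_sym.
by case: eqP => _ /=; rewrite ?mulr1n ?mulr0n; [field|ring].
Qed.

Lemma iconj_lin k j c u v :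
  iconj_ k j (c *: u + v) = c *: iconj_ k j u + iconj_ k j v.
Proof.
apply/funext => n; pose f w := (4^-1)%:C *
   ((lattice_shift j k (position j w) n - lattice_shift j (- k%:Z) (position j w) n)
     + (n 0 j)%:~R * (lattice_shift j k w n - lattice_shift j (- k%:Z) w n)) : R[i].
rewrite -[LHS]/(f (c *: u + v)) -[RHS]/(c * f u + f v) /f /lattice_shift /position.
have fE m : (c *: u + v) m = c * u m + v m by [].
by rewrite !fE; ring.
Qed.

Lemma Delta_lin i c u v : Delta_ i (c *: u + v) = c *: Delta_ i u + Delta_ i v.
Proof.
apply/funext => n.
pose f w := 2^-1 * (lattice_shift i 1 w n + lattice_shift i (-1) w n) : R[i].
rewrite -[LHS]/(f (c *: u + v)) -[RHS]/(c * f u + f v) /f /lattice_shift.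
have fE m : (c *: u + v) m = c * u m + v m by [].
by rewrite !fE; ring.
Qed.

Local Lemma lin_sum (T : lattice_op R d) (I : Type) (r : seq I) (F : I ->
  lattice_fun R d) :
  (forall c u v, T (c *: u + v) = c *: T u + T v) ->
  T (\sum_(i <- r) F i) = \sum_(i <- r) T (F i).
Proof.
move=> lT; elim: r => [|i r IH].
  rewrite !big_nil; have := lT (-1) 0 0.
  by rewrite scaler0 addr0 scaleN1r addNr.
by rewrite !big_cons -[F i]scale1r lT IH !scale1r.
Qed.

Lemma Delta_iconj_ k i j u : Delta_ i (iconj_ k j u) - iconj_ k j (Delta_ i u) =
  (i == j)%:R *: ((4^-1)%:C *:
    ((lattice_shift j (k%:Z - 1) u + lattice_shift j (- (k%:Z - 1)) u)
   - (lattice_shift j (k%:Z + 1) u + lattice_shift j (- (k%:Z + 1)) u))).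
Proof.
have -> : iconj_ k j (Delta_ i u) = 2^-1 *: (iconj_ k j (lattice_shift i 1 u)
    + iconj_ k j (lattice_shift i (-1) u)).
  rewrite /Delta_ -[X in iconj_ _ _ X]addr0 iconj_lin -[X in _ *: iconj_ _ _ (X +
    _)]scale1r.
  rewrite iconj_lin scale1r -[RHS]addr0; congr (_ + _).
  by have := iconj_lin k j (-1) 0 0; rewrite scaler0 addr0 scaleN1r addNr.
rewrite /Delta_ -scalerBr opprD addrACA !lattice_shift_iconj_ fmorphV rmorph_nat.
case: eqP => [->|_]; last by rewrite !mul0r !scale0r addr0 scaler0.
rewrite !lattice_shiftD; apply/funext => n.
have -> : - (k%:Z - 1) = 1 - k%:Z by ring.
have -> : - (k%:Z + 1) = -1 - k%:Z by ring.
rewrite [1 + k%:Z]addrC [-1 + k%:Z]addrC.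
set a := lattice_shift j (k%:Z + 1) u; set b := lattice_shift j (1 - k%:Z) u.
set c := lattice_shift j (k%:Z - 1) u; set e := lattice_shift j (-1 - k%:Z) u.
rewrite -[LHS]/(2^-1 * (1%:R * - (1%:~R / 2) * (a n - b n) +
  1%:R * - ((-1)%:~R / 2) * (c n - e n))).
rewrite -[RHS]/(1%:R * (4^-1 * (c n + b n - (a n + e n)))).
rewrite mulrN1z !mulr1z; by field.
Qed.

Lemma Delta_iconj k u : Delta (iconj k u) - iconj k (Delta u) = commutator_op k u.
Proof.
have e1 : Delta (iconj k u) = \sum_(j < d) \sum_(i < d) Delta_ i (iconj_ k j u).
  rewrite exchange_big; apply: eq_bigr => i _.
  exact: (lin_sum _ _ (Delta_lin i)).
have e2 : iconj k (Delta u) = \sum_(j < d) \sum_(i < d) iconj_ k j (Delta_ i u).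
  apply: eq_bigr => j _; exact: (lin_sum _ _ (iconj_lin k j)).
rewrite e1 e2 -sumrB; apply: eq_bigr => j _; rewrite -sumrB (bigD1 j)//= big1.
  by rewrite addr0 Delta_iconj_ eqxx scale1r.
by move=> i /negbTE ij; rewrite Delta_iconj_ ij scale0r.
Qed.

(** [iA] is antisymmetric, so the form is that of the operator commutator, which
    [Delta_iconj] computes exactly. *)
Lemma commutator_form k u v : finitely_supported u -> finitely_supported v ->
  rin u (commutator_op k v) = rin (Delta u) (iconj k v) + rin (iconj k u) (Delta v).
Proof.
move=> fu fv; have fe w : finitely_supported w ->
  ell2 w by exact: finitely_supported_ell2.
have fD := finitely_supported_Delta; have fB := finitely_supported_iconj k.
rewrite -Delta_iconj rinBr ?rin_Delta; try by auto.
by rewrite rin_iconj; auto.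
Qed.

Lemma conjugate_op_finite k u : finitely_supported u ->
  conjugate_op (fun=> k) (u, conjugate_op0 (fun=> k) u).
Proof.
have cst w : ell2_cvg (fun=> w) w.
  by rewrite /ell2_cvg subrr ell2_norm0; exact: cvg_cst.
move=> fu; split; [exact: finitely_supported_ell2| |].
  exact/finitely_supported_ell2/finitely_supported_conj0.
by exists (fun=> u).
Qed.

Lemma conjugate_op_unit k u Au : conjugate_op (fun=> k) (u, Au) ->
  conjugate_op (fun=> k) ('i *: u, 'i *: Au).
Proof.
have ni w : ell2_norm ('i *: w : lattice_fun R d) = ell2_norm w.
  by apply: ell2_norm_unimod; rewrite /= expr0n add0r expr1n sqrtr1.
move=> [/= eu eA [u_ [fu_ cu cA]]]; split => /=; [exact: ell2Z|exact: ell2Z|].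
exists (fun k => 'i *: u_ k); split.
- by move=> l; exact: finitely_supportedZ.
- rewrite /ell2_cvg; under eq_fun do rewrite -scalerBr ni.
  exact: cu.
- rewrite /ell2_cvg; have e l : conjugate_op0 (fun=> k) ('i *: u_ l) =
      'i *: conjugate_op0 (fun=> k) (u_ l).
    have i0 : 'i != 0 :> R[i] by rewrite eq_complex /= oner_eq0 andbF.
    apply: (scalerI i0); rewrite iconjE iconjE /iconj scaler_sumr.
    apply: eq_bigr => j _; rewrite -[X in iconj_ _ _ X]addr0 iconj_lin.
    have -> : iconj_ k j (0 : lattice_fun R d) = 0.
      by have := iconj_lin k j (-1) 0 0; rewrite scaler0 addr0 scaleN1r addNr.
    by rewrite addr0.
  under eq_fun do rewrite e -scalerBr ni.
  exact: cA.
Qed.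

(** Both sides of [commutator_form] pass to the limit along the approximating
    sequences that define the closure of the conjugate operator. *)
Lemma commutator_form_closure k u Au v Av :
  conjugate_op (fun=> k) (u, Au) -> conjugate_op (fun=> k) (v, Av) ->
  rin u (commutator_op k v) = rin (Delta u) ('i *: Av) + rin ('i *: Au) (Delta v).
Proof.
move=> [/= eu eAu [u_ [fu_ cu cAu]]] [/= ev eAv [v_ [fv_ cv cAv]]].
have fe w : finitely_supported w -> ell2 w by exact: finitely_supported_ell2.
have ecu l : ell2 (u_ l) by auto.
have ecv l : ell2 (v_ l) by auto.
have ni w : ell2_norm ('i *: w : lattice_fun R d) = ell2_norm w.
  by apply: ell2_norm_unimod; rewrite /= expr0n add0r expr1n sqrtr1.
have cB (w_ : nat -> lattice_fun R d) Aw : ell2_cvg (fun l => conjugate_op0 (fun=> k)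
  (w_ l)) Aw ->
    ell2_cvg (fun l => iconj k (w_ l)) ('i *: Aw).
  rewrite /ell2_cvg => cw; under eq_fun do rewrite -iconjE -scalerBr ni.
  exact: cw.
have bC := @bounded_op_commutator R d k; have bD := @bounded_op_Delta R d.
have eB l : ell2 (iconj k (u_ l)) by exact/fe/finitely_supported_iconj.
have eB' l : ell2 (iconj k (v_ l)) by exact/fe/finitely_supported_iconj.
have eD w : ell2 w -> ell2 (Delta w) by exact: (bounded_op_ell2 bD).
have eC w : ell2 w -> ell2 (commutator_op k w) by exact: (bounded_op_ell2 bC).
have l1 := ell2_cvg_rin ecu (fun l => eC _ (ecv l)) eu (eC _ ev) cu
  (bounded_op_cvg bC ecv ev cv).
have l2 := ell2_cvg_rin (fun l => eD _ (ecu l)) eB' (eD _ eu) (ell2Z 'i eAv)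
  (bounded_op_cvg bD ecu eu cu) (cB _ _ cAv).
have l3 := ell2_cvg_rin eB (fun l => eD _ (ecv l)) (ell2Z 'i eAu) (eD _ ev)
  (cB _ _ cAu) (bounded_op_cvg bD ecv ev cv).
apply: (cvg_unique _ l1); first exact: Rhausdorff.
rewrite (_ : (fun l => _) = fun l => rin (Delta (u_ l)) (iconj k (v_ l)) +
   rin (iconj k (u_ l)) (Delta (v_ l))); first exact: cvgD l2 l3.
by apply/funext => l; rewrite commutator_form.
Qed.

Lemma commutator_ext_commutator_op k :
  commutator_ext (@Delta R d) (conjugate_op (fun=> k)) (commutator_op k).
Proof.
split; first exact: bounded_op_commutator.
move=> u Au v Av cu cv.
have [/= eu eAu _] := cu; have [/= ev eAv _] := cv.
have eD w : ell2 w -> ell2 (Delta w) by exact: (bounded_op_ell2 (@bounded_op_Delta R d)).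
have iD : Delta ('i *: u) = 'i *: Delta u.
  exact: (bounded_opZ (@bounded_op_Delta R d)).
rewrite !inner_rin (commutator_form_closure cu cv).
rewrite (commutator_form_closure (conjugate_op_unit cu) cv) iD.
rewrite scaleNr scalerN !rinNl ?opprK; try by auto using ell2Z.
by apply/eqP; rewrite eq_complex /= !opprK !eqxx.
Qed.

(** A bounded extension of the commutator form is determined on finitely
    supported functions, which is all that wave packets require. *)
Lemma commutator_ext_finite k C u v :
  commutator_ext (@Delta R d) (conjugate_op (fun=> k)) C ->
  finitely_supported u -> finitely_supported v ->
  rin u (C v) = rin u (commutator_op k v).
Proof.
move=> [_ hC] fu fv; have [_ hC0] := commutator_ext_commutator_op k.
have := hC _ _ _ _ (conjugate_op_finite k fu) (conjugate_op_finite k fv).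
rewrite -(hC0 _ _ _ _ (conjugate_op_finite k fu) (conjugate_op_finite k fv)).
by rewrite !inner_rin => -[].
Qed.

End Conjugate.

(** * Chebyshev symbols and positivity by the discrete Fourier transform *)

Section Chebyshev.
Context {R : realType}.

(** Consecutive Chebyshev polynomials of the first kind: the recurrence has
    order two. *)
Fixpoint cheb_pair (m : nat) (x : R) : R * R :=
  if m is m'.+1 then
    let: (a, b) := cheb_pair m' x in (b, 2 * x * b - a)
  else (1, x).

Definition cheb (m : nat) (x : R) : R := (cheb_pair m x).1.

Lemma cheb1 x : cheb 1 x = x. Proof. by []. Qed.
Lemma chebSS m x : cheb m.+2 x = 2 * x * cheb m.+1 x - cheb m x.
Proof. by rewrite /cheb /=; case: (cheb_pair m x). Qed.

Lemma unimod_neq0 (z : R[i]) : Normc.normc z = 1 -> z != 0.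
Proof. by move=> z1; apply/eqP => z0; move: z1; rewrite z0 Normc.normc0 => /esym/eqP;
  rewrite oner_eq0. Qed.

Lemma normc1_inv (z : R[i]) : Normc.normc z = 1 -> z^-1 = z^*.
Proof.
move=> z1; apply: (mulfI (unimod_neq0 z1)); rewrite divff ?unimod_neq0//.
have := normc_sqr z; rewrite z1 expr1n.
case: z {z1} => a b /= h; apply/eqP; rewrite eq_complex /=.
by apply/andP; split; apply/eqP; [rewrite h|]; ring.
Qed.

Lemma Re_expr (z : R[i]) m : Normc.normc z = 1 ->
  complex.Re (z ^+ m) = cheb m (complex.Re z).
Proof.
move=> z1; have : complex.Re (z ^+ m) = cheb m (complex.Re z) /\
  complex.Re (z ^+ m.+1) = cheb m.+1 (complex.Re z).
  elim: m => [|m [IH1 IH2]]; first by rewrite expr0 expr1.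
  split=> //; rewrite chebSS -IH1 -IH2 !exprS.
  have := normc_sqr z; rewrite z1 expr1n; move: (z ^+ m) => w.
  case: z {z1 IH1 IH2} => a b; case: w => c e /= h.
  apply/eqP; rewrite -subr_eq0; apply/eqP.
  transitivity (c * (1 - (a * a + b * b))); first ring.
  by rewrite -h subrr mulr0.
by case.
Qed.

Lemma Re_unimod (z : R[i]) : Normc.normc z = 1 -> -1 <= complex.Re z <= 1.
Proof.
move=> z1; have := normc_sqr z; rewrite z1 expr1n.
case: z {z1} => a b /= h; have := sqr_ge0 b; rewrite expr2 => h2.
by apply/andP; split; nra.
Qed.

Lemma exprz_addV (z : R[i]) (m : nat) : Normc.normc z = 1 ->
  z ^ m%:Z + z ^ (- m%:Z) = (2 * cheb m (complex.Re z))%:C.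
Proof.
move=> z1; rewrite -Re_expr// -exprnN.
have zm : Normc.normc (z ^+ m) = 1.
  by elim: m => [|m IH]; rewrite ?expr0 ?Normc.normc1// exprS Normc.normcM z1 IH mulr1.
rewrite -[z ^ m]/(z ^+ m) normc1_inv//.
case: (z ^+ m) => a b; apply/eqP; rewrite eq_complex /=; apply/andP; split; apply/eqP;
  ring.
Qed.

(** The symbol [sin xi * sin (k xi)] of one summand of the commutator, as a
    polynomial in [x = cos xi], written by the product formula as
    [(cos ((k - 1) xi) - cos ((k + 1) xi)) / 2]. *)
Definition velocity (k : nat) (x : R) : R := (cheb k.-1 x - cheb k.+1 x) / 2.

End Chebyshev.

Section Fourier.
Context {R : realType} {d : nat}.
Implicit Types (u v w : lattice_fun R d).

(** The roots of ['X^N - 1] are distinct, since the characteristic is 0. *)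
Lemma prim_root_complex_exists (N : nat) : (0 < N)%N ->
  exists z : R[i], N.-primitive_root z.
Proof.
move=> N0; have [r Dp] := closed_field_poly_normal ('X^N - 1 : {poly R[i]}).
rewrite (monicP _) ?monicXnsubC// scale1r in Dp.
have /hasP[z _ zp] : has N.-primitive_root r; last by exists z.
apply: has_prim_root => //.
- by apply/allP => z; rewrite -root_prod_XsubC -Dp.
- by rewrite -separable_prod_XsubC -Dp separable_Xn_sub_1// pnatr_eq0 -lt0n.
- by rewrite -ltnS -(size_prod_XsubC r id) -Dp size_XnsubC.
Qed.

Definition chi (z : 'I_d -> R[i]) (n : 'rV[int]_d) : R[i] := \prod_j z j ^ n 0 j.

Section Chi.
Variable z : 'I_d -> R[i].
Hypothesis z1 : forall j, Normc.normc (z j) = 1.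

Lemma chiD n m : chi z (n + m) = chi z n * chi z m.
Proof.
rewrite -big_split; apply: eq_bigr => j _.
by rewrite mxE expfzDr// unimod_neq0.
Qed.

Lemma normc_chi n : Normc.normc (chi z n) = 1.
Proof.
apply: (big_ind (fun x => Normc.normc x = 1)); first exact: Normc.normc1.
  by move=> x y hx hy; rewrite Normc.normcM hx hy mulr1.
move=> j _; have p m : Normc.normc (z j ^+ m) = 1.
  by elim: m => [|m IH]; rewrite ?expr0 ?Normc.normc1// exprS Normc.normcM z1 IH mulr1.
by case: (n 0 j) => m; rewrite ?NegzE -?exprnN ?Normc.normcV ?p ?invr1.
Qed.

Lemma chiN n : chi z (- n) = (chi z n)^*.
Proof.
rewrite -normc1_inv ?normc_chi// -[LHS]mul1r -(mulVf (unimod_neq0 (normc_chi n))).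
have chi0 : chi z 0 = 1 by rewrite /chi big1// => j _; rewrite mxE expr0z.
by rewrite -mulrA -chiD addrN chi0 mulr1.
Qed.

Lemma chi_delta j m : chi z (delta_mx 0 j *~ m) = z j ^ m.
Proof.
have e i : (delta_mx 0 j *~ m : 'rV[int]_d) 0 i = m *+ (i == j).
  by have := coord_translate 0 i j m;
    rewrite sub0r mxE [X in _ = X - _]mxE sub0r => /oppr_inj.
rewrite /chi (bigD1 j)//= e eqxx mulr1n big1 ?mulr1// => i /negbTE ij.
by rewrite e ij mulr0n expr0z.
Qed.

Variable F : seq 'rV[int]_d.

(** Fourier coefficient at the character [chi z], summed over a fixed finite set
    [F]: this is linear in all functions, and is the true coefficient of those
    supported in [F]. *)
Definition hat u : R[i] := \sum_(n <- F) chi z (- n) * u n.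

Lemma hatD u v : hat (u + v) = hat u + hat v.
Proof. by rewrite /hat -big_split; apply: eq_bigr => n _; exact: mulrDr. Qed.

Lemma hatZ c u : hat (c *: u) = c * hat u.
Proof. by rewrite /hat mulr_sumr; apply: eq_bigr => n _; exact: mulrCA. Qed.

Lemma hatN u : hat (- u) = - hat u.
Proof. by rewrite -scaleN1r hatZ mulN1r. Qed.

Lemma hat_sum (I : Type) (r : seq I) (f : I -> lattice_fun R d) :
  hat (\sum_(i <- r) f i) = \sum_(i <- r) hat (f i).
Proof.
elim: r => [|i r IH]; last by rewrite !big_cons hatD IH.
by rewrite !big_nil /hat big1// => n _; rewrite mulr0.
Qed.

(** Reindexing is legitimate as soon as [F] holds both the support of [u] and
    its translate. *)
Lemma hat_shift j m u : uniq F -> (forall n, n \notin F -> u n = 0) ->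
  (forall n, n \notin F -> lattice_shift j m u n = 0) ->
  hat (lattice_shift j m u) = z j ^ (- m) * hat u.
Proof.
move=> uF u0 su0; rewrite /hat mulr_sumr.
pose e : 'rV[int]_d := delta_mx 0 j *~ m.
transitivity (\sum_(n <- F | n - e \in F) chi z (- n) * u (n - e)).
  rewrite [RHS]big_mkcond; apply: eq_bigr => n _; case: ifPn => // /u0 ne.
  by rewrite [lattice_shift _ _ _ _]ne mulr0.
transitivity (\sum_(n <- F | n + e \in F) chi z (- (n + e)) * u n); last first.
  rewrite big_mkcond; apply: eq_bigr => n _; case: ifPn => [_|ne].
    rewrite mulrA opprD chiD; congr (_ * _); rewrite mulrC; congr (_ * _).
    by rewrite /e -mulrNz chi_delta.
  by have := su0 _ ne; rewrite /lattice_shift addrK => ->; rewrite !mulr0.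
rewrite -[LHS]big_filter -[RHS]big_filter.
rewrite (perm_big [seq n + e | n <- F & n + e \in F]).
  by rewrite big_map; apply: eq_bigr => n _; rewrite addrK.
apply: uniq_perm; [exact: filter_uniq|by rewrite map_inj_uniq ?filter_uniq//;
  exact: addIr|].
move=> n; rewrite mem_filter; apply/andP/mapP => [[h1 h2]|[n' + ->]].
  by exists (n - e); rewrite ?subrK// mem_filter subrK h1 h2.
by rewrite mem_filter => /andP[h1 h2]; rewrite addrK h1 h2.
Qed.

End Chi.

Lemma prim_root_normc (N : nat) (zeta : R[i]) : N.-primitive_root zeta ->
  Normc.normc zeta = 1.
Proof.
move=> zp; have N0 := prim_order_gt0 zp.
have nX m : Normc.normc (zeta ^+ m) = Normc.normc zeta ^+ m.
  by elim: m => [|m IH]; rewrite ?expr0 ?Normc.normc1// !exprS Normc.normcM IH.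
apply/eqP; rewrite -(@pexpr_eq1 _ _ N)//; last by case: (zeta) => a b; exact: sqrtr_ge0.
by rewrite -nX (prim_expr_order zp) Normc.normc1.
Qed.

(** Geometric sum of ratio [zeta ^ m], an [N]-th root of unity other than 1. *)
Lemma sum_prim_root (N : nat) (zeta : R[i]) (m : int) : N.-primitive_root zeta ->
  (`|m| < N)%N -> m != 0 -> \sum_(b < N) (zeta ^+ b) ^ m = 0.
Proof.
move=> zp mN m0.
have z1 := prim_root_normc zp; have z0 := unimod_neq0 z1.
have -> : \sum_(b < N) (zeta ^+ b) ^ m = \sum_(b < N) (zeta ^ m) ^+ b.
  apply: eq_bigr => b _; rewrite -[zeta ^+ b]/(zeta ^ b%:Z) -[_ ^+ b]/((zeta ^ m) ^ b%:Z).
  by rewrite !exprz_exp mulrC.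
have neq1 : zeta ^ m != 1.
  have pos (p : nat) : (0 < p < N)%N -> zeta ^+ p != 1.
    move=> /andP[p0 pN]; rewrite -(prim_order_dvd zp); apply/negP => /dvdn_leq.
    by move=> /(_ p0); rewrite leqNgt pN.
  case: m m0 mN => p m0 mN.
    by apply: pos; rewrite mN andbT lt0n; apply: contra_neq m0 => ->.
  by rewrite NegzE -exprnN invr_eq1 pos.
have := subrX1 (zeta ^ m) N.
have -> : (zeta ^ m) ^+ N = 1.
  rewrite -[_ ^+ N]/((zeta ^ m) ^ N%:Z) exprz_exp mulrC -exprz_exp.
  by rewrite -[zeta ^ N]/(zeta ^+ N) (prim_expr_order zp) exp1rz.
rewrite subrr => /esym/eqP; rewrite mulf_eq0 subr_eq0 (negbTE neq1) /=.
by move=> /eqP.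
Qed.

Lemma Re_sum (I : Type) (r : seq I) (f : I -> R[i]) :
  complex.Re (\sum_(i <- r) f i) = \sum_(i <- r) complex.Re (f i).
Proof.
elim: r => [|i r IH]; first by rewrite !big_nil.
by rewrite !big_cons -IH; case: (f i) (\sum_(_ <- _) _) => ? ? [].
Qed.

Local Lemma conj_sum (I : Type) (r : seq I) (f : I -> R[i]) :
  conjc (\sum_(i <- r) f i) = \sum_(i <- r) conjc (f i).
Proof.
elim: r => [|i r IH]; first by rewrite !big_nil conjc0.
rewrite !big_cons -IH; case: (f i) (\sum_(_ <- _) _) => a b [a' b'] /=.
by rewrite opprD.
Qed.

Local Lemma conjM (x y : R[i]) : conjc (x * y) = conjc x * conjc y.
Proof.
by case: x y => a b [a' b']; apply/eqP; rewrite eq_complex /=; apply/andP; split;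
  apply/eqP; ring.
Qed.

(** Discrete Fourier transform on the torus of side [N].  Here [I] indexes the
    [N ^ d] characters and [c = N ^ d].  The side [N] exceeds all differences of
    coordinates in [F], so that distinct points of [F] stay distinct modulo [N]
    and the characters are orthogonal on [F]. *)
Lemma plancherel (F : seq 'rV[int]_d) : uniq F ->
  exists (I : finType) (z : I -> 'I_d -> R[i]) (c : R),
    [/\ 0 < c, forall a j, Normc.normc (z a j) = 1 &
      forall u v, (forall n, n \notin F -> u n = 0) -> (forall n, n \notin F ->
        v n = 0) ->
      c * rin u v = \sum_a complex.Re (conjc (hat (z a) F u) * hat (z a) F v)].
Proof.
move=> uF.
pose N := (\sum_(n <- F) \sum_(m <- F) \sum_j absz ((n - m)%R ord0 j)).+1%N.
have [zeta zp] := prim_root_complex_exists (ltn0Sn _ : 0 < N)%N.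
have z1 := prim_root_normc zp.
pose z (a : {ffun 'I_d -> 'I_N}) j := zeta ^+ a j.
have nz a j : Normc.normc (z a j) = 1.
  rewrite /z; elim: (nat_of_ord _) => [|m IH]; first by rewrite expr0 Normc.normc1.
  by rewrite exprS Normc.normcM z1 IH mulr1.
have orth n m : n \in F -> m \in F ->
    \sum_a chi (z a) (n - m) = if n == m then (N ^ d)%:R else 0.
  move=> nF mF; rewrite /chi /z.
  rewrite -(bigA_distr_bigA (fun j (b : 'I_N) => (zeta ^+ b) ^ (n - m) 0 j)).
  case: eqP => [->|/eqP nm].
    rewrite (eq_bigr (fun=> N%:R)).
      by rewrite prodr_const card_ord natrX.
    move=> j _; rewrite subrr mxE (eq_bigr (fun=> 1)); last by move=> b _; rewrite expr0z.
    by rewrite sumr_const card_ord.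
  have [j nmj] : exists j, (n - m) 0 j != 0.
    apply/existsP; apply: contraR nm; rewrite negb_exists => /forallP h.
    rewrite -subr_eq0; apply/eqP/rowP => j; rewrite [RHS]mxE.
    by apply/eqP; rewrite -[_ == _]negbK; exact: h.
  rewrite (bigD1 j)//= sum_prim_root ?mul0r//.
  rewrite ltnS (big_rem n)//= (leq_trans _ (leq_addr _ _))//.
  rewrite (big_rem m)//= (leq_trans _ (leq_addr _ _))//.
  by rewrite (bigD1 j)//= leq_addr.
exists {ffun 'I_d -> 'I_N}, z, (N ^ d)%:R; split => //.
  by rewrite ltr0n expn_gt0.
move=> u v u0 v0.
rewrite /rin (rsum_finite uF); last by move=> n nF; rewrite u0//= !mul0r addr0.
transitivity (complex.Re (\sum_a conjc (hat (z a) F u) * hat (z a) F v)); last first.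
  exact: Re_sum.
have -> : \sum_a conjc (hat (z a) F u) * hat (z a) F v =
    \sum_(n <- F) (N ^ d)%:R * (conjc (u n) * v n).
  transitivity (\sum_a \sum_(n <- F) \sum_(m <- F)
      chi (z a) (n - m) * (conjc (u n) * v m)).
    apply: eq_bigr => a _; rewrite /hat. rewrite conj_sum mulr_suml.
    apply: eq_bigr => n _; rewrite mulr_sumr; apply: eq_bigr => m _.
    rewrite conjM (chiN (nz a) n) conjcK chiD//; ring.
  rewrite exchange_big; apply: eq_big_seq => n nF; rewrite exchange_big/=.
  rewrite (big_rem n)//= -mulr_suml orth// eqxx.
  rewrite big_seq big1 ?addr0// => m.
  rewrite mem_rem_uniq// inE => /andP[mn mF].
  by rewrite -mulr_suml orth// eq_sym (negbTE mn) mul0r.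
rewrite mulr_sumr Re_sum; apply: eq_bigr => n _.
rewrite -(rmorph_nat (real_complex R)).
by case: (u n) (v n) => [a b] [a' b'] /=; ring.
Qed.

Lemma translates_support (ms : seq int) u : finitely_supported u ->
  exists F : seq 'rV[int]_d, [/\ uniq F, forall n, n \notin F -> u n = 0 &
    forall j m n, m \in ms -> n \notin F -> lattice_shift j m u n = 0].
Proof.
move=> /finitely_supportedP[F0 uF0 u0].
pose D : seq 'rV[int]_d := 0 :: [seq delta_mx 0 j *~ m | j <- enum 'I_d, m <- ms].
exists (undup [seq n + e | n <- F0, e <- D]); split; first exact: undup_uniq.
- move=> n; rewrite mem_undup => h; apply: u0; apply: contra h => nF.
  by rewrite -[n]addr0; apply: allpairs_f => //; rewrite inE eqxx.
- move=> j m n mms; rewrite mem_undup => h; apply: u0; apply: contra h => nF.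
  rewrite -[n](subrK (delta_mx 0 j *~ m)); apply: allpairs_f => //.
  by rewrite inE; apply/orP; right; apply: allpairs_f => //; rewrite mem_enum.
Qed.

(** A pointwise inequality between symbols on the cube is one between quadratic
    forms: after Plancherel, each term is the value of the symbol at the real
    parts of a tuple of roots of unity, times the square of a modulus. *)
Lemma symbol_ge0 (k : nat) (s K E m : R) : (0 < k)%N ->
  (forall x : 'I_d -> R, (forall j, -1 <= x j <= 1) ->
     m <= s * \sum_j velocity k (x j) + K * (\sum_j x j - E) ^+ 2) ->
  forall u, ell2 u ->
  m * rin u u <= s * rin u (commutator_op k u)
     + K * rin (Delta u - E%:C *: u) (Delta u - E%:C *: u).
Proof.
move=> k0 H.
pose ms := [:: 1; -1; k%:Z - 1; - (k%:Z - 1); k%:Z + 1; - (k%:Z + 1)].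
have fin u : finitely_supported u -> m * rin u u <= s * rin u (commutator_op k u)
     + K * rin (Delta u - E%:C *: u) (Delta u - E%:C *: u).
  move=> fu; have [F [uF u0 su0]] := translates_support ms fu.
  have [I [z [c [c0 z1 planch]]]] := plancherel uF.
  have Du0 n : n \notin F -> (Delta u - E%:C *: u) n = 0.
    move=> nF.
    have -> : (Delta u - E%:C *: u) n = Delta u n - E%:C * u n by [].
    rewrite u0// mulr0 subr0 /Delta fct_sumE big1// => j _.
    rewrite -[LHS]/(2^-1 * (lattice_shift j 1 u n + lattice_shift j (-1) u n)).
    by rewrite !su0 ?addr0 ?mulr0// !inE ?eqxx ?orbT.
  have Cu0 n : n \notin F -> commutator_op k u n = 0.
    move=> nF; rewrite /commutator_op fct_sumE big1// => j _.
    rewrite -[LHS]/(_ * ((lattice_shift j _ u n + lattice_shift j _ u n)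
       - (lattice_shift j _ u n + lattice_shift j _ u n))).
    by rewrite !su0 ?addr0 ?subr0 ?mulr0// !inE ?eqxx ?orbT.
  have hatS a j l : l \in ms -> hat (z a) F (lattice_shift j l u) =
      z a j ^ (- l) * hat (z a) F u.
    by move=> lms; rewrite hat_shift// => n nF; rewrite su0.
  have hatD' a : hat (z a) F (Delta u - E%:C *: u) =
      (\sum_j complex.Re (z a j) - E)%:C * hat (z a) F u.
    rewrite hatD hatN hatZ /Delta hat_sum rmorphB mulrBl; congr (_ - _).
    rewrite rmorph_sum mulr_suml; apply: eq_bigr => j _.
    rewrite /Delta_ hatZ hatD !hatS ?inE ?eqxx ?orbT// -mulrDl mulrA opprK addrC.
    rewrite (exprz_addV 1)// cheb1 half_complex -rmorphM; congr (_%:C * _).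
    by field.
  have hatC a : hat (z a) F (commutator_op k u) =
      (\sum_j velocity k (complex.Re (z a j)))%:C * hat (z a) F u.
    rewrite hat_sum rmorph_sum mulr_suml; apply: eq_bigr => j _.
    rewrite hatZ !hatD hatN !hatD !hatS ?inE ?eqxx ?orbT// -!mulrDl -mulrBl mulrA !opprK.
    have -> : k%:Z - 1 = k.-1%:Z by rewrite -subn1 subzn.
    have -> : k%:Z + 1 = k.+1%:Z by rewrite -addn1 PoszD.
    rewrite ![z a j ^ (- _) + _]addrC !exprz_addV// -rmorphB -rmorphM.
    by congr (_%:C * _); rewrite /velocity; field.
  rewrite -(ler_pM2l c0) mulrDr ![c * (_ * _)]mulrCA !planch// !mulr_sumr -big_split.
  apply: ler_sum => a _ /=; rewrite hatC hatD'.
  set y := hat _ _ _; have := H (fun j => complex.Re (z a j)) (fun j => Re_unimod (z1 a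
    j)).
  set p := \sum_j velocity _ _; set q := \sum_j _ - E.
  case: y => b e h.
  rewrite [leLHS](_ : _ = m * (b * b + e * e)); last by rewrite /=; ring.
  rewrite [leRHS](_ : _ = (s * p + K * q ^+ 2) * (b * b + e * e)); last by rewrite /=;
    ring.
  by rewrite ler_wpM2r// -!expr2 addr_ge0 ?sqr_ge0.
move=> u eu; have [u_ fu_ cu] := finitely_supported_dense eu.
have ecu l : ell2 (u_ l) by exact: finitely_supported_ell2.
have bC := @bounded_op_commutator R d k.
have bD := @bounded_op_Delta R d.
have eC w : ell2 w -> ell2 (commutator_op k w) by exact: (bounded_op_ell2 bC).
have bDE : bounded_op (fun w : lattice_fun R d => Delta w - E%:C *: w).
  have b1 : bounded_op (fun w : lattice_fun R d => w).
    by split => //; exists 1 => w _; rewrite mul1r.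
  rewrite (_ : (fun w => _) = fun w => Delta w + (- E)%:C *: w).
    exact: bounded_op_add bD (bounded_op_scale (- E) b1).
  by apply/funext => w; rewrite rmorphN scaleNr.
have eD w : ell2 w -> ell2 (Delta w - E%:C *: w) by exact: (bounded_op_ell2 bDE).
have l1 := ell2_cvg_rin ecu ecu eu eu cu cu.
have l2 := ell2_cvg_rin ecu (fun l => eC _ (ecu l)) eu (eC _ eu) cu
  (bounded_op_cvg bC ecu eu cu).
have cD := bounded_op_cvg bDE ecu eu cu.
have l3 := ell2_cvg_rin (fun l => eD _ (ecu l)) (fun l => eD _ (ecu l)) (eD _ eu) (eD _
  eu) cD cD.
have L : (fun l => m * rin (u_ l) (u_ l)) @ \oo --> m * rin u u by exact: cvgMr.
have Rr : (fun l => s * rin (u_ l) (commutator_op k (u_ l)) +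
    K * rin (Delta (u_ l) - E%:C *: u_ l) (Delta (u_ l) - E%:C *: u_ l)) @ \oo -->
    s * rin u (commutator_op k u) + K * rin (Delta u - E%:C *: u) (Delta u - E%:C *: u).
  by apply: cvgD; exact: cvgMr.
apply: (ler_cvg_to L Rr); apply: nearW => l.
exact: fin.
Qed.

End Fourier.

(** * Spectral subspaces of a bounded symmetric operator *)

Section Spectral.
Context {R : realType} {d : nat}.
Implicit Types (u v w : lattice_fun R d) (B : set (measurableTypeR R)).

Lemma Rintegral_bounds (mu : {measure set (measurableTypeR R) -> \bar R}) B (m : R) :
  measurable B -> mu setT = m%:E -> mu (~` B) = 0%E ->
  mu.-integrable setT (EFin : measurableTypeR R -> \bar R) ->
  (forall a, (forall x : R, B x -> a <= x) -> a * m <= (\int[mu]_x (x : R))%R) /\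
  (forall b, (forall x : R, B x -> x <= b) -> (\int[mu]_x (x : R))%R <= b * m).
Proof.
move=> mB muT muB' imu.
have mCB := measurableC mB.
have muB : mu B = m%:E.
  have : mu (B `|` ~` B) = (mu B + mu (~` B))%E.
    by apply: measureU => //; rewrite setICr.
  by rewrite muB' adde0 setUv muT => ->.
have iB : mu.-integrable B (EFin : measurableTypeR R -> \bar R).
  exact: integrableS imu.
have -> : (\int[mu]_x (x : R))%R = (\int[mu]_(x in B) (x : R))%R.
  by rewrite /Rintegral (negligible_integral mCB)// setTD setCK.
have icst a : mu.-integrable B (EFin \o (fun=> a : R)).
  apply/integrableP; split; first exact/measurable_realfun.measurable_EFinP.
  rewrite [X in (X < _)%E](_ : _ = \int[mu]_(x in B) (`|a|%:E))%E//.
  by rewrite integral_cst// muB -EFinM ltry.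
have cst a : (\int[mu]_(x in B) a)%R = a * m.
  by rewrite /Rintegral integral_cst// muB.
by split=> a h; rewrite -cst; apply: le_Rintegral.
Qed.

Variables (T : lattice_op R d) (P : set R -> lattice_op R d).
Hypothesis bT : bounded_op T.
Hypothesis sT : forall u v, ell2 u -> ell2 v -> rin (T u) v = rin u (T v).
Hypothesis hP : spectral_measure T P.

Lemma pvm_bounded B : measurable B -> bounded_op (P B).
Proof. by move=> mB; case: hP => -[/(_ B mB)[]]. Qed.

Lemma pvm_ell2 B u : measurable B -> ell2 u -> ell2 (P B u).
Proof. by move=> /pvm_bounded[h _ _] eu; exact: h. Qed.

Lemma pvm_idem B u : measurable B -> ell2 u -> P B (P B u) = P B u.
Proof. by move=> mB; case: hP => -[/(_ B mB)[_ h _] _ _ _ _]; exact: h. Qed.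

Lemma pvm_self_adjoint B u v : measurable B -> ell2 u -> ell2 v ->
  rin u (P B v) = rin (P B u) v.
Proof.
move=> mB eu ev; case: hP => -[/(_ B mB)[_ _ h] _ _ _ _].
by have := h _ _ eu ev; rewrite !inner_rin => -[].
Qed.

Lemma pvmI A B u : measurable A -> measurable B -> ell2 u ->
  P A (P B u) = P (A `&` B) u.
Proof. by move=> mA mB eu; case: hP => -[_ _ h _] _; rewrite h. Qed.

Lemma pvm0 u : ell2 u -> P set0 u = 0.
Proof. by move=> eu; case: hP => -[_ h _ _] _; case: (h u eu). Qed.

Lemma pvmT u : ell2 u -> P setT u = u.
Proof. by move=> eu; case: hP => -[_ h _ _] _; case: (h u eu). Qed.

Lemma pvm_disjoint A B u : measurable A -> measurable B -> ell2 u ->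
  A `&` B = set0 -> P A (P B u) = 0.
Proof. by move=> mA mB eu AB; rewrite pvmI// AB pvm0. Qed.

Lemma pvm_sqr B u : measurable B -> ell2 u -> rin u (P B u) = rin (P B u) (P B u).
Proof. by move=> mB eu; rewrite -{1}(pvm_idem mB eu) pvm_self_adjoint//;
  exact: pvm_ell2. Qed.

Lemma spectral_measureP u : ell2 u ->
  exists mu : {measure set (measurableTypeR R) -> \bar R},
    [/\ forall B, measurable B -> mu B = (rin u (P B u))%:E,
        mu.-integrable setT (EFin : measurableTypeR R -> \bar R)
      & rin u (T u) = (\int[mu]_x (x : R))%R].
Proof.
move=> eu; case: hP => _ /(_ u eu)[mu [h1 h2 h3]]; exists mu; split => //.
- by move=> B mB; rewrite h1// inner_rin.
- by move: h3; rewrite inner_rin => -[].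
Qed.

(** The measure of [u] is additive, which makes the norm of the difference of the
    two sides vanish; only weak information on [P] enters. *)
Lemma pvm_complement B u : measurable B -> ell2 u -> u = P B u + P (~` B) u.
Proof.
move=> mB eu; have mCB := measurableC mB.
have eB := pvm_ell2 mB eu; have eCB := pvm_ell2 mCB eu.
have e : rin u u = rin (P B u) (P B u) + rin (P (~` B) u) (P (~` B) u).
  have [mu [h1 _ _]] := spectral_measureP eu.
  have : mu (B `|` ~` B) = (mu B + mu (~` B))%E.
    by apply: measureU => //; rewrite setICr.
  by rewrite setUv !h1// pvmT// -EFinD !(pvm_sqr _ eu)// => -[].
apply/eqP; rewrite -subr_eq0; apply/eqP; apply: rin_eq0; first by auto using ell2B, ell2D.
rewrite rinBl ?rinBr ?rinDl ?rinDr; try by auto using ell2B, ell2D.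
have z : rin (P B u) (P (~` B) u) = 0.
  by rewrite -pvm_self_adjoint// pvm_disjoint ?rin0r// setICr.
by rewrite (rinC (P B u) u) (rinC (P (~` B) u) u) (rinC (P (~` B) u) (P B u))
  !pvm_sqr// e z; ring.
Qed.

(** The measure of [P A u + P B v] is the sum of the measures of its two parts, so
    the quadratic form of [T] is additive on them and the mixed term, which [T]
    being symmetric counts twice, must vanish. *)
Lemma pvm_cross A B u v : measurable A -> measurable B -> ell2 u -> ell2 v ->
  A `&` B = set0 -> rin (P A u) (T (P B v)) = 0.
Proof.
move=> mA mB eu ev AB; set f := P A u; set g := P B v.
have ef : ell2 f by exact: pvm_ell2.
have eg : ell2 g by exact: pvm_ell2.
have eTf := bounded_op_ell2 bT ef; have eTg := bounded_op_ell2 bT eg.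
have [mf [f1 f2 f3]] := spectral_measureP ef.
have [mg [g1 g2 g3]] := spectral_measureP eg.
have [mh [h1 h2 h3]] := spectral_measureP (ell2D ef eg).
have cross D : measurable D -> rin f (P D g) = 0.
  move=> mD; rewrite /g pvmI// /f -pvm_self_adjoint//; last by apply: pvm_ell2 => //;
    exact: measurableI.
  rewrite pvm_disjoint ?rin0r//; first exact: measurableI.
  by rewrite setICA AB setI0.
have add : rin (f + g) (T (f + g)) = rin f (T f) + rin g (T g).
  rewrite f3 g3 h3 /Rintegral -fineD;
    [|exact: integrable_fin_num|exact: integrable_fin_num].
  rewrite -integral_measure_add//.
  congr fine; apply: eq_measure_integral => D mD _.
  transitivity (mf D + mg D)%E; last exact/esym/measure_addE.
  rewrite h1// f1// g1// -EFinD; congr EFin.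
  have bD := pvm_bounded mD.
  rewrite (bounded_opD bD ef eg) rinDl ?rinDr//; try by auto using ell2D, pvm_ell2.
  by rewrite (rinC g) -pvm_self_adjoint// cross//; ring.
move: add; rewrite (bounded_opD bT ef eg) rinDl ?rinDr//; try by auto using ell2D.
rewrite -(sT eg ef) (rinC _ f); lra.
Qed.

(** The component of [T (P B u)] in the range of [P (~` B)] is orthogonal to
    itself by [pvm_cross]. *)
Lemma pvm_reduces B u : measurable B -> ell2 u -> P B (T (P B u)) = T (P B u).
Proof.
move=> mB eu; have mCB := measurableC mB.
have ey : ell2 (T (P B u)) by apply: (bounded_op_ell2 bT); exact: pvm_ell2.
rewrite [RHS](pvm_complement mB ey).
have -> : P (~` B) (T (P B u)) = 0; last by rewrite addr0.
apply: rin_eq0; first exact: pvm_ell2.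
rewrite -pvm_sqr// pvm_self_adjoint//.
by apply: pvm_cross => //; rewrite setICl.
Qed.

Lemma pvm_form_bounds B u : measurable B -> ell2 u ->
  (forall a, (forall x : R, B x -> a <= x) ->
     a * rin (P B u) (P B u) <= rin (P B u) (T (P B u))) /\
  (forall b, (forall x : R, B x -> x <= b) ->
     rin (P B u) (T (P B u)) <= b * rin (P B u) (P B u)).
Proof.
move=> mB eu; have ew := pvm_ell2 mB eu; have mCB := measurableC mB.
have [mu [h1 h2 ->]] := spectral_measureP ew.
apply: Rintegral_bounds => //; first by rewrite h1// pvmT.
by rewrite h1// pvm_disjoint ?rin0r// setICl.
Qed.

(** With [S = T - E], whose form on the subspace lies between [- e] and [e], the
    bound [S^2 <= e^2] comes from
    [2 e (e^2 - S^2) = (e + S) (e - S) (e + S) + (e - S) (e + S) (e - S)]: the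
    form of [e - S] is nonnegative at [(e + S) v], and conversely. *)
Lemma pvm_near (E e : R) B u : measurable B -> ell2 u -> 0 < e ->
  (forall x : R, B x -> E - e <= x <= E + e) ->
  rin (T (P B u) - E%:C *: P B u) (T (P B u) - E%:C *: P B u)
    <= e ^+ 2 * rin (P B u) (P B u).
Proof.
move=> mB eu e0 hB; set v := P B u.
have ev : ell2 v by exact: pvm_ell2.
have eT w : ell2 w -> ell2 (T w) by exact: (bounded_op_ell2 bT).
have bounds w : ell2 w -> P B w = w ->
    (E - e) * rin w w <= rin w (T w) <= (E + e) * rin w w.
  move=> ew Pw; have [lo up] := pvm_form_bounds mB ew; rewrite Pw in lo up.
  by rewrite lo ?up// => x /hB /andP[].
set y := T v - E%:C *: v.
have ey : ell2 y by rewrite /y; auto using ell2B, ell2Z.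
have bP := pvm_bounded mB.
have Pv : P B v = v by exact: pvm_idem.
have Py : P B y = y.
  rewrite /y (bounded_opB bP (eT _ ev) (ell2Z _ ev)) (bounded_opZ bP _ ev) Pv.
  by rewrite /v pvm_reduces.
have Tv : T v = y + E%:C *: v by rewrite /y subrK.
(* The abstract values keep the decomposition below from being unfolded. *)
clearbody y v.
pose q w := rin w (T w) - E * rin w w.
have b1 c : let w := c%:C *: v + y in - e * rin w w <= q w <= e * rin w w.
  move=> w; have ew : ell2 w by rewrite /w; auto using ell2D, ell2Z.
  have Pw : P B w = w.
    by rewrite /w (bounded_opD bP (ell2Z _ ev) ey) (bounded_opZ bP _ ev) Pv Py.
  by have /andP[h1 h2] := bounds _ ew Pw; rewrite /q; apply/andP; split; lra.
have expand c : rin (c%:C *: v + y) (c%:C *: v + y)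
    = c ^+ 2 * rin v v + 2 * c * rin v y + rin y y.
  rewrite rinDl ?rinDr ?rinZl; try by auto using ell2D, ell2Z.
  rewrite !rinZr; try by auto using ell2D, ell2Z.
  rewrite (rinC y v). ring.
have expandq c : q (c%:C *: v + y) = c ^+ 2 * rin v y + 2 * c * rin y y + q y.
  rewrite /q expand (bounded_opD bT (ell2Z _ ev) ey) (bounded_opZ bT _ ev).
  rewrite Tv.
  rewrite rinDl ?rinDr ?rinZl; try by auto using ell2D, ell2Z.
  rewrite !rinZr; try by auto using ell2D, ell2Z.
  rewrite !rinDr; try by auto using ell2D, ell2Z.
  rewrite !rinZr; try by auto using ell2D, ell2Z.
  rewrite -(sT ev ey).
  rewrite Tv.
  rewrite rinDl ?rinZl; try by auto using ell2D, ell2Z.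
  by rewrite (rinC y v); ring.
have /andP[_ p1] := b1 e; have /andP[p2 _] := b1 (- e).
rewrite !expand !expandq in p1 p2.
rewrite -(ler_pM2l e0).
lra.
Qed.

(** Split the complement of [B] at [E].  On each half the form of [T - E] is
    definite with bound [e], and Cauchy-Schwarz against [(T - E) u] bounds the
    component of [u] there; adding the two squares gives the factor 2. *)
Lemma pvm_far (E e : R) B u : measurable B -> ell2 u -> 0 < e ->
  (forall x : R, E - e < x < E + e -> B x) ->
  e ^+ 2 * rin (P (~` B) u) (P (~` B) u) <=
    2 * rin (T u - E%:C *: u) (T u - E%:C *: u).
Proof.
move=> mB eu e0 hB; set y := T u - E%:C *: u.
have eT w : ell2 w -> ell2 (T w) by exact: (bounded_op_ell2 bT).
have ey : ell2 y by rewrite /y; auto using ell2B, ell2Z.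
have half (D : set (measurableTypeR R)) (s : R) : measurable D -> (s = 1 \/ s = -1) ->
    (forall x : R, D x -> e <= s * (x - E)) ->
    e ^+ 2 * rin (P D u) (P D u) <= rin y y.
  move=> mD hs hD; set w := P D u.
  have ew : ell2 w by exact: pvm_ell2.
  have mCD := measurableC mD.
  have s2 : s ^+ 2 = 1 by case: hs => ->; rewrite ?sqrrN expr1n.
  have wy : rin w y = rin w (T w) - E * rin w w.
    rewrite /y {1}(pvm_complement mD eu).
    have e1 := pvm_ell2 mCD eu.
    rewrite (bounded_opD bT ew e1) rinBr ?rinDr ?rinZr; try by auto using ell2D, ell2Z.
    have -> : rin w (T (P (~` D) u)) = 0 by apply: pvm_cross => //; rewrite setICr.
    by rewrite addr0 (rinC w u) -[rin u w]/(rin u (P D u)) pvm_sqr.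
  have h : e * rin w w <= s * rin w y.
    rewrite wy; have [lo up] := pvm_form_bounds mD eu.
    case: hs hD => -> hD.
      have := lo (E + e) (fun x Dx => ltac:(have := hD x Dx; lra)).
      by rewrite -/w; lra.
    have := up (E - e) (fun x Dx => ltac:(have := hD x Dx; lra)).
    by rewrite -/w; lra.
  have cs := rin_sqr_le ew ey.
  have [w0|w0] := eqVneq (rin w w) 0; first by rewrite w0 mulr0 rin_ge0.
  have wp : 0 < rin w w by rewrite lt_neqAle eq_sym w0 rin_ge0.
  rewrite -(ler_pM2l wp).
  apply: le_trans cs.
  have -> : rin w y ^+ 2 = (s * rin w y) ^+ 2 by rewrite exprMn s2 mul1r.
  have -> : rin w w * (e ^+ 2 * rin w w) = (e * rin w w) ^+ 2 by ring.
  by rewrite ler_pXn2r// nnegrE ?(le_trans _ h)// mulr_ge0 ?ltW.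
pose D1 := ~` B `&` [set x : measurableTypeR R | E <= x].
pose D2 := ~` B `&` [set x : measurableTypeR R | x < E].
have mCB := measurableC mB.
have m1 : measurable D1.
  apply: measurableI => //; rewrite (_ : [set x | _] = `[E, +oo[%classic).
    exact: measurable_itv.
  by apply/seteqP; split => x; rewrite /= in_itv /= andbT.
have m2 : measurable D2.
  apply: measurableI => //; rewrite (_ : [set x | _] = `]-oo, E[%classic).
    exact: measurable_itv.
  by apply/seteqP; split => x; rewrite /= in_itv.
have D12 : D1 `&` D2 = set0.
  by apply/seteqP; split => // x [[_ /= h1] [_ /= h2]]; move: h1; rewrite leNgt h2.
have split : rin (P (~` B) u) (P (~` B) u) = rin (P D1 u) (P D1 u) + rin (P D2 u) (P D2
  u).
  have [mu [h1 _ _]] := spectral_measureP eu.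
  have : mu (D1 `|` D2) = (mu D1 + mu D2)%E by exact: measureU.
  have -> : D1 `|` D2 = ~` B.
    apply/seteqP; split => [x [[]|[]]//|x nB].
    by case: (leP E x) => h; [left|right].
  by rewrite !h1// -EFinD !(pvm_sqr _ eu)// => -[].
have i1 := half D1 1 m1 (or_introl erefl).
have i2 := half D2 (-1) m2 (or_intror erefl).
rewrite split mulrDr.
have j1 : e ^+ 2 * rin (P D1 u) (P D1 u) <= rin y y.
  apply: i1 => x [nB /= Ex]; rewrite mul1r leNgt; apply/negP => h; apply: nB; apply: hB.
  by apply/andP; split; lra.
have j2 : e ^+ 2 * rin (P D2 u) (P D2 u) <= rin y y.
  apply: i2 => x [nB /= Ex]; rewrite leNgt; apply/negP => h; apply: nB; apply: hB.
  by apply/andP; split; lra.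
lra.
Qed.

End Spectral.

(** * Approximate joint eigenvectors *)

Section Weyl.
Context {R : realType} {d : nat}.
Implicit Types (u v w : lattice_fun R d).

Lemma unit_circle_lift (x : R) : -1 <= x <= 1 ->
  exists2 z : R[i], Normc.normc z = 1 & complex.Re z = x.
Proof.
move=> /andP[x1 x2]; have h : 0 <= 1 - x ^+ 2.
  by have -> : 1 - x ^+ 2 = (1 - x) * (1 + x); [ring|apply: mulr_ge0; lra].
exists (x +i* Num.sqrt (1 - x ^+ 2)); last by [].
rewrite /Normc.normc (sqr_sqrtr h).
by have -> : x ^+ 2 + (1 - x ^+ 2) = 1; [ring|rewrite sqrtr1].
Qed.

Definition box (L : nat) : seq 'rV[int]_d :=
  codom (fun f : {ffun 'I_d -> 'I_L} => (\row_j (f j : nat)%:Z)).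

Lemma box_uniq L : uniq (box L).
Proof.
rewrite map_inj_uniq ?enum_uniq// => f g /rowP fg; apply/ffunP => j.
by have := fg j; rewrite !mxE => -[/val_inj].
Qed.

Lemma size_box L : size (box L) = (L ^ d)%N.
Proof. by rewrite size_codom card_ffun !card_ord. Qed.

Lemma mem_box L (n : 'rV[int]_d) : reflect (forall j, 0 <= n 0 j < L%:Z) (n \in box L).
Proof.
apply: (iffP codomP) => [[f ->] j|h]; first by rewrite mxE ltz_nat ltn_ord.
have hj j : (absz (n 0%R j) < L)%N.
  by have /andP[h0 h1] := h j; rewrite -ltz_nat gez0_abs.
exists [ffun j => Ordinal (hj j)]; apply/rowP => j; rewrite mxE ffunE /= gez0_abs//.
by have /andP[] := h j.
Qed.

Variable z : 'I_d -> R[i].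
Hypothesis z1 : forall j, Normc.normc (z j) = 1.

Definition wave_packet (L : nat) : lattice_fun R d :=
  fun n => if n \in box L then chi z n else 0.

Lemma finitely_supported_wave_packet L : finitely_supported (wave_packet L).
Proof.
apply/finitely_supportedP; exists (box L); first exact: box_uniq.
by move=> n /negbTE h; rewrite /wave_packet h.
Qed.

Local Lemma rin_sum (F : seq 'rV[int]_d) u v : uniq F -> (forall n, n \notin F ->
  u n = 0) ->
  rin u v = \sum_(n <- F) complex.Re (conjc (u n) * v n).
Proof.
move=> uF u0; rewrite /rin (rsum_finite uF).
  by apply: eq_bigr => n _; case: (u n) (v n) => [a b] [a' b'] /=; ring.
by move=> n /u0 -> /=; rewrite !mul0r addr0.
Qed.

Lemma rin_wave_packet L : rin (wave_packet L) (wave_packet L) = (L ^ d)%:R.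
Proof.
rewrite (rin_sum _ (box_uniq L)); last by move=> n /negbTE h; rewrite /wave_packet h.
rewrite -size_box -sum1_size natr_sum; apply: eq_big_seq => n nB.
rewrite /wave_packet nB -normc1_inv ?normc_chi// mulVf//.
exact/unimod_neq0/normc_chi.
Qed.

(** The packet and its translate have the same phases on the intersection of the
    box of side [M + 1] with its translate by [e_j].  That intersection contains
    a translate by [(1, .., 1)] of the box of side [M], whatever [j] is. *)
Lemma shift_wave_packet M j :
  ell2_norm (lattice_shift j 1 (wave_packet M.+1) - (z j)^-1 *: wave_packet M.+1) ^+ 2
    <= 2 * ((M.+1 ^ d)%:R - (M ^ d)%:R).
Proof.
set u := wave_packet M.+1.
have zV1 : Normc.normc (z j)^-1 = 1 by rewrite Normc.normcV z1 invr1.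
have eu : ell2 u by exact/finitely_supported_ell2/finitely_supported_wave_packet.
have eS : ell2 (lattice_shift j 1 u) by exact: ell2_shift.
have eZ := ell2Z (z j)^-1 eu.
rewrite ell2_norm_sqr rinBl ?rinBr ?rin_shift ?rin_unimod//; try by auto using ell2B.
rewrite (rinC (_ *: _) (lattice_shift _ _ _)) rin_wave_packet.
suff : (M ^ d)%:R <= rin (lattice_shift j 1 u) ((z j)^-1 *: u) by lra.
pose one : 'rV[int]_d := const_mx 1.
pose G := [seq n + one | n <- box M].
have uG : uniq G by rewrite map_inj_uniq ?box_uniq//; exact: addIr.
have -> : (M ^ d)%:R = rsum (fun n => if n \in G then 1 else 0 : R).
  rewrite (rsum_finite uG) => [|n /negbTE ->//].
  rewrite -size_box -(size_map (fun n => n + one)) -sum1_size natr_sum.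
  by apply: eq_big_seq => n ->.
apply: ler_rsum.
- by apply: (abs_summable_finite uG) => n /negbTE ->.
- exact: rin_summable.
move=> n.
have -> : complex.Re (lattice_shift j 1 u n) * complex.Re (((z j)^-1 *: u) n) +
   complex.Im (lattice_shift j 1 u n) * complex.Im (((z j)^-1 *: u) n) =
   if (n - delta_mx 0 j *~ 1 \in box M.+1) && (n \in box M.+1) then 1 else 0.
  rewrite -[((z j)^-1 *: u) n]/((z j)^-1 * u n).
  rewrite -[lattice_shift j 1 u n]/(u (n - delta_mx 0 j *~ 1)) /u /wave_packet.
  case: ifP => //= _; last by rewrite !mul0r addr0.
  case: ifP => //= _; last by rewrite mulr0 !mulr0 addr0.
  rewrite chiD// chiN// chi_delta// expr1z -normc1_inv// [_^-1 * _]mulrC -!expr2.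
  rewrite -normc_sqr Normc.normcM normc_chi// mul1r zV1 expr1n//.
have [nG|_] := ifPn; last by case: ifP.
rewrite ifT//; move: nG => /mapP[m /mem_box mB ->].
apply/andP; split; apply/mem_box => i; have /andP[h1 h2] := mB i.
  rewrite coord_translate !mxE.
  move: (m _ i) h1 h2 => y h1 h2.
  by case: (i == j) => /=; rewrite ?mulr1n ?mulr0n ?subr0 ?addrK; apply/andP; split; lia.
by rewrite !mxE; move: (m _ i) h1 h2 => y h1 h2; apply/andP; split; lia.
Qed.

Lemma bernoulli_le (t : R) n : 0 <= t <= 1 -> 1 - n%:R * t <= (1 - t) ^+ n.
Proof.
move=> /andP[t0 t1]; elim: n => [|n IH]; first by rewrite mul0r subr0 expr0.
rewrite exprS -natr1; apply: (@le_trans _ _ ((1 - t) * (1 - n%:R * t))).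
  have : 0 <= n%:R * t * t by rewrite !mulr_ge0.
  by lra.
by rewrite ler_wpM2l// subr_ge0.
Qed.

(** The box of side [M] fills a proportion of at least [1 - d / (M + 1)] of the
    box of side [M + 1], by Bernoulli's inequality. *)
Lemma approx_translation_eigenvector (e : R) : 0 < e ->
  exists2 u, finitely_supported u & 0 < ell2_norm u /\
    forall j, ell2_norm (lattice_shift j 1 u - (z j)^-1 *: u) <= e * ell2_norm u.
Proof.
move=> e0; pose M := Num.bound (2 * d%:R / e ^+ 2).
have hM : 2 * d%:R / e ^+ 2 < M%:R.
  by apply: archi_boundP; apply: divr_ge0; [apply: mulr_ge0;
    rewrite ler0n|exact: sqr_ge0].
exists (wave_packet M.+1); first exact: finitely_supported_wave_packet.
set u := wave_packet M.+1; have M0 : 0 < (M.+1)%:R :> R by rewrite ltr0n.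
have un : ell2_norm u ^+ 2 = (M.+1 ^ d)%:R by rewrite ell2_norm_sqr rin_wave_packet.
have u0 : 0 < ell2_norm u.
  rewrite lt_neqAle ell2_norm_ge0 andbT eq_sym -sqrf_eq0 un pnatr_eq0.
  by rewrite -lt0n expn_gt0.
split=> // j; rewrite -(@ler_pXn2r _ 2)// ?nnegrE ?mulr_ge0 ?ell2_norm_ge0 ?(ltW e0)//.
apply: le_trans (shift_wave_packet M j) _.
rewrite exprMn un !natrX.
pose t : R := (M.+1%:R)^-1.
have t0 : 0 <= t by rewrite invr_ge0 ltW.
have t1 : t <= 1 by rewrite invf_le1// ler1n.
have Mt : M.+1%:R * t = 1 by rewrite mulfV// gt_eqF.
have MM : M%:R = M.+1%:R * (1 - t) by rewrite mulrBr mulr1 Mt -natr1 addrK.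
rewrite MM exprMn; set X := M.+1%:R ^+ d.
have X0 : 0 <= X by rewrite exprn_ge0// ltW.
have b : 1 - d%:R * t <= (1 - t) ^+ d by apply: bernoulli_le; rewrite t0.
have c : 2 * (d%:R * t) <= e ^+ 2.
  have e20 : 0 < e ^+ 2 by rewrite exprn_gt0.
  have {}hM : 2 * d%:R < M.+1%:R * e ^+ 2.
    by rewrite -ltr_pdivrMr// (lt_trans hM)// ltr_nat.
  rewrite mulrA ler_pdivrMr// mulrC ltW//.
  by rewrite mulrC [_ * M.+1%:R]mulrC.
rewrite [leRHS]mulrC.
have -> : 2 * (X - X * (1 - t) ^+ d) = X * (2 * (1 - (1 - t) ^+ d)) by ring.
by rewrite ler_wpM2l//; lra.
Qed.

(** Telescoping: [S^(m+1) - c^(m+1) = S^m (S - c) + c (S^m - c^m)], where [S] is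
    unitary and [c] has modulus 1. *)
Lemma shift_power_eigenvector (e : R) u j m : ell2 u ->
  ell2_norm (lattice_shift j 1 u - (z j)^-1 *: u) <= e ->
  ell2_norm (lattice_shift j m%:Z u - z j ^- m *: u) <= m%:R * e /\
  ell2_norm (lattice_shift j (- m%:Z) u - z j ^+ m *: u) <= m%:R * e.
Proof.
move=> eu h1.
have zn0 := unimod_neq0 (z1 j).
have zp l : Normc.normc (z j ^+ l) = 1.
  by elim: l => [|l IH]; rewrite ?expr0 ?Normc.normc1// exprS Normc.normcM z1 IH mulr1.
have zm l : Normc.normc (z j ^- l) = 1 by rewrite Normc.normcV zp invr1.
have eS l : ell2 (lattice_shift j l u) by exact: ell2_shift.
have shB l v w : lattice_shift j l (v - w) = lattice_shift j l v - lattice_shift j l w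
  by [].
have shZ l c v : lattice_shift j l (c *: v) = c *: lattice_shift j l v by [].
have h2 : ell2_norm (lattice_shift j (-1) u - z j *: u) <= e.
  rewrite -(ell2_norm_shift j 1) -(ell2_norm_unimod _ (zm 1%N)) expr1.
  rewrite shB shZ lattice_shiftD addrN lattice_shift0 scalerBr scalerA mulVf// scale1r.
  by rewrite -ell2_normN opprB.
elim: m => [|m [IH1 IH2]].
  by rewrite oppr0 lattice_shift0 expr0 invr1 scale1r subrr ell2_norm0 mul0r.
have mE : m.+1%:Z = m%:Z + 1 by rewrite intS addrC.
rewrite -natr1 mulrDl mul1r; split.
  have -> : lattice_shift j m.+1%:Z u - z j ^- m.+1 *: u =
    lattice_shift j m%:Z (lattice_shift j 1 u - (z j)^-1 *: u) +
    (z j)^-1 *: (lattice_shift j m%:Z u - z j ^- m *: u).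
    rewrite shB shZ lattice_shiftD scalerBr scalerA addrA subrK.
    by rewrite -invfM -exprS mE.
  apply: le_trans (ell2_normD _ _) _; try by auto using ell2_shift, ell2B, ell2Z.
  by rewrite ell2_norm_shift ell2_norm_unimod ?Normc.normcV ?z1 ?invr1// addrC lerD.
have -> : lattice_shift j (- m.+1%:Z) u - z j ^+ m.+1 *: u =
    lattice_shift j (- m%:Z) (lattice_shift j (-1) u - z j *: u) +
    z j *: (lattice_shift j (- m%:Z) u - z j ^+ m *: u).
  rewrite shB shZ lattice_shiftD scalerBr scalerA addrA subrK.
  by rewrite -exprS mE opprD.
apply: le_trans (ell2_normD _ _) _; try by auto using ell2_shift, ell2B, ell2Z.
by rewrite ell2_norm_shift ell2_norm_unimod// addrC lerD.
Qed.

End Weyl.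

Section Eigen.
Context {R : realType} {d : nat}.
Implicit Types (u v w : lattice_fun R d).

Lemma approx_joint_eigenvector (k : nat) (x : 'I_d -> R) (e : R) : (0 < k)%N ->
  (forall j, -1 <= x j <= 1) -> 0 < e ->
  exists2 u : lattice_fun R d, finitely_supported u & [/\ 0 < ell2_norm u,
    ell2_norm (Delta u - (\sum_j x j)%:C *: u) <= e * ell2_norm u &
    ell2_norm (commutator_op k u - (\sum_j velocity k (x j))%:C *: u) <= e * ell2_norm u].
Proof.
move=> k0 hx e0.
have /choice[z hz] j : exists z : R[i], Normc.normc z = 1 /\ complex.Re z = x j.
  by have [z z1 zx] := unit_circle_lift (hx j); exists z.
have z1 j : Normc.normc (z j) = 1 by case: (hz j).
have zx j : complex.Re (z j) = x j by case: (hz j).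
pose e' := e / (d.+1%:R * k.+1%:R).
have dk0 : 0 < d.+1%:R * k.+1%:R :> R by rewrite mulr_gt0 ?ltr0n.
have e'0 : 0 < e' by rewrite divr_gt0.
have [u fu [u0 hu]] := approx_translation_eigenvector z1 e'0.
have eu : ell2 u := finitely_supported_ell2 fu.
have eS j m : ell2 (lattice_shift j m u) by exact: ell2_shift.
exists u => //; set a := e' * ell2_norm u.
have a0 : 0 <= a by rewrite mulr_ge0 ?ell2_norm_ge0 ?ltW.
have pair j m : ell2_norm (lattice_shift j m%:Z u + lattice_shift j (- m%:Z) u
    - (2 * cheb m (x j))%:C *: u) <= 2 * m%:R * a.
  have [h1 h2] := shift_power_eigenvector z1 m eu (hu j).
  have -> : 2 * m%:R * a = m%:R * a + m%:R * a by ring.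
  have -> : lattice_shift j m%:Z u + lattice_shift j (- m%:Z) u
      - (2 * cheb m (x j))%:C *: u =
      (lattice_shift j m%:Z u - z j ^- m *: u) + (lattice_shift j (- m%:Z) u - z j ^+ m
        *: u).
    rewrite -zx -exprz_addV// addrC scalerDl opprD [- _ - _]addrC addrC addrACA.
    by rewrite -exprnN.
  apply: le_trans (ell2_normD _ _) (lerD h1 h2); by auto using ell2B, ell2Z.
have sums (f : 'I_d -> lattice_fun R d) (c b : R) : 0 <= b ->
    (forall j, ell2 (f j)) -> (forall j, ell2_norm (f j) <= b) -> b <= k.+1%:R * a ->
    ell2_norm (\sum_j f j) <= e * ell2_norm u.
  move=> b0 ef fb ba; apply: le_trans (ell2_norm_sum _ _) _; first by move=> j _;
    exact: ef.
  apply: (@le_trans _ _ (\sum_(j < d) b)); first by apply: ler_sum => j _; exact: fb.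
  rewrite sumr_const card_ord -[_ *+ d]mulr_natl.
  apply: (@le_trans _ _ (d.+1%:R * (k.+1%:R * a))).
    by rewrite ler_pM// ler_nat.
  by rewrite /a /e' !mulrA [_ * e]mulrC mulfK// gt_eqF.
split => //.
- rewrite rmorph_sum scaler_suml -sumrB.
  apply: (sums _ 0 a) => // [j|j|].
  + rewrite /Delta_ half_complex; auto using ell2B, ell2Z, ell2D.
  + have -> : Delta_ j u - (x j)%:C *: u = (2^-1)%:C *:
       (lattice_shift j 1%:Z u + lattice_shift j (- 1%:Z) u - (2 * cheb 1 (x j))%:C *: u).
      rewrite scalerBr scalerA -rmorphM cheb1 mulKf ?pnatr_eq0//.
      by rewrite /Delta_ half_complex.
    rewrite ell2_normZ; last by auto using ell2B, ell2Z, ell2D.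
    have := pair j 1%N; rewrite ger0_norm ?invr_ge0// mulr1 => h.
    by lra.
  + by rewrite -[leLHS]mul1r ler_wpM2r// ler1n.
- rewrite rmorph_sum scaler_suml -sumrB.
  apply: (sums _ 0 (k%:R * a)) => // [|j|j|].
  + by rewrite mulr_ge0.
  + auto 10 using ell2B, ell2Z, ell2D.
  + have -> : (4^-1)%:C *:
    ((lattice_shift j (k%:Z - 1) u + lattice_shift j (- (k%:Z - 1)) u)
   - (lattice_shift j (k%:Z + 1) u + lattice_shift j (- (k%:Z + 1)) u)) -
     (velocity k (x j))%:C *: u = (4^-1)%:C *:
     ((lattice_shift j k.-1%:Z u + lattice_shift j (- k.-1%:Z) u - (2 * cheb k.-1 (x
       j))%:C *: u)
      - (lattice_shift j k.+1%:Z u + lattice_shift j (- k.+1%:Z) u - (2 * cheb k.+1 (x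
        j))%:C *: u)).
      have -> : k%:Z - 1 = k.-1%:Z by rewrite -subn1 subzn.
      have -> : k%:Z + 1 = k.+1%:Z by rewrite -addn1 PoszD.
      have -> : velocity k (x j) = 4^-1 * (2 * cheb k.-1 (x j) - 2 * cheb k.+1 (x j)).
        by rewrite /velocity; field.
      rewrite rmorphM -scalerA -scalerBr rmorphB scalerBl.
      congr (_ *: _); set X := _ + lattice_shift j (- k.-1%:Z) u.
      by rewrite !opprB addrACA [RHS]addrACA; congr (_ + _); rewrite addrC.
    rewrite ell2_normZ; last by auto 10 using ell2B, ell2Z, ell2D.
    rewrite ger0_norm ?invr_ge0//.
    rewrite mulrC ler_pdivrMr//.
    apply: le_trans (ell2_normD _ _) _; try by auto 10 using ell2B, ell2Z, ell2D, ell2N.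
    rewrite ell2_normN (le_trans (lerD (pair j k.-1) (pair j k.+1)))//.
    have -> : (k.-1%:R : R) = k%:R - 1 by rewrite -subn1 natrB.
    by rewrite -natr1; lra.
  + by rewrite ler_wpM2r// ler_nat.
Qed.

End Eigen.

(** * The Mourre set in terms of the symbol on energy surfaces *)

Section Compactness.
Context {R : realType} {d : nat}.

Lemma cheb_continuous m : continuous (cheb m : R -> R).
Proof.
have : continuous (cheb m : R -> R) /\ continuous (cheb m.+1 : R -> R); last by case.
elim: m => [|m [IH1 IH2]]; first by split => x; [exact: cvg_cst|exact: cvg_id].
split => // x; rewrite (_ : cheb m.+2 = fun y => 2 * y * cheb m.+1 y - cheb m y).
  apply: cvgB; last exact: IH1.
  by apply: cvgM; [apply: cvgMr; exact: cvg_id|exact: IH2].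
by apply/funext => y; rewrite chebSS.
Qed.

Lemma velocity_continuous k : continuous (velocity k : R -> R).
Proof. by move=> x; apply: cvgMl; apply: cvgB; exact: cheb_continuous. Qed.

(** Where [h] vanishes, [f] is positive, so [f + |f| + h] is positive on the cube
    and has a positive minimum there.  Points with [f < 0] are then at a definite
    height of [h], and a large multiple of [h] makes up for the minimum of [f]. *)
Lemma penalized_lower_bound (f h : 'rV[R]_d -> R) : continuous f -> continuous h ->
  (forall x : 'rV[R]_d, (forall j, -1 <= x 0 j <= 1) -> 0 <= h x) ->
  (forall x : 'rV[R]_d, (forall j, -1 <= x 0 j <= 1) -> h x = 0 -> 0 < f x) ->
  exists K m, [/\ 0 < K, 0 < m &
    forall x : 'rV[R]_d, (forall j, -1 <= x 0 j <= 1) -> m <= f x + K * h x].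
Proof.
move=> cf ch h0 hf.
pose D : set 'rV[R]_d := [set x | forall j, `[-1, 1]%classic (x ord0 j)].
have DE x : D x <-> forall j, -1 <= x 0 j <= 1.
  by split => Dx j; have := Dx j; rewrite /= in_itv.
have cD : compact D.
  exact (@rV_compact R d (fun=> `[-1, 1]%classic) (fun=> @segment_compact _ _ _)).
have D0 : D !=set0.
  by exists 0; apply/DE => j; rewrite mxE lerN10 ler01.
pose g x := f x + `|f x| + h x.
have cg : continuous g.
  by move=> x; exact: (cvgD (cvgD (cf x) (cvg_norm (cf x))) (ch x)).
have [a aD ga] := compact_EVT_min D0 cD (continuous_subspaceT cg).
have [b bD fb] := compact_EVT_min D0 cD (continuous_subspaceT cf).
set m0 := g a in ga; set M := `|f b|.
have {}aD := (DE a).1 (set_mem aD).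
have m00 : 0 < m0.
  rewrite /m0 /g; have [ha|ha] := eqVneq (h a) 0.
    have := hf a aD ha => fa; rewrite ha addr0 gtr0_norm//; lra.
  have hap : 0 < h a by rewrite lt_neqAle eq_sym ha h0.
  by have := ler_norm (- f a); rewrite normrN; lra.
exists (M / m0 + 2), (m0 / 2); split.
- by rewrite ltr_wpDl// divr_ge0 ?normr_ge0 ?(ltW m00).
- by rewrite divr_gt0.
move=> x Dx; have xD : x \in D by apply/mem_set/DE.
have gx := ga x xD; have fx := fb x xD; have hx := h0 x Dx.
have e1 : (M / m0 + 2) * h x = M / m0 * h x + 2 * h x by ring.
have M0 : 0 <= M / m0 by rewrite divr_ge0 ?normr_ge0 ?(ltW m00).
have p1 : 0 <= M / m0 * h x by rewrite mulr_ge0.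
rewrite e1; have [f0|f0] := leP 0 (f x).
  by rewrite -/m0 /g ger0_norm// in gx; lra.
have gx' : m0 <= h x by move: gx; rewrite /g ltr0_norm//; lra.
have : M <= M / m0 * h x.
  by rewrite mulrAC ler_pdivlMr// ler_wpM2l ?normr_ge0.
have : - M <= f b by rewrite /M; have := ler_norm (- f b); rewrite normrN; lra.
lra.
Qed.

End Compactness.

Section Mourre.
Context {R : realType} {d : nat}.
Implicit Types (u v w : lattice_fun R d).

Definition energy_surface (E : R) (x : 'I_d -> R) : Prop :=
  (forall j, -1 <= x j <= 1) /\ \sum_j x j = E.

(** A bounded inverse of [Delta - E] would contradict the existence of
    approximate eigenvectors. *)
Lemma spectrum_Delta E x : energy_surface E x -> spectrum (@Delta R d) E.
Proof.
move=> [hx sx] [S [bS hS]]; have [M M0 SM] := bounded_op_bound bS.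
have e0 : 0 < (M + 1)^-1 by rewrite invr_gt0 ltr_wpDl.
have [u fu [u0 + _]] := approx_joint_eigenvector (ltn0Sn 0) hx e0; rewrite sx.
have eu := finitely_supported_ell2 fu.
have eD : ell2 (Delta u - E%:C *: u).
  by apply: ell2B (ell2Z _ eu); exact: (bounded_op_ell2 (@bounded_op_Delta R d)).
move=> h; have := SM _ eD; have [-> _] := hS u eu => h2.
have : ell2_norm u <= M * ((M + 1)^-1 * ell2_norm u).
  by apply: le_trans h2 _; rewrite ler_wpM2l.
have M1 : 0 < M + 1 by rewrite ltr_wpDl.
rewrite mulrA -[leLHS]mul1r ler_pM2r// -(ler_pM2r M1) mul1r divfK ?gt_eqF//; lra.
Qed.

Lemma commutator_op_i k u : ell2 u -> commutator_op k ('i *: u) = 'i *: commutator_op k u.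
Proof. by move=> eu; exact: (bounded_opZ (@bounded_op_commutator R d k)). Qed.

Lemma rin_commutator k u v : ell2 u -> ell2 v ->
  rin (commutator_op k u) v = rin u (commutator_op k v).
Proof.
move=> eu ev.
have es w j m : ell2 w -> ell2 (lattice_shift j m w) by exact: ell2_shift.
rewrite /commutator_op rin_suml ?rin_sumr//; try by auto 10 using ell2B, ell2Z, ell2D.
apply: eq_bigr => j _.
rewrite rinZl ?rinZr; try by auto 10 using ell2B, ell2Z, ell2D.
rewrite rinBl ?rinBr; try by auto 10 using ell2B, ell2Z, ell2D.
rewrite !rinDl ?rinDr; try by auto 10 using ell2B, ell2Z, ell2D, ell2N.
rewrite !rin_shift_adj !opprK; ring.
Qed.

Lemma rin_i_commutator k v : ell2 v -> rin ('i *: v) (commutator_op k v) = 0.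
Proof.
move=> ev; have eiv := ell2Z 'i ev; have bC := @bounded_op_commutator R d k.
have eC := bounded_op_ell2 bC ev; have eiC := ell2Z 'i eC.
have e1 := rin_commutator k eiv ev; have e2 := commutator_op_i k ev.
have e3 := rin_ii ('i *: commutator_op k v) v.
rewrite e2 in e1; rewrite -e1 -e3 scalerA.
have -> : 'i * 'i = -1 :> R[i] by rewrite -expr2 sqr_i.
rewrite scaleN1r (rinNl eC eiv) rinC -e1.
have : rin ('i *: commutator_op k v) v = - rin ('i *: commutator_op k v) v; last by lra.
rewrite -{1}e3 scalerA.
have -> : 'i * 'i = -1 :> R[i] by rewrite -expr2 sqr_i.
by rewrite scaleN1r (rinNl eC eiv) rinC e1.
Qed.

Variables (P : set R -> lattice_op R d).
Hypothesis hP : spectral_measure Delta P.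

(** For [v] in the spectral subspace of [(E - e, E + e)], [symbol_ge0] gives
    [m |v|^2 <= s <v, C v> + K |(Delta - E) v|^2] and [pvm_near] bounds the last
    term by [K e^2 |v|^2 = (m / 2) |v|^2]. *)
Lemma mourre_sufficient k (s E : R) : (0 < k)%N ->
  (exists x, energy_surface E x) ->
  (forall x, energy_surface E x -> 0 < s * \sum_j velocity k (x j)) ->
  mourre_set_sgn s Delta (conjugate_op (fun=> k)) P E.
Proof.
move=> k0 [x0 hx0] hG; split; first exact: spectrum_Delta hx0.
pose f (x : 'rV[R]_d) := s * \sum_j velocity k (x 0 j).
pose h (x : 'rV[R]_d) := (\sum_j x 0 j - E) ^+ 2.
have cs (g : R -> R) : continuous g -> continuous (fun x : 'rV[R]_d => \sum_j g (x 0 j)).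
  move=> cg; have cj j : continuous (fun x : 'rV[R]_d => g (x 0 j)).
    move=> x; have h1 := @coord_continuous R 1 d 0 j x.
    have h2 := cg (x 0 j).
    exact: (cvg_comp _ _ h1 h2).
  elim: (index_enum _) => [|j r IH].
    rewrite (_ : (fun _ => _) = fun=> 0); first exact: cst_continuous.
    by apply/funext => y; rewrite big_nil.
  rewrite (_ : (fun y => _) = fun y : 'rV[R]_d => g (y 0 j) + \sum_(i <- r) g (y 0 i)).
    by move=> x; exact: (cvgD (cj j x) (IH x)).
  by apply/funext => y; rewrite big_cons.
have cf : continuous f.
  by move=> x; have h1 := cs _ (@velocity_continuous R k) x; exact: (cvgM (cvg_cst s) h1).
have ch : continuous h.
  have c1 := cs id (fun y => cvg_id).
  rewrite (_ : h = fun y => (\sum_j y 0 j - E) * (\sum_j y 0 j - E)).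
    move=> x; have c2 : (fun y : 'rV[R]_d => \sum_j y 0 j - E) @ x --> \sum_j x 0 j - E.
      exact: (cvgB (c1 x) (cvg_cst E)).
    exact: (cvgM c2 c2).
  by apply/funext => y; rewrite /h expr2.
have [||K [m [K0 m0 hm]]] := penalized_lower_bound cf ch.
- by move=> x _; exact: sqr_ge0.
- move=> x hx /eqP; rewrite sqrf_eq0 subr_eq0 => /eqP hE.
  by apply: (hG (fun j => x 0 j)).
pose e := Num.sqrt (m / (2 * K)).
have mK : 0 < m / (2 * K) by rewrite divr_gt0// mulr_gt0.
have e0 : 0 < e by rewrite sqrtr_gt0.
have e2 : K * e ^+ 2 = m / 2.
  rewrite sqr_sqrtr ?ltW//; field; exact: lt0r_neq0.
have mI : measurable (`]E - e, E + e[%classic : set (measurableTypeR R))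
  by exact: measurable_itv.
exists (commutator_op k), `]E - e, E + e[%classic, (m / 2); split.
- exact: commutator_ext_commutator_op.
- split; [exact: itv_open|exact: interval_is_interval|].
  by rewrite /= in_itv /=; apply/andP; split; lra.
- by rewrite divr_gt0.
move=> u eu; set v := P _ u.
have ev : ell2 v by exact: (pvm_ell2 hP).
have eC : ell2 (commutator_op k v)
  by exact: (bounded_op_ell2 (@bounded_op_commutator R d k)).
have bP := pvm_bounded hP mI.
have ePC : ell2 (P `]E - e, E + e[%classic (commutator_op k v)) by exact: (pvm_ell2 hP).
have eiu := ell2Z 'i eu; have eiv := ell2Z 'i ev.
have Piu : P `]E - e, E + e[%classic ('i *: u) = 'i *: v by exact: (bounded_opZ bP).
have isC := rin_i_commutator k ev.
rewrite !inner_rin lecE /= !rinZr//.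
rewrite !(pvm_self_adjoint hP mI _ eC)// Piu isC mulr0.
have vi : rin ('i *: u) v = 0.
  have Pv : P `]E - e, E + e[%classic v = v by exact: (pvm_idem hP).
  rewrite -Pv (pvm_self_adjoint hP mI eiu ev) Piu.
  exact: rin_i_diag.
apply/andP; split.
  by apply/eqP; rewrite -[LHS](mulr0 (m / 2)); congr (_ * _); exact: esym vi.
rewrite -[P _ u]/v (pvm_sqr hP mI eu) -/v.
have near : rin (Delta v - E%:C *: v) (Delta v - E%:C *: v) <= e ^+ 2 * rin v v.
  apply: (pvm_near (@bounded_op_Delta R d) (@rin_Delta R d) hP mI eu e0) => x.
  by rewrite /= in_itv /= => /andP[/ltW -> /ltW ->].
have := @symbol_ge0 R d k s K E m k0 _ v ev.
have hx (x : 'I_d -> R) : (forall j, -1 <= x j <= 1) ->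
    m <= s * \sum_j velocity k (x j) + K * (\sum_j x j - E) ^+ 2.
  move=> hx; have := hm (\row_j x j); rewrite /f /h.
  have -> : \sum_j velocity k ((\row_j x j) 0 j) = \sum_j velocity k (x j).
    by apply: eq_bigr => j _; rewrite mxE.
  have -> : \sum_j (\row_j x j) 0 j = \sum_j x j.
    by apply: eq_bigr => j _; rewrite mxE.
  by apply => j; rewrite mxE.
move=> /(_ hx) pos.
have : K * rin (Delta v - E%:C *: v) (Delta v - E%:C *: v) <= m / 2 * rin v v.
  by rewrite -e2 -mulrA ler_pM2l.
lra.
Qed.

(** Test the Mourre estimate on a wave packet [u] of precision [e].  With
    [v = P I u] and [w = u - v], [pvm_far] gives [|w| <= c e |u|], so the estimate
    yields [gamma <= s * G x + O(e)] for all small [e]. *)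
Lemma mourre_necessary k (s E : R) x : (0 < k)%N ->
  mourre_set_sgn s Delta (conjugate_op (fun=> k)) P E ->
  energy_surface E x -> 0 < s * \sum_j velocity k (x j).
Proof.
move=> k0 [_ [C [I [gamma [hC [oI _ IE] g0 hge]]]]] [hx sx].
set G := \sum_j velocity k (x j).
have [bC _] := hC; have [M M0 CM] := bounded_op_bound bC.
have mI : measurable (I : set (measurableTypeR R))
  by exact: measurable_realfun.open_measurable.
have [del del0 delI] : exists2 del : R, 0 < del & forall y : R, E - del < y < E + del
  -> I y.
  have /nbhs_ballP[del /= del0 hdel] := open_nbhs_nbhs (conj oI IE).
  exists del => // y /andP[y1 y2]; apply: hdel.
  by rewrite /ball /= ltr_norml; apply/andP; split; lra.
have [c c0 cdel] : exists2 c : R, 0 <= c & del * c = 2.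
  by exists (2 / del); [rewrite divr_ge0// ltW|rewrite mulrC divfK// gt_eqF].
pose K := `|s| * (1 + 2 * M * c) + gamma * c ^+ 2.
have K0 : 0 <= K.
  have Mc : 0 <= 2 * M * c by rewrite mulr_ge0// mulr_ge0.
  apply: addr_ge0; apply: mulr_ge0; rewrite ?normr_ge0 ?sqr_ge0 ?(ltW g0)//.
  exact: addr_ge0.
have main e : 0 < e -> e <= 1 -> gamma <= s * G + e * K.
  move=> e0 e1; have [u fu [u0 + +]] := approx_joint_eigenvector k0 hx e0.
  rewrite sx -/G => hD hV; set nu := ell2_norm u in u0 hD hV.
  have eu := finitely_supported_ell2 fu; set v := P I u; set w := P (~` I) u.
  have mCI := measurableC mI.
  have ev : ell2 v by exact: (pvm_ell2 hP).
  have ew : ell2 w by exact: (pvm_ell2 hP).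
  have uvw : u = v + w by exact: (pvm_complement hP).
  have eC y : ell2 y -> ell2 (C y) by exact: (bounded_op_ell2 bC).
  have eDu : ell2 (Delta u - E%:C *: u).
    by apply: ell2B (ell2Z _ eu); exact: (bounded_op_ell2 (@bounded_op_Delta R d)).
  have eV : ell2 (commutator_op k u)
    by exact: (bounded_op_ell2 (@bounded_op_commutator R d k)).
  have vw : rin v w = 0.
    rewrite /w (pvm_self_adjoint hP)// (pvm_disjoint hP) ?rin0l//; exact: setICl.
  have nuE : nu ^+ 2 = rin v v + rin w w.
    rewrite /nu ell2_norm_sqr uvw rinDl ?rinDr//; try by auto using ell2D.
    by rewrite (rinC w v) vw; ring.
  have nw : ell2_norm w <= c * e * nu.
    rewrite -(@ler_pXn2r _ 2)// ?nnegrE ?ell2_norm_ge0//; last first.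
      by rewrite !mulr_ge0 ?(ltW e0) ?(ltW u0).
    have far := pvm_far (@bounded_op_Delta R d) (@rin_Delta R d) hP mI eu del0 delI.
    have hD2 : rin (Delta u - E%:C *: u) (Delta u - E%:C *: u) <= (e * nu) ^+ 2.
      by rewrite -ell2_norm_sqr ler_pXn2r// ?nnegrE ?ell2_norm_ge0// mulr_ge0 ?(ltW e0)
        ?(ltW u0).
    rewrite ell2_norm_sqr -/w in far *.
    rewrite -(ler_pM2l (exprn_gt0 2 del0)); apply: le_trans far _.
    have -> : del ^+ 2 * (c * e * nu) ^+ 2 = 4 * (e * nu) ^+ 2.
      by rewrite -mulrA exprMn mulrA -exprMn cdel; ring.
    have := sqr_ge0 (e * nu); lra.
  have nv : ell2_norm v <= nu.
    rewrite -(@ler_pXn2r _ 2)// ?nnegrE ?ell2_norm_ge0// nuE ell2_norm_sqr.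
    by rewrite lerDl rin_ge0.
  have cvv : rin v (C v) = G * nu ^+ 2 + rin u (commutator_op k u - G%:C *: u)
      - rin w (C u) - rin v (C w).
    rewrite rinBr ?rinZr; try by auto using ell2Z.
    rewrite -(commutator_ext_finite hC fu fu) /nu ell2_norm_sqr.
    have f1 : rin u (C u) = rin v (C u) + rin w (C u).
      by rewrite [in LHS]uvw -[in C _]uvw rinDl; auto.
    have f2 : rin v (C u) = rin v (C v) + rin v (C w).
      by rewrite [in LHS]uvw (bounded_opD bC ev ew) rinDr; auto.
    by rewrite f1 f2; ring.
  have b1 : `|rin u (commutator_op k u - G%:C *: u)| <= e * nu ^+ 2.
    apply: le_trans (ler_rin _ _) _; try by auto using ell2B, ell2Z.
    by rewrite expr2 mulrCA ler_wpM2l// ltW.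
  have b2 : `|rin w (C u)| <= c * e * nu * (M * nu).
    apply: le_trans (ler_rin _ _) _; try by auto.
    by rewrite ler_pM ?ell2_norm_ge0//; exact: CM.
  have b3 : `|rin v (C w)| <= nu * (M * (c * e * nu)).
    apply: le_trans (ler_rin _ _) _; try by auto.
    rewrite ler_pM ?ell2_norm_ge0//; apply: le_trans (CM _ ew) _.
    by rewrite ler_wpM2l.
  have lo : gamma * rin v v <= s * rin v (C v).
    have := hge u eu; rewrite !inner_rin lecE /= => /andP[_].
    have eCv := eC _ ev.
    have ePC : ell2 (P I (C v)) by exact: (pvm_ell2 hP).
    by rewrite !rinZr// (pvm_self_adjoint hP mI eu eCv) (pvm_sqr hP).
  have b4 : s * rin v (C v) <= s * G * nu ^+ 2 + `|s| * (e * (1 + 2 * M * c)) * nu ^+ 2.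
    set A := rin u _ in cvv b1; set B := rin w _ in cvv b2;
      set D := rin v (C w) in cvv b3.
    have b : `|A - B - D| <= e * (1 + 2 * M * c) * nu ^+ 2.
      rewrite (le_trans (ler_normB _ _))// (le_trans (lerD (ler_normB _ _) (lexx _)))//.
      lra.
    rewrite cvv (_ : s * _ = s * G * nu ^+ 2 + s * (A - B - D)); last by ring.
    rewrite lerD2l (le_trans (ler_norm _))// normrM -mulrA.
    by apply: ler_wpM2l => //; exact: normr_ge0.
  have b5 : rin w w <= (c * e) ^+ 2 * nu ^+ 2.
    by rewrite -ell2_norm_sqr -exprMn ler_pXn2r// ?nnegrE ?ell2_norm_ge0// !mulr_ge0
      ?(ltW e0) ?(ltW u0).
  have nu2 : 0 < nu ^+ 2 by rewrite exprn_gt0.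
  rewrite -(ler_pM2r nu2).
  have b6 : (c * e) ^+ 2 <= c ^+ 2 * e.
    by rewrite exprMn ler_wpM2l ?sqr_ge0// expr2 ler_piMl// ltW.
  have b7 : gamma * rin w w <= gamma * (c ^+ 2 * e * nu ^+ 2).
    rewrite ler_wpM2l ?(ltW g0)// (le_trans b5)//.
    by rewrite ler_wpM2r// ltW.
  rewrite /K; nra.
have [//|sG] := ltP 0 (s * G).
have gK : 0 < 2 * (K + gamma) by rewrite mulr_gt0// ltr_wpDl.
(* Any precision [t] with [t * K < gamma] and [t <= 1] contradicts [main]. *)
pose t := gamma / (2 * (K + gamma)).
have t0 : 0 < t by rewrite divr_gt0.
have t1 : t <= 1 by rewrite ler_pdivrMr// mul1r; lra.
have te : t * (2 * (K + gamma)) = gamma by rewrite divfK// gt_eqF.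
have tg : 0 < t * gamma by rewrite mulr_gt0.
have := main t t0 t1; lra.
Qed.

End Mourre.

(** * The symbols for k = 2, 3, 4 *)

Section Symbol.
Context {R : realType}.
Implicit Types (a b c x y E s p : R).

Lemma velocity2E x : velocity 2 x = 2 * x * (1 - x ^+ 2).
Proof. by rewrite /velocity /cheb /=; field. Qed.

Lemma velocity3E x : velocity 3 x = (1 - x ^+ 2) * (4 * x ^+ 2 - 1).
Proof. by rewrite /velocity /cheb /=; field. Qed.

Lemma velocity4E x : velocity 4 x = 4 * x * (1 - x ^+ 2) * (2 * x ^+ 2 - 1).
Proof. by rewrite /velocity /cheb /=; field. Qed.

Lemma velocity2N x : velocity 2 (- x) = - velocity 2 x.
Proof. by rewrite !velocity2E; ring. Qed.

Lemma velocity4N x : velocity 4 (- x) = - velocity 4 x.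
Proof. by rewrite !velocity4E; ring. Qed.

Lemma velocity2_gt0 x : 0 < x < 1 -> 0 < velocity 2 x.
Proof.
move=> /andP[x0 x1]; rewrite velocity2E (_ : _ * _ = 2 * x * ((1 - x) * (1 + x)));
  last by ring.
by rewrite !mulr_gt0//; lra.
Qed.

Lemma velocity2_ge0 x : 0 <= x <= 1 -> 0 <= velocity 2 x.
Proof.
move=> /andP[x0 x1]; rewrite velocity2E (_ : _ * _ = 2 * x * ((1 - x) * (1 + x)));
  last by ring.
by rewrite !mulr_ge0//; lra.
Qed.

Lemma velocity2_le0 x : -1 <= x <= 0 -> velocity 2 x <= 0.
Proof.
move=> /andP[x0 x1]; rewrite -[x]opprK velocity2N oppr_le0.
by apply: velocity2_ge0; apply/andP; split; lra.
Qed.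

Local Lemma velocity3_factor x : velocity 3 x = (1 - x) * (1 + x) * ((2 * x - 1) * (2 *
  x + 1)).
Proof. by rewrite velocity3E; ring. Qed.

Lemma velocity3_gt0 x : 2^-1 < x < 1 -> 0 < velocity 3 x.
Proof. by move=> /andP[x0 x1]; rewrite velocity3_factor !mulr_gt0//; lra. Qed.

Lemma velocity3_ge0 x : 2^-1 <= x <= 1 -> 0 <= velocity 3 x.
Proof. by move=> /andP[x0 x1]; rewrite velocity3_factor !mulr_ge0//; lra. Qed.

Lemma velocity3N x : velocity 3 (- x) = velocity 3 x.
Proof. by rewrite !velocity3E sqrrN. Qed.

Lemma velocity3_lt0 x : - 2^-1 < x < 2^-1 -> velocity 3 x < 0.
Proof.
move=> /andP[x0 x1]; rewrite -oppr_gt0.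
rewrite (_ : - _ = (1 - x) * (1 + x) * ((1 - 2 * x) * (2 * x + 1)));
  last by rewrite velocity3_factor; ring.
by rewrite !mulr_gt0//; lra.
Qed.

Lemma velocity3_le0 x : - 2^-1 <= x <= 2^-1 -> velocity 3 x <= 0.
Proof.
move=> /andP[x0 x1]; rewrite -oppr_ge0.
rewrite (_ : - _ = (1 - x) * (1 + x) * ((1 - 2 * x) * (2 * x + 1)));
  last by rewrite velocity3_factor; ring.
by rewrite !mulr_ge0//; lra.
Qed.

(** All that linear arithmetic needs to know about the square root of 2; likewise
    for the thresholds below. *)
Lemma sqrt2_facts : exists t : R, [/\ Num.sqrt 2 = t, (Num.sqrt 2)^-1 = t / 2,
  t * t = 2, 141 / 100 < t & t < 142 / 100].
Proof.
exists (Num.sqrt 2); have t2 : Num.sqrt 2 * Num.sqrt 2 = 2 :> R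
  by rewrite -expr2 sqr_sqrtr.
have t0 : 0 <= Num.sqrt 2 :> R := sqrtr_ge0 2.
split=> //; last 2 first.
- by rewrite ltNge; apply/negP => h; nra.
- by rewrite ltNge; apply/negP => h; nra.
have tn0 : Num.sqrt 2 != 0 :> R by rewrite sqrtr_eq0 -ltNge.
by apply: (mulfI tn0); rewrite divff// mulrA t2 divff.
Qed.

Local Notation h2 := ((Num.sqrt 2)^-1 : R).

Local Lemma velocity4_factor x : velocity 4 x = 8 * (x * (1 - x) * (1 + x) * ((x - h2)
  * (x + h2))).
Proof.
rewrite velocity4E; have [t [-> -> t2 _ _]] := sqrt2_facts.
have -> : (x - t / 2) * (x + t / 2) = x ^+ 2 - t * t / 4 by field.
by rewrite t2; field.
Qed.

Local Lemma inv_sqrt2_gt0 : 0 < h2.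
Proof. by rewrite invr_gt0 sqrtr_gt0. Qed.

Local Lemma inv_sqrt2_lt1 : h2 < 1.
Proof. by have [t [_ -> _ _ t5]] := sqrt2_facts; lra. Qed.

Lemma velocity4_gt0 x : h2 < x < 1 -> 0 < velocity 4 x.
Proof. by have := inv_sqrt2_gt0; move=> h0 /andP[x0 x1];
  rewrite velocity4_factor !mulr_gt0//; lra. Qed.

Lemma velocity4_ge0 x : h2 <= x <= 1 -> 0 <= velocity 4 x.
Proof. by have := inv_sqrt2_gt0; move=> h0 /andP[x0 x1];
  rewrite velocity4_factor !mulr_ge0//; lra. Qed.

Lemma velocity4_lt0 x : 0 < x < h2 -> velocity 4 x < 0.
Proof.
have h0 := inv_sqrt2_gt0; have h1 := inv_sqrt2_lt1; move=> /andP[x0 x1];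
  rewrite -oppr_gt0.
rewrite (_ : - _ = 8 * (x * (1 - x) * (1 + x) * ((h2 - x) * (x + h2))));
  last by rewrite velocity4_factor; ring.
by rewrite !mulr_gt0//; lra.
Qed.

Lemma velocity4_le0 x : 0 <= x <= h2 -> velocity 4 x <= 0.
Proof.
have h0 := inv_sqrt2_gt0; have h1 := inv_sqrt2_lt1; move=> /andP[x0 x1];
  rewrite -oppr_ge0.
rewrite (_ : - _ = 8 * (x * (1 - x) * (1 + x) * ((h2 - x) * (x + h2))));
  last by rewrite velocity4_factor; ring.
by rewrite !mulr_ge0//; lra.
Qed.

Lemma velocity4_ge0N x : - h2 <= x <= 0 -> 0 <= velocity 4 x.
Proof.
move=> /andP[x0 x1]; rewrite -[x]opprK velocity4N oppr_ge0.
by apply: velocity4_le0; apply/andP; split; lra.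
Qed.

(** Completed squares: at fixed [s = a + b], the symbol for [d = 2] is quadratic
    in [p = a * b] (times [s] when [k = 4]). *)
Lemma velocity3_add a b : 8 * (velocity 3 a + velocity 3 b) =
  32 * (a + b) ^+ 4 - 40 * (a + b) ^+ 2 + 9 - (8 * (a * b) - (8 * (a + b) ^+ 2 - 5)) ^+ 2.
Proof. by rewrite !velocity3E; ring. Qed.

Lemma velocity4_add a b : 10 * (velocity 4 a + velocity 4 b) = (a + b) *
  (20 * (a + b) ^+ 4 - 60 * (a + b) ^+ 2 + 41 - (20 * (a * b) - (10 * (a + b) ^+ 2 -
    9)) ^+ 2).
Proof. by rewrite !velocity4E; ring. Qed.

Definition threshold3 : R := 2^-1 * Num.sqrt (2^-1 * (5 - Num.sqrt 7)).
Definition threshold4 : R := Num.sqrt (3 / 2 - (Num.sqrt 5)^-1).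

Lemma threshold3_facts : exists q : R, [/\ 26 / 10 < q, q < 27 / 10, q * q = 7,
  0 <= threshold3 & threshold3 ^+ 2 = (5 - q) / 8].
Proof.
exists (Num.sqrt 7); have q2 : Num.sqrt 7 * Num.sqrt 7 = 7 :> R
  by rewrite -expr2 sqr_sqrtr.
have q0 : 0 <= Num.sqrt 7 :> R := sqrtr_ge0 7.
have q1 : 26 / 10 < Num.sqrt 7 :> R by rewrite ltNge; apply/negP => h; nra.
have q3 : Num.sqrt 7 < 27 / 10 :> R by rewrite ltNge; apply/negP => h; nra.
split=> //; first by rewrite mulr_ge0// ?sqrtr_ge0.
by rewrite exprMn sqr_sqrtr; [field|lra].
Qed.

Lemma threshold4_facts : exists r : R, [/\ 44 / 100 < r, r < 45 / 100, r * r = 5^-1,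
  0 <= threshold4 & threshold4 ^+ 2 = 3 / 2 - r].
Proof.
exists (Num.sqrt 5)^-1.
have q2 : (Num.sqrt 5)^-1 * (Num.sqrt 5)^-1 = 5^-1 :> R
  by rewrite -invfM -expr2 sqr_sqrtr.
have q0 : 0 <= (Num.sqrt 5)^-1 :> R by rewrite invr_ge0 sqrtr_ge0.
have q1 : 44 / 100 < (Num.sqrt 5)^-1 :> R by rewrite ltNge; apply/negP => h; nra.
have q3 : (Num.sqrt 5)^-1 < 45 / 100 :> R by rewrite ltNge; apply/negP => h; nra.
split=> //; first exact: sqrtr_ge0.
by rewrite sqr_sqrtr//; lra.
Qed.

(** Below the larger root of the discriminant, here for [S = s^2 < 5/6], the
    quadratic in [p] is negative everywhere.  For larger [S] its maximum under the
    constraint [p <= S / 4] is at [a = b = s / 2], where it is negative as long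
    as [S < 1]. *)
Lemma velocity3_band a b : threshold3 < a + b < 1 -> velocity 3 a + velocity 3 b < 0.
Proof.
move=> /andP[s0 s1]; have [q [q1 q2 qq c0 c2]] := threshold3_facts.
rewrite -(pmulr_rlt0 _ (ltr0Sn R 7)) velocity3_add.
have pS : 4 * (a * b) <= (a + b) ^+ 2.
  by rewrite -subr_ge0 (_ : _ - _ = (a - b) ^+ 2); [exact: sqr_ge0|ring].
set s := a + b in s0 s1 pS *; set p := a * b in pS *.
have S0 : (5 - q) / 8 < s ^+ 2 by rewrite -c2 ltr_pXn2r// nnegrE//; lra.
have S1 : s ^+ 2 < 1 by rewrite expr_lt1//; lra.
rewrite (_ : s ^+ 4 = s ^+ 2 * s ^+ 2); last by ring.
move: (s ^+ 2) S0 S1 pS => S S0 S1 pS.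
have [S2|S2] := ltP S (5 / 6).
  have : 32 * (S * S) - 40 * S + 9 < 0.
    have -> : 32 * (S * S) - 40 * S + 9 = - (32 * ((S - (5 - q) / 8) * ((5 + q) / 8 -
      S))) + (q * q - 7) / 2.
      by field.
    rewrite qq subrr mul0r addr0 oppr_lt0 !mulr_gt0//; lra.
  by have := sqr_ge0 (8 * p - (8 * S - 5)); lra.
have : (6 * S - 5) ^+ 2 <= (8 * p - (8 * S - 5)) ^+ 2.
  by rewrite -[leRHS]sqrrN ler_pXn2r// ?nnegrE; lra.
have -> : 32 * (S * S) - 40 * S + 9 = (6 * S - 5) ^+ 2 - 4 * ((1 - S) * (4 - S)) by ring.
have : 0 < (1 - S) * (4 - S) by rewrite mulr_gt0//; lra.
lra.
Qed.

(** As for [velocity3_band]; the vertex [p = S / 2 - 9/20] passes the bound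
    [p <= S / 4] at [S = 9/5], and the value at [a = b] is negative for
    [S < 2]. *)
Lemma velocity4_band a b : threshold4 < a + b < Num.sqrt 2 ->
  velocity 4 a + velocity 4 b < 0.
Proof.
move=> /andP[s0 s1]; have [q [q1 q2 qq c0 c2]] := threshold4_facts.
rewrite -(pmulr_rlt0 _ (ltr0Sn R 9)) velocity4_add.
have pS : 4 * (a * b) <= (a + b) ^+ 2.
  by rewrite -subr_ge0 (_ : _ - _ = (a - b) ^+ 2); [exact: sqr_ge0|ring].
set s := a + b in s0 s1 pS *; set p := a * b in pS *.
have sp : 0 < s by lra.
have S0 : 3 / 2 - q < s ^+ 2 by rewrite -c2 ltr_pXn2r// nnegrE//; lra.
have S1 : s ^+ 2 < 2.
  rewrite -[ltRHS](@sqr_sqrtr _ 2)// ltr_pXn2r// nnegrE ?sqrtr_ge0//; lra.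
rewrite pmulr_rlt0// (_ : s ^+ 4 = s ^+ 2 * s ^+ 2); last by ring.
move: (s ^+ 2) S0 S1 pS => S S0 S1 pS.
have [S2|S2] := ltP S (9 / 5).
  have : 20 * (S * S) - 60 * S + 41 < 0.
    have -> : 20 * (S * S) - 60 * S + 41 =
        - (20 * ((S - (3 / 2 - q)) * ((3 / 2 + q) - S))) + 20 * (q * q - 5^-1).
      by field.
    rewrite qq subrr mulr0 addr0 oppr_lt0 !mulr_gt0//; lra.
  by have := sqr_ge0 (20 * p - (10 * S - 9)); lra.
have : (5 * S - 9) ^+ 2 <= (20 * p - (10 * S - 9)) ^+ 2.
  by rewrite -[leRHS]sqrrN ler_pXn2r// ?nnegrE; lra.
have -> : 20 * (S * S) - 60 * S + 41 = (5 * S - 9) ^+ 2 - 5 * ((2 - S) * (4 - S)) by ring.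
have : 0 < (2 - S) * (4 - S) by rewrite mulr_gt0//; lra.
lra.
Qed.

(** The condition [0 <= 1 - s + p] is [0 <= (1 - a) * (1 - b)]. *)
Lemma roots_in_box s p : 0 <= s <= 2 -> 4 * p <= s ^+ 2 -> 0 <= 1 - s + p ->
  exists a b, [/\ -1 <= a <= 1, -1 <= b <= 1, a + b = s & a * b = p].
Proof.
move=> /andP[s0 s2] ps p1; pose D := Num.sqrt (s ^+ 2 - 4 * p).
have D0 : 0 <= D := sqrtr_ge0 _.
have D2 : D ^+ 2 = s ^+ 2 - 4 * p by rewrite sqr_sqrtr//; lra.
have D3 : D <= 2 - s.
  rewrite -(@ler_pXn2r _ 2)// ?nnegrE//; [|lra].
  by rewrite D2 (_ : (2 - s) ^+ 2 = s ^+ 2 + 4 - 4 * s); [lra|ring].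
exists ((s + D) / 2), ((s - D) / 2); split.
- by apply/andP; split; lra.
- by apply/andP; split; lra.
- by field.
- rewrite (_ : _ * _ = (s ^+ 2 - D ^+ 2) / 4); last by field.
  by rewrite D2; field.
Qed.

(** Take [p] at the vertex of the quadratic, where the value is the discriminant
    over 8, nonnegative below the threshold. *)
Lemma velocity3_witness s : 0 <= s <= threshold3 ->
  exists a b, [/\ -1 <= a <= 1, -1 <= b <= 1, a + b = s & 0 <= velocity 3 a + velocity
    3 b].
Proof.
move=> /andP[s0 s1]; have [q [q1 q2 qq c0 c2]] := threshold3_facts.
have S1 : s ^+ 2 <= (5 - q) / 8 by rewrite -c2 ler_pXn2r// nnegrE.
have s2 : s <= 1 by rewrite -(@ler_pXn2r _ 2)// ?nnegrE// expr1n; lra.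
have [|||a [b [ha hb ab pab]]] := @roots_in_box s (s ^+ 2 - 5 / 8).
- by apply/andP; split; lra.
- lra.
- rewrite (_ : 1 - s + _ = (s - 2^-1) ^+ 2 + 1 / 8); last by field.
  by have := sqr_ge0 (s - 2^-1); lra.
exists a, b; split=> //.
rewrite -(pmulr_rge0 _ (ltr0Sn R 7)) velocity3_add ab pab.
rewrite (_ : 8 * (s ^+ 2 - 5 / 8) - (8 * s ^+ 2 - 5) = 0); last by field.
rewrite expr0n /= subr0 (_ : s ^+ 4 = s ^+ 2 * s ^+ 2); last by ring.
move: (s ^+ 2) S1 => S S1.
have -> : 32 * (S * S) - 40 * S + 9 = 32 * (((5 - q) / 8 - S) * ((5 + q) / 8 - S)) + (q
  * q - 7) / 2.
  by field.
rewrite qq subrr mul0r addr0 !mulr_ge0//; lra.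
Qed.

(** As for [velocity3_witness], with the vertex [p = s^2 / 2 - 9/20]. *)
Lemma velocity4_witness s : 0 <= s <= threshold4 ->
  exists a b, [/\ -1 <= a <= 1, -1 <= b <= 1, a + b = s & 0 <= velocity 4 a + velocity
    4 b].
Proof.
move=> /andP[s0 s1]; have [q [q1 q2 qq c0 c2]] := threshold4_facts.
have S1 : s ^+ 2 <= 3 / 2 - q by rewrite -c2 ler_pXn2r// nnegrE.
have s2 : s <= 2 by rewrite -(@ler_pXn2r _ 2)// ?nnegrE//; lra.
have [|||a [b [ha hb ab pab]]] := @roots_in_box s (s ^+ 2 / 2 - 9 / 20).
- by apply/andP; split; lra.
- lra.
- rewrite (_ : 1 - s + _ = (s - 1) ^+ 2 / 2 + 1 / 20); last by field.
  by have := sqr_ge0 (s - 1); lra.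
exists a, b; split=> //.
rewrite -(pmulr_rge0 _ (ltr0Sn R 9)) velocity4_add ab pab.
rewrite (_ : 20 * (s ^+ 2 / 2 - 9 / 20) - (10 * s ^+ 2 - 9) = 0); last by field.
rewrite expr0n /= subr0 mulr_ge0// (_ : s ^+ 4 = s ^+ 2 * s ^+ 2); last by ring.
move: (s ^+ 2) S1 => S S1.
have -> : 20 * (S * S) - 60 * S + 41 =
   20 * ((3 / 2 - q - S) * (3 / 2 + q - S)) + 20 * (q * q - 5^-1) by field.
rewrite qq subrr mulr0 addr0 !mulr_ge0//; lra.
Qed.

End Symbol.

(** * Sign of the symbol on energy surfaces *)

Section Surfaces.
Context {R : realType}.
Implicit Types (E h : R).

Lemma energy_surface_nonempty d E : 0 <= E <= d%:R -> exists x : 'I_d ->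
  R, energy_surface E x.
Proof.
move=> /andP[E0 Ed]; case: d Ed => [|d] Ed.
  exists (fun=> 0); split; first by case.
  by rewrite big_ord0; apply/eqP; rewrite eq_le Ed E0.
exists (fun=> E / d.+1%:R); split.
  move=> _; rewrite ler_pdivrMr ?mul1r ?ltr0n// Ed andbT (@le_trans _ _ 0)//.
  by rewrite divr_ge0.
by rewrite sumr_const card_ord -[_ *+ d.+1]mulr_natr divfK// pnatr_eq0.
Qed.

Definition sign_definite k d E : Prop := exists2 s : R, s = 1 \/ s = -1 &
  forall x : 'I_d -> R, energy_surface E x -> 0 < s * \sum_j velocity k (x j).

Definition sign_indefinite k d E : Prop :=
  (exists2 x : 'I_d -> R, energy_surface E x & \sum_j velocity k (x j) <= 0) /\
  (exists2 x : 'I_d -> R, energy_surface E x & 0 <= \sum_j velocity k (x j)).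

Lemma mourre_set_definite k d (P : set R -> lattice_op R d) E : (0 < k)%N ->
  spectral_measure Delta P -> 0 <= E <= d%:R -> sign_definite k d E ->
  mourre_set Delta (conjugate_op (fun=> k)) P E.
Proof.
move=> k0 hP hE [s [->|->] hs]; [left|right];
  exact: (mourre_sufficient hP k0 (energy_surface_nonempty hE)).
Qed.

Lemma mourre_set_indefinite k d (P : set R -> lattice_op R d) E : (0 < k)%N ->
  spectral_measure Delta P -> sign_indefinite k d E ->
  ~ mourre_set Delta (conjugate_op (fun=> k)) P E.
Proof.
move=> k0 hP [[x sx x0] [y sy y0]] [h|h].
  by have := mourre_necessary hP k0 h sx; rewrite mul1r ltNge x0.
by have := mourre_necessary hP k0 h sy; rewrite mulN1r oppr_gt0 ltNge y0.
Qed.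

(** The defects [1 - x j] are nonnegative and add up to [d - E], which is less than
    [1 - h] and positive: every coordinate exceeds [h] and some coordinate is less
    than 1. *)
Lemma sign_definite_top k d E h : 0 <= h -> velocity k (1 : R) = 0 ->
  (forall y, h < y < 1 -> 0 < velocity k y) ->
  d%:R - 1 + h < E < d%:R -> sign_definite k d E.
Proof.
move=> h0 v1 vp /andP[E1 E2]; exists 1; [by left|move=> x [hx sx]; rewrite mul1r].
have sub1 : \sum_(j < d) (1 - x j) = d%:R - E.
  by rewrite sumrB sumr_const card_ord sx.
have xh j : h < x j.
  have : 1 - x j <= \sum_(j < d) (1 - x j).
    rewrite (bigD1 j)//= lerDl sumr_ge0// => i _.
    by have /andP[_] := hx i; rewrite subr_ge0.
  by rewrite sub1; lra.
have vge j : 0 <= velocity k (x j).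
  have /andP[_ x1] := hx j; have [->|xn1] := eqVneq (x j) 1; first by rewrite v1.
  by rewrite ltW// vp// xh lt_neqAle xn1.
have [j xj] : exists j, x j < 1.
  apply: contrapT => /forallNP nx; have : \sum_(j < d) (1 - x j) <= 0.
    by apply: sumr_le0 => j _; rewrite subr_le0 leNgt; apply/negP/nx.
  by rewrite sub1; lra.
rewrite (bigD1 j)//= ltr_wpDr ?sumr_ge0// vp// xh//.
Qed.

Local Definition vec d (l : seq R) : 'I_d -> R := fun i => nth 0 l i.

Lemma sign_indefinite_seq k d E (l1 l2 : seq R) : size l1 = d -> size l2 = d ->
  {in l1, forall y, -1 <= y <= 1} -> {in l2, forall y, -1 <= y <= 1} ->
  \sum_(y <- l1) y = E -> \sum_(y <- l2) y = E ->
  \sum_(y <- l1) velocity k y <= 0 -> 0 <= \sum_(y <- l2) velocity k y ->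
  sign_indefinite k d E.
Proof.
have sumE (f : R -> R) (l : seq R) : size l = d ->
  \sum_j f (@vec d l j) = \sum_(y <- l) f y.
  by move=> sl; rewrite (big_nth 0) sl big_mkord.
move=> s1 s2 b1 b2 e1 e2 h1 h2; split; [exists (@vec d l1)|exists (@vec d l2)].
- by split; [move=> j; apply: b1; rewrite mem_nth// s1|rewrite (sumE id)].
- by rewrite sumE.
- by split; [move=> j; apply: b2; rewrite mem_nth// s2|rewrite (sumE id)].
- by rewrite sumE.
Qed.

Lemma sign_indefinite1 k E : -1 <= E <= 1 -> velocity k E = 0 -> sign_indefinite k 1 E.
Proof.
move=> hE vE; apply: (@sign_indefinite_seq k 1 E [:: E] [:: E]) => //;
  by [move=> y; rewrite inE => /eqP ->|rewrite big_seq1// vE].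
Qed.

Lemma sign_indefinite2 k E a b a' b' :
  [&& -1 <= a <= 1, -1 <= b <= 1, -1 <= a' <= 1 & -1 <= b' <= 1] ->
  a + b = E -> a' + b' = E ->
  velocity k a + velocity k b <= 0 -> 0 <= velocity k a' + velocity k b' ->
  sign_indefinite k 2 E.
Proof.
move=> /and4P[ha hb ha' hb'] e1 e2 h1 h2.
apply: (@sign_indefinite_seq k 2 E [:: a; b] [:: a'; b']) => //.
- by move=> y; rewrite !inE => /orP[] /eqP ->.
- by move=> y; rewrite !inE => /orP[] /eqP ->.
- by rewrite !big_cons big_nil addr0.
- by rewrite !big_cons big_nil addr0.
- by rewrite !big_cons big_nil addr0.
- by rewrite !big_cons big_nil addr0.
Qed.

Lemma sign_indefinite3 k E a b c a' b' c' :
  [&& -1 <= a <= 1, -1 <= b <= 1 & -1 <= c <= 1] ->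
  [&& -1 <= a' <= 1, -1 <= b' <= 1 & -1 <= c' <= 1] ->
  a + b + c = E -> a' + b' + c' = E ->
  velocity k a + velocity k b + velocity k c <= 0 ->
  0 <= velocity k a' + velocity k b' + velocity k c' ->
  sign_indefinite k 3 E.
Proof.
move=> /and3P[ha hb hc] /and3P[ha' hb' hc'] e1 e2 h1 h2.
apply: (@sign_indefinite_seq k 3 E [:: a; b; c] [:: a'; b'; c']) => //.
- by move=> y; rewrite !inE => /or3P[] /eqP ->.
- by move=> y; rewrite !inE => /or3P[] /eqP ->.
- by rewrite !big_cons big_nil addr0 addrA.
- by rewrite !big_cons big_nil addr0 addrA.
- by rewrite !big_cons big_nil addr0 addrA.
- by rewrite !big_cons big_nil addr0 addrA.
Qed.

Lemma sign_definite1N k E : velocity k E < 0 -> sign_definite k 1 E.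
Proof.
move=> vE; exists (-1); [by right|move=> x [_]].
by rewrite !big_ord1 => ->; rewrite mulN1r oppr_gt0.
Qed.

Lemma sign_definite2N k E :
  (forall a b, a + b = E -> velocity k a + velocity k b < 0) -> sign_definite k 2 E.
Proof.
move=> h; exists (-1); [by right|move=> x [_]].
rewrite !big_ord_recl !big_ord0 !addr0 => /h.
by rewrite mulN1r oppr_gt0.
Qed.

Local Lemma velocity2_1 : velocity 2 (1 : R) = 0. Proof. by rewrite velocity2E; ring. Qed.
Local Lemma velocity3_1 : velocity 3 (1 : R) = 0. Proof. by rewrite velocity3E; ring. Qed.
Local Lemma velocity4_1 : velocity 4 (1 : R) = 0. Proof. by rewrite velocity4E; ring. Qed.
Local Lemma velocity2_0 : velocity 2 (0 : R) = 0. Proof. by rewrite velocity2E; ring. Qed.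
Local Lemma velocity4_0 : velocity 4 (0 : R) = 0. Proof. by rewrite velocity4E; ring. Qed.

Lemma sign_definite_top2 d E : d%:R - 1 < E < d%:R -> sign_definite 2 d E.
Proof.
move=> hE; apply: (@sign_definite_top 2 d E 0 (lexx 0) velocity2_1) => //.
- exact: velocity2_gt0.
- by rewrite addr0.
Qed.

Lemma sign_definite_top3 d E : d%:R - 2^-1 < E < d%:R -> sign_definite 3 d E.
Proof.
move=> /andP[E1 E2]; apply: (@sign_definite_top 3 d E 2^-1 _ velocity3_1) => //.
- exact: velocity3_gt0.
- by apply/andP; split; lra.
Qed.

Lemma sign_definite_top4 d E : d%:R - 1 + (Num.sqrt 2)^-1 < E < d%:R ->
  sign_definite 4 d E.
Proof.
move=> /andP[E1 E2]; apply: (@sign_definite_top 4 d E (Num.sqrt 2)^-1 _ velocity4_1) =>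
  //.
- exact: velocity4_gt0.
- by rewrite E1.
Qed.

Lemma open_part_definite k d E : (1 <= d <= 3)%N -> (2 <= k <= 4)%N ->
  open_part k d E -> 0 <= E <= d%:R /\ sign_definite k d E.
Proof.
have [t [t1 t2 tt t3 t4]] := @sqrt2_facts R.
have [q [q1 q2 qq c30 c32]] := @threshold3_facts R.
have [r [r1 r2 rr c40 c42]] := @threshold4_facts R.
rewrite /threshold3 in c30 c32; rewrite /threshold4 in c40 c42.
case: d => [//|[|[|[|//]]]] _; case: k => [//|[//|[|[|[|//]]]]] _ /=;
  rewrite ?in_itv /=.
- move=> hE; split; first by case/andP: hE => /ltW -> /ltW ->.
  by apply: sign_definite_top2; rewrite subrr.
- move=> []; rewrite /= ?in_itv /= => /andP[E0 E1] Eh; split; first by rewrite E0 ltW.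
  have [h|h|h] := ltgtP E 2^-1.
  + by apply/sign_definite1N/velocity3_lt0; apply/andP; split; lra.
  + by apply: sign_definite_top3; apply/andP; split; lra.
  + by case: Eh.
- move=> []; rewrite /= ?in_itv /= => /andP[E0 E1] Eh; split; first by rewrite !ltW.
  have [h|h|h] := ltgtP E (Num.sqrt 2)^-1.
  + by apply/sign_definite1N/velocity4_lt0; apply/andP; split.
  + by apply: sign_definite_top4; rewrite subrr add0r h.
  + by case: Eh.
- move=> /andP[E1 E2]; split; first by apply/andP; split; lra.
  by apply: sign_definite_top2; apply/andP; split; lra.
- case; rewrite /= ?in_itv /= => /andP[E1 E2]; split;
  try (by rewrite ?t1 ?t2 in E1 E2; apply/andP; split; lra).
    by apply: sign_definite2N => a b ab; apply: velocity3_band; rewrite ab E1.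
  by apply: sign_definite_top3; apply/andP; split; lra.
- case; rewrite /= ?in_itv /= => /andP[E1 E2]; split;
  try (by rewrite ?t1 ?t2 in E1 E2; apply/andP; split; lra).
    by apply: sign_definite2N => a b ab; apply: velocity4_band; rewrite ab E1.
  by apply: sign_definite_top4; apply/andP; split; lra.
- move=> /andP[E1 E2]; split; first by apply/andP; split; lra.
  by apply: sign_definite_top2; apply/andP; split; lra.
- move=> /andP[E1 E2]; split; first by apply/andP; split; lra.
  by apply: sign_definite_top3; apply/andP; split; lra.
- move=> /andP[E1 E2]; split; first by apply/andP; split; lra.
  by apply: sign_definite_top4; apply/andP; split; lra.
Qed.

Local Lemma velocity3_Nhalf : velocity 3 (- 2^-1 : R) = 0. Proof.
  by rewrite velocity3E; field. Qed.
Local Lemma velocity3_N1 : velocity 3 (- 1 : R) = 0. Proof.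
  by rewrite velocity3N velocity3_1. Qed.
Local Lemma velocity3_half : velocity 3 (2^-1 : R) = 0. Proof. by rewrite velocity3E;
  field. Qed.
Local Lemma velocity4_inv_sqrt2 : velocity 4 ((Num.sqrt 2)^-1 : R) = 0.
Proof.
rewrite velocity4E; have [t [_ -> tt _ _]] := @sqrt2_facts R.
by rewrite (_ : 2 * (t / 2) ^+ 2 - 1 = (t * t - 2) / 2); [rewrite tt; field|field].
Qed.

Local Lemma box1 : -1 <= (1 : R) <= 1. Proof. by apply/andP; split; lra. Qed.

Lemma sign_indefinite_max2 k : velocity k (1 : R) = 0 -> sign_indefinite k 2 2.
Proof.
move=> v1; apply: (@sign_indefinite2 k 2 1 1 1 1); rewrite ?v1 ?addr0//.
by rewrite box1.
Qed.

Lemma sign_indefinite_max3 k : velocity k (1 : R) = 0 -> sign_indefinite k 3 3.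
Proof.
move=> v1; apply: (@sign_indefinite3 k 3 1 1 1 1 1 1); rewrite ?v1 ?addr0//.
- by rewrite box1.
- by rewrite box1.
- by ring.
- by ring.
Qed.

Lemma sign_indefinite_k2_d2 E : 0 <= E <= 1 -> sign_indefinite 2 2 E.
Proof.
move=> /andP[E0 E1]; apply: (@sign_indefinite2 2 E 1 (E - 1) (E / 2) (E / 2)).
- by apply/and4P; split; apply/andP; split; lra.
- by ring.
- by field.
- by rewrite velocity2_1 add0r velocity2_le0//; apply/andP; split; lra.
- by rewrite addr_ge0// velocity2_ge0//; apply/andP; split; lra.
Qed.

Lemma sign_indefinite_k3_d2_low E : 0 <= E <= threshold3 -> sign_indefinite 3 2 E.
Proof.
have [q [q1 q2 qq c30 c32]] := @threshold3_facts R.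
have c3 : threshold3 < 1 :> R by rewrite ltNge; apply/negP => h; nra.
move=> hE; have [a [b [ha hb ab v0]]] := velocity3_witness hE.
move/andP: hE => [E0 E1].
apply: (@sign_indefinite2 3 E (E / 2) (E / 2) a b) => //.
- by rewrite ha hb !andbT; apply/andP; split; apply/andP; split; lra.
- by field.
have h : velocity 3 (E / 2) <= 0 by apply: velocity3_le0; apply/andP; split; lra.
lra.
Qed.

Lemma sign_indefinite_k3_d2_high E : 1 <= E <= 3 / 2 -> sign_indefinite 3 2 E.
Proof.
move=> /andP[E0 E1]; apply: (@sign_indefinite2 3 E 1 (E - 1) (E / 2) (E / 2)).
- by apply/and4P; split; apply/andP; split; lra.
- by ring.
- by field.
- by rewrite velocity3_1 add0r velocity3_le0//; apply/andP; split; lra.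
- by rewrite addr_ge0// velocity3_ge0//; apply/andP; split; lra.
Qed.

Lemma sign_indefinite_k4_d2_low E : 0 <= E <= threshold4 -> sign_indefinite 4 2 E.
Proof.
have [t [t1 t2 tt t3 t4]] := @sqrt2_facts R.
have [r [r1 r2 rr c40 c42]] := @threshold4_facts R.
have c4 : threshold4 < 11 / 10 :> R by rewrite ltNge; apply/negP => h; nra.
move=> hE; have [a [b [ha hb ab v0]]] := velocity4_witness hE.
move/andP: hE => [E0 E1].
apply: (@sign_indefinite2 4 E (E / 2) (E / 2) a b) => //.
- by rewrite ha hb !andbT; apply/andP; split; apply/andP; split; lra.
- by field.
have h : velocity 4 (E / 2) <= 0.
  by apply: velocity4_le0; rewrite t2; apply/andP; split; lra.
lra.
Qed.

Lemma sign_indefinite_k4_d2_high E : Num.sqrt 2 <= E <= 1 + Num.sqrt 2 / 2 ->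
  sign_indefinite 4 2 E.
Proof.
have [t [t1 t2 tt t3 t4]] := @sqrt2_facts R; rewrite t1.
move=> /andP[E0 E1]; apply: (@sign_indefinite2 4 E 1 (E - 1) (E / 2) (E / 2)).
- by apply/and4P; split; apply/andP; split; lra.
- by ring.
- by field.
- by rewrite velocity4_1 add0r velocity4_le0// t2; apply/andP; split; lra.
- by rewrite addr_ge0// velocity4_ge0// t2; apply/andP; split; lra.
Qed.

Lemma sign_indefinite_k2_d3 E : 0 <= E <= 2 -> sign_indefinite 2 3 E.
Proof.
move=> /andP[E0 E1].
have pos : 0 <= velocity 2 (E / 3) by apply: velocity2_ge0; apply/andP; split; lra.
have bE : [&& -1 <= E / 3 <= 1, -1 <= E / 3 <= 1 & -1 <= E / 3 <= 1].
  by apply/and3P; split; apply/andP; split; lra.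
have [h|h] := leP E 1.
  apply: (@sign_indefinite3 2 E 1 (E - 1) 0 (E / 3) (E / 3) (E / 3)) => //.
  - by apply/and3P; split; apply/andP; split; lra.
  - by ring.
  - by field.
  - by rewrite velocity2_1 velocity2_0 add0r addr0 velocity2_le0//; apply/andP; split;
    lra.
  - by lra.
apply: (@sign_indefinite3 2 E 1 1 (E - 2) (E / 3) (E / 3) (E / 3)) => //.
- by apply/and3P; split; apply/andP; split; lra.
- by ring.
- by field.
- by rewrite velocity2_1 !add0r velocity2_le0//; apply/andP; split; lra.
- by lra.
Qed.

(** For [E < 3/2] the nonnegative values come from points [(a, y, y)] where [a] is
    a zero of [velocity 3] chosen so that [y] stays in [[1/2, 1]]. *)
Lemma sign_indefinite_k3_d3 E : 0 <= E <= 5 / 2 -> sign_indefinite 3 3 E.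
Proof.
move=> /andP[E0 E1].
have bE : [&& -1 <= E / 3 <= 1, -1 <= E / 3 <= 1 & -1 <= E / 3 <= 1].
  by apply/and3P; split; apply/andP; split; lra.
have [h|h] := leP (3 / 2) E.
  have pos : 0 <= velocity 3 (E / 3) by apply: velocity3_ge0; apply/andP; split; lra.
  apply: (@sign_indefinite3 3 E 1 1 (E - 2) (E / 3) (E / 3) (E / 3)) => //.
  - by apply/and3P; split; apply/andP; split; lra.
  - by ring.
  - by field.
  - by rewrite velocity3_1 !add0r velocity3_le0//; apply/andP; split; lra.
  - by lra.
have neg : velocity 3 (E / 3) <= 0 by apply: velocity3_le0; apply/andP; split; lra.
have crit a y : -1 <= a <= 0 -> velocity 3 a = 0 -> y = (E - a) / 2 ->
    2^-1 <= y <= 1 -> sign_indefinite 3 3 E.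
  move=> /andP[a1 a2] va yE hy; have pos := velocity3_ge0 hy; move/andP: hy => [y1 y2].
  apply: (@sign_indefinite3 3 E (E / 3) (E / 3) (E / 3) a y y) => //.
  - by apply/and3P; split; apply/andP; split; lra.
  - by field.
  - by rewrite yE; field.
  - by lra.
  - by rewrite va; lra.
have [h1|h1] := leP E 1.
  by apply: (crit (- 1) _ _ velocity3_N1 erefl); apply/andP; split; lra.
by apply: (crit (- 2^-1) _ _ velocity3_Nhalf erefl); apply/andP; split; lra.
Qed.

(** The nonnegative values come from points with two coordinates at zeros of
    [velocity 4], the third one falling between minus the inverse of the
    square root of 2 and 0, where [velocity 4] is nonnegative. *)
Lemma sign_indefinite_k4_d3_low E : 0 <= E <= 2 -> sign_indefinite 4 3 E.
Proof.
have [t [t1 t2 tt t3 t4]] := @sqrt2_facts R; move=> /andP[E0 E1].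
have v4Nh : velocity 4 (- (t / 2)) = 0
  by rewrite velocity4N -t2 velocity4_inv_sqrt2 oppr0.
have v4h : velocity 4 (t / 2) = 0 by rewrite -t2 velocity4_inv_sqrt2.
have neg : velocity 4 (E / 3) <= 0.
  by apply: velocity4_le0; rewrite t2; apply/andP; split; lra.
have crit a b c : -1 <= a <= 1 -> -1 <= b <= 1 -> velocity 4 a = 0 -> velocity 4 b = 0 ->
    c = E - a - b -> - (t / 2) <= c <= 0 -> sign_indefinite 4 3 E.
  move=> ha hb va vb cE hc.
  apply: (@sign_indefinite3 4 E (E / 3) (E / 3) (E / 3) a b c) => //.
  - by apply/and3P; split; apply/andP; split; lra.
  - by move/andP: hc => [c1 c2]; apply/and3P; split => //; apply/andP; split; lra.
  - by field.
  - by rewrite cE; ring.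
  - by lra.
  - by rewrite va vb !add0r velocity4_ge0N// t2.
have [h1|h1] := leP E (1 - t / 2).
  by apply: (crit 1 (- (t / 2)) _ _ _ velocity4_1 v4Nh erefl); apply/andP; split; lra.
have [h2|h2] := leP E 1.
  by apply: (crit 0 1 _ _ _ velocity4_0 velocity4_1 erefl); apply/andP; split; lra.
have [h3|h3] := leP E (2 - t / 2).
  by apply: (crit 1 (t / 2) _ _ _ velocity4_1 v4h erefl); apply/andP; split; lra.
by apply: (crit 1 1 _ _ _ velocity4_1 velocity4_1 erefl); apply/andP; split; lra.
Qed.

Lemma sign_indefinite_k4_d3_high E : 3 / Num.sqrt 2 <= E <= 2 + (Num.sqrt 2)^-1 ->
  sign_indefinite 4 3 E.
Proof.
have [t [t1 t2 tt t3 t4]] := @sqrt2_facts R; rewrite t2 => /andP[E0 E1].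
have pos : 0 <= velocity 4 (E / 3).
  by apply: velocity4_ge0; rewrite t2; apply/andP; split; lra.
apply: (@sign_indefinite3 4 E 1 1 (E - 2) (E / 3) (E / 3) (E / 3)).
- by apply/and3P; split; apply/andP; split; lra.
- by apply/and3P; split; apply/andP; split; lra.
- by ring.
- by field.
- by rewrite velocity4_1 !add0r velocity4_le0// t2; apply/andP; split; lra.
- by lra.
Qed.

Lemma closed_part_indefinite k d E : (1 <= d <= 3)%N -> (2 <= k <= 4)%N ->
  closed_part k d E -> sign_indefinite k d E.
Proof.
have [t [t1 t2 tt t3 t4]] := @sqrt2_facts R.
case: d => [//|[|[|[|//]]]] _; case: k => [//|[//|[|[|[|//]]]]] _.
- by case=> ->; apply: sign_indefinite1; rewrite ?velocity2_0 ?velocity2_1//;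
  apply/andP; split; lra.
- by case=> ->; apply: sign_indefinite1; rewrite ?velocity3_half ?velocity3_1//;
  apply/andP; split; lra.
- by case=> [[]|] ->; apply: sign_indefinite1;
  rewrite ?velocity4_inv_sqrt2 ?velocity4_0 ?velocity4_1//;
    rewrite ?t2; apply/andP; split; lra.
- case=> [h|->]; last exact: sign_indefinite_max2 velocity2_1.
  by apply: sign_indefinite_k2_d2; move: h; rewrite /= in_itv.
- case=> [[h|h]|->]; last exact: sign_indefinite_max2 velocity3_1.
    by apply: sign_indefinite_k3_d2_low; move: h; rewrite /= in_itv.
  by apply: sign_indefinite_k3_d2_high; move: h; rewrite /= in_itv.
- case=> [[h|h]|->]; last exact: sign_indefinite_max2 velocity4_1.
    by apply: sign_indefinite_k4_d2_low; move: h; rewrite /= in_itv.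
  by apply: sign_indefinite_k4_d2_high; move: h; rewrite /= in_itv.
- case=> [h|->]; last exact: sign_indefinite_max3 velocity2_1.
  by apply: sign_indefinite_k2_d3; move: h; rewrite /= in_itv.
- case=> [h|->]; last exact: sign_indefinite_max3 velocity3_1.
  by apply: sign_indefinite_k3_d3; move: h; rewrite /= in_itv.
- case=> [[h|h]|->]; last exact: sign_indefinite_max3 velocity4_1.
    by apply: sign_indefinite_k4_d3_low; move: h; rewrite /= in_itv.
  by apply: sign_indefinite_k4_d3_high; move: h; rewrite /= in_itv.
Qed.

(** The upper bound comes for free from the nonempty energy surface. *)
Lemma sign_indefinite_range k d E : 0 <= E -> sign_indefinite k d E -> 0 <= E <= d%:R.
Proof.
move=> -> [[x [hx <-] _] _] /=; rewrite -[d in d%:R]card_ord -sumr_const.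
by apply: ler_sum => j _; have /andP[] := hx j.
Qed.

Lemma closed_part_ge0 k d E : (1 <= d <= 3)%N -> (2 <= k <= 4)%N ->
  closed_part k d E -> 0 <= E.
Proof.
have [t [t1 t2 tt t3 t4]] := @sqrt2_facts R.
case: d => [//|[|[|[|//]]]] _; case: k => [//|[//|[|[|[|//]]]]] _.
- by case=> ->; lra.
- by case=> ->; lra.
- by case=> [[]|] ->; rewrite ?t2; lra.
- by case=> [|->//]; rewrite /= in_itv => /andP[].
- by case=> [[]|->//]; rewrite /= in_itv /= => /andP[e1 e2]; lra.
- by case=> [[]|->//]; rewrite /= in_itv /= ?t1 => /andP[e1 e2]; lra.
- by case=> [|->//]; rewrite /= in_itv => /andP[].
- by case=> [|->//]; rewrite /= in_itv => /andP[].
- by case=> [[]|->//]; rewrite /= in_itv /= ?t2 => /andP[e1 e2]; lra.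
Qed.

End Surfaces.

Local Close Scope complex_scope.

Theorem theorem3p1 (R : realType) (d k : nat)
    (hd : (1 <= d <= 3)%N) (hk : (2 <= k <= 4)%N)
    (P : set R -> lattice_op R d) (hP : spectral_measure Delta P) :
  let mu : set R := mourre_set Delta (conjugate_op (fun=> k)) P in
  (open_part k d `<=` mu `&` `[0, d%:R]) /\
  (closed_part k d `<=` `[0, d%:R] `\` mu).
Proof.
have k0 : (0 < k)%N by case/andP: hk => /ltnW.
split=> E hE.
  have [E0 hs] := open_part_definite hd hk hE.
  split; first exact: mourre_set_definite.
  by rewrite /= in_itv.
have hs := closed_part_indefinite hd hk hE.
have E0 := sign_indefinite_range (closed_part_ge0 hd hk hE) hs.
split; first by rewrite /= in_itv.
exact: mourre_set_indefinite.
Qed.
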